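(* Let $d\geq 1$ and let $\omega=(\omega_x)_{x\in\mathbb{Z}}$ be an i.i.d. environment with law $\mathsf{P}$, with $\rho_0=(1-\omega_0)/\omega_0$. Assume that: (i) there exists $\varepsilon_0\in(0,1/2)$ such that $\mathsf{P}[\varepsilon_0\leq\omega_0\leq 1-\varepsilon_0]=1$; (ii) $\mathsf{E}(\log\rho_0)<0$; (iii) there exists $\kappa>0$ such that $\mathsf{E}(\rho_0^{\kappa})=1$, and this $\kappa$ satisfies $0<\kappa<1/2$. Let $x_1,\dots,x_d,z_1\in\mathbb{Z}$ have the same parity, i.e. $(x_1,\dots,x_d,z_1)\in(2\mathbb{Z})^{d+1}\cup(2\mathbb{Z}+1)^{d+1}$. Then $\mathbb{P}^{(x_1,\dots,x_d,z_1)}$-almost surely, there exist infinitely many $n\in\mathbb{N}$ such that $$S_n^{(1)}=S_n^{(2)}=\dots=S_n^{(d)}=Z_n.$$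
   Context: $\mathbb{N}=\{0,1,2,\dots\}$ and $\log$ is the natural logarithm. The environment $\omega=(\omega_x)_{x\in\mathbb{Z}}$ is a collection of i.i.d. random variables with values in $(0,1)$ and joint law $\mathsf{P}$; $\mathsf{E}$ is expectation under $\mathsf{P}$; $\rho_x:=(1-\omega_x)/\omega_x$ for $x\in\mathbb{Z}$. Under (i), (ii), (iii) the number $\kappa$ is unique. Given $\omega$ and $(x_1,\dots,x_d,z_1)\in\mathbb{Z}^{d+1}$, under the quenched law $P_\omega^{(x_1,\dots,x_d,z_1)}$ the processes $(S_n^{(j)})_{n\in\mathbb{N}}$, $1\leq j\leq d$, and $(Z_n)_{n\in\mathbb{N}}$ are $d+1$ independent Markov chains on $\mathbb{Z}$ with $S_0^{(j)}=x_j$ for $1\leq j\leq d$, $Z_0=z_1$, and the following transition probabilities. Each $S^{(j)}$ (a random walk in the random environment $\omega$, the same $\omega$ for all $j$) jumps from $y$ to $y+1$ with probability $\omega_y$ and from $y$ to $y-1$ with probability $1-\omega_y$. The chain $Z$ (simple random walk) jumps from $y$ to $y+1$ with probability $1/2$ and from $y$ to $y-1$ with probability $1/2$. The annealed law is $\mathbb{P}^{(x_1,\dots,x_d,z_1)}(\cdot):=\int P_\omega^{(x_1,\dots,x_d,z_1)}(\cdot)\,\mathsf{P}(\mathrm{d}\omega)$. *)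

(* Defs.v *)
From HB Require Import structures.
From mathcomp Require Import all_boot all_order all_algebra.
From mathcomp Require Import finmap.
From mathcomp Require Import all_classical all_reals all_analysis.

Set Implicit Arguments.
Unset Strict Implicit.
Unset Printing Implicit Defensive.
Import Order.TTheory GRing.Theory Num.Theory.
Import numFieldNormedType.Exports.

Local Open Scope classical_set_scope.
Local Open Scope ring_scope.

HB.instance Definition _ := isPointed.Build int 0%Z.
HB.instance Definition _ := @isMeasurable.Build default_measure_display
  int discrete_measurable discrete_measurable0
  discrete_measurableC discrete_measurableU.

Section Independence.
Context (dT : measure_display) (T : measurableType dT) (R : realType).
Variable mu : {measure set T -> \bar R}.

Definition mutually_independent (I : choiceType) (F : I -> set (set T)) : Prop :=
  forall (J : {fset I}) (A : I -> set T),
    (forall i, i \in J -> F i (A i)) ->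
    mu (\bigcap_(i in [set` J]) A i) = (\prod_(i <- J) mu (A i))%E.

End Independence.

Definition sigma_process (dT : measure_display) (T : measurableType dT)
    (X : nat -> {mfun T >-> int}) : set (set T) :=
  <<s \bigcup_n preimage_set_system [set: T] (X n) measurable >>.

Definition iid (dE : measure_display) (E : measurableType dE) (R : realType)
    (P : probability E R) (I : choiceType) (X : I -> {RV P >-> R}) : Prop :=
  mutually_independent P
    (fun i => preimage_set_system [set: E] (X i) measurable) /\
  (forall i j (B : set R), measurable B ->
     distribution P (X i) B = distribution P (X j) B).

Definition rho (R : realType) (w : R) : R := (1 - w) / w.

(* Jump up with probability [a y], down with probability [1 - a y]. *)
Definition nn_transition (R : realType) (a : int -> R) (y y' : int) : R :=
  if y' == y + 1 then a y else if y' == y - 1 then 1 - a y else 0.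

(* The Markov property is multiplied out, so that histories of probability
   zero need no separate treatment. *)
Definition markov_chain (dT : measure_display) (T : measurableType dT)
    (R : realType) (mu : {measure set T -> \bar R})
    (x0 : int) (p : int -> int -> R) (X : nat -> {mfun T >-> int}) : Prop :=
  mu [set t | X 0%N t = x0] = 1%E /\
  forall (n : nat) (y : nat -> int),
    mu [set t | forall k, (k <= n.+1)%N -> X k t = y k] =
    (mu [set t | forall k, (k <= n)%N -> X k t = y k] *
     (p (y n) (y n.+1))%:E)%E.

(* The d + 1 processes are indexed by [option 'I_d], with [None] for Z. *)
Definition walks (dT : measure_display) (T : measurableType dT) (d : nat)
    (S : 'I_d -> nat -> {mfun T >-> int}) (Z : nat -> {mfun T >-> int})
    (i : option 'I_d) : nat -> {mfun T >-> int} :=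
  if i is Some j then S j else Z.

Definition quenched_law (dT : measure_display) (T : measurableType dT)
    (R : realType) (w : int -> R) (d : nat) (x : 'I_d -> int) (z : int)
    (S : 'I_d -> nat -> {mfun T >-> int}) (Z : nat -> {mfun T >-> int})
    (mu : {measure set T -> \bar R}) : Prop :=
  [/\ forall j : 'I_d, markov_chain mu (x j) (nn_transition w) (S j),
      markov_chain mu z (nn_transition (fun=> 2^-1)) Z &
      mutually_independent mu (fun i => sigma_process (walks S Z i))].

Section Annealed.
Local Open Scope ereal_scope.
Context (dE : measure_display) (E : measurableType dE)
  (dT : measure_display) (T : measurableType dT) (R : realType).
Variables (P : probability E R) (Q : R.-pker E ~> T).

Definition annealed (A : set T) : \bar R := \int[P]_e Q e A.

Let annealed0 : annealed set0 = 0.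
Proof. by rewrite /annealed integral0_eq. Qed.

Let annealed_ge0 A : 0 <= annealed A.
Proof. exact: integral_ge0. Qed.

Let annealed_sigma_additive : semi_sigma_additive annealed.
Proof.
move=> U mU tU mUU; rewrite [X in _ --> X](_ : _ =
  \int[P]_e (\sum_(n <oo) Q e (U n))); last first.
  apply: eq_integral => e _.
  by apply/esym/cvg_lim => //; exact/measure_semi_sigma_additive.
apply/cvg_closeP; split.
  by apply: is_cvg_nneseries => n _ _; exact: integral_ge0.
rewrite closeE// integral_nneseries// => n.
exact: measurable_kernel.
Qed.

HB.instance Definition _ := isMeasure.Build _ _ _ annealed
  annealed0 annealed_ge0 annealed_sigma_additive.

Let annealed_setT : annealed [set: T] = 1.
Proof.
rewrite /annealed (eq_integral (cst 1)) => [|e _]; last exact: prob_kernel.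
by rewrite integral_cst// mul1e; exact: probability_setT.
Qed.

HB.instance Definition _ := Measure_isProbability.Build _ _ _ annealed
  annealed_setT.

End Annealed.

Definition same_parity (d : nat) (x : 'I_d -> int) (z : int) : Prop :=
  ((forall j, (2 %| x j)%Z) /\ (2 %| z)%Z) \/
  ((forall j, ~~ (2 %| x j)%Z) /\ ~~ (2 %| z)%Z).

(* Main.v *)
Require Import Defs.
From HB Require Import structures.
From mathcomp Require Import all_boot all_order all_algebra finmap.
From mathcomp Require Import all_classical all_reals all_analysis.
From mathcomp Require Import measurable_realfun.
From mathcomp Require Import ring lra zify.

Set Implicit Arguments.
Unset Strict Implicit.
Unset Printing Implicit Defensive.
Import Order.TTheory GRing.Theory Num.Theory.
Import numFieldNormedType.Exports.

Local Open Scope classical_set_scope.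
Local Open Scope ring_scope.

(** Write E = exp (- V) for the weight attached to the potential V of the
    environment, so that E (y - 1) = rho_y E y, and B y for the sum of E over
    all sites up to y, which is finite because the walk drifts to the right.
    The argument has a quenched half and an environment half.

    Quenched half.  Suppose that a site b is followed by a site m that takes very
    long to be reached from b: E m is smaller than E b by a factor that exceeds
    the time at stake, while the mass B (m - 1) on the left of m
    is at most C E b.  Started from fixed points on the left of b, a walker
    needs a time of order sum_(y < b) B y / E y to reach b, and the simple walk
    Z a time of order b^2.  Over such times the walker, once at b, is confined
    to the left of m, where the reversible measure has mass O(E b); by the
    Cauchy-Schwarz inequality it is therefore at b, at each even time after the
    first visit, with probability bounded below ([valley_return]).  Look at the
    first time after a large t at which Z is at b.  Given Z, the d walkers are
    independent, so they are all at b at that time with probability bounded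
    below, by a constant that depends on the environment but neither on b nor
    on the starting points ([quenched_meeting]).  A probability of ever meeting
    that is bounded below uniformly over all positions of the right parity
    makes the d + 1 chains meet infinitely often ([avoid_geometric],
    [meet_infinitely_often]).

    Environment half.  It remains to find such pairs (b, m), called valleys,
    arbitrarily far to the right.  Put beta = rho^(kappa / 2).  Then beta^2 has
    mean 1, and beta has mean q < 1 because rho is not almost surely 1.  The
    depth E b / E m is (beta_(b+1) ... beta_m)^(2 / kappa), and both B b / E b
    and the time to reach b are dominated by powers of exponent 2 / kappa and
    1 / kappa of the perpetuities xi and clock driven by beta and beta^2: this
    is superadditivity of convex powers.  The diffusive time b^2 is absorbed in
    the same way precisely because 1 / kappa >= 2.  So one needs infinitely
    many b with xi_b bounded, with (beta_(b+1) ... beta_m)^2 >= K clock_b for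
    some m > b, and with the products along the way growing geometrically, up
    to a constant.  Since beta^2 has mean 1, one trial launched at b succeeds
    with probability of order 1 / clock_b, and clock_b is of order at most
    b log b, whose inverse has a divergent sum.  Divergence of the sum of the
    success probabilities does not suffice for dependent trials, so the trials
    are run one after the other: [track] follows the current anchor b,
    abandons it as soon as the product falls below a growing floor, and dies on
    success.  A potential function bounds the sum of E[live_n / clock_n]
    ([sum_mean_live_le]), whereas a tracker surviving with positive probability
    would make it diverge ([live_vanishes], [log_harmonic_unbounded]).  Hence
    every tracker succeeds almost surely ([ae_barrier]), which gives the
    valleys ([valleys_exist], [ae_valleys]). *)

(** * Nearest-neighbour walks *)

Section Walk.
Context {R : realFieldType}.
Variable w : int -> R.

Definition walk_step (f : int -> R) (x : int) : R :=
  w x * f (x + 1) + (1 - w x) * f (x - 1).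

Definition tproba (n : nat) (x y : int) : R := iter n walk_step (fun u => (u == y)%:R) x.

(** Probability that the walk from [x] does not visit [b] at the times
    [0, ..., n]. *)
Fixpoint survival (b : int) (n : nat) (x : int) : R :=
  if n is m.+1 then (x != b)%:R * walk_step (survival b m) x else (x != b)%:R.

Lemma eq_walk_step f g : f =1 g -> walk_step f =1 walk_step g.
Proof. by move=> fg x; rewrite /walk_step !fg. Qed.

Lemma eq_iter_walk_step n f g : f =1 g -> iter n walk_step f =1 iter n walk_step g.
Proof. by move=> fg; elim: n => //= n IH; apply: eq_walk_step. Qed.

Lemma iter_walk_stepD n f g x :
  iter n walk_step (fun u => f u + g u) x = iter n walk_step f x + iter n walk_step g x.
Proof.
elim: n f g x => //= n IH f g x; rewrite {1}/walk_step !IH /walk_step; ring.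
Qed.

Lemma iter_walk_stepZ n c f x :
  iter n walk_step (fun u => c * f u) x = c * iter n walk_step f x.
Proof. by elim: n f x => //= n IH f x; rewrite {1}/walk_step !IH /walk_step; ring. Qed.

Lemma iter_walk_step_cst n c x : iter n walk_step (fun=> c) x = c.
Proof. by elim: n x => //= n IH x; rewrite /walk_step !IH; ring. Qed.

Lemma iter_walk_step_sum n (I : Type) (r : seq I) (F : I -> int -> R) x :
  iter n walk_step (fun u => \sum_(i <- r) F i u) x = \sum_(i <- r) iter n walk_step (F i) x.
Proof.
elim: r => [|i r IH].
  rewrite big_nil -[RHS](iter_walk_step_cst n 0 x).
  by apply: eq_iter_walk_step => u; rewrite big_nil.
rewrite big_cons -IH -iter_walk_stepD.
by apply: eq_iter_walk_step => u; rewrite big_cons.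
Qed.

Lemma walk_step_cst c x : walk_step (fun=> c) x = c.
Proof. exact: (iter_walk_step_cst 1). Qed.

Lemma walk_step_sum (I : Type) (r : seq I) (F : I -> int -> R) x :
  walk_step (fun u => \sum_(i <- r) F i u) x = \sum_(i <- r) walk_step (F i) x.
Proof. exact: (iter_walk_step_sum 1). Qed.

Lemma walk_step_compl f x : walk_step (fun u => 1 - f u) x = 1 - walk_step f x.
Proof. by rewrite /walk_step; ring. Qed.

Lemma tprobaS n x y : tproba n.+1 x y = w x * tproba n (x + 1) y + (1 - w x) * tproba n (x - 1) y.
Proof. by []. Qed.

Lemma tprobaSr n x y :
  tproba n.+1 x y = w (y - 1) * tproba n x (y - 1) + (1 - w (y + 1)) * tproba n x (y + 1).
Proof.
rewrite /tproba iterSr -!iter_walk_stepZ -iter_walk_stepD; apply: eq_iter_walk_step => u.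
rewrite /walk_step; congr (_ + _).
  have -> : (u + 1 == y) = (u == y - 1) by rewrite [RHS]eq_sym subr_eq eq_sym.
  by case: eqP => [->|_]; rewrite ?mulr0.
by rewrite subr_eq; case: eqP => [->|_]; rewrite ?mulr0.
Qed.

Lemma tproba_rev (p : int -> R) n x y :
  (forall y, p y * w y = p (y + 1) * (1 - w (y + 1))) ->
  p x * tproba n x y = p y * tproba n y x.
Proof.
move=> rev; elim: n x y => [|n IH] x y.
  by rewrite /tproba /= eq_sym; case: eqP => [->|]; rewrite ?mulr0.
rewrite tprobaS tprobaSr mulrDr !mulrA rev.
have -> : p x * (1 - w x) = p (x - 1) * w (x - 1) by rewrite rev subrK.
rewrite (mulrAC (p (x + 1))) (mulrAC (p (x - 1))) (IH (x + 1)) (IH (x - 1)); ring.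
Qed.

Hypothesis w01 : forall y, 0 <= w y <= 1.

Lemma walk_step_le (f g : int -> R) x :
  f (x + 1) <= g (x + 1) -> f (x - 1) <= g (x - 1) -> walk_step f x <= walk_step g x.
Proof. by move=> h1 h2; have := w01 x; rewrite /walk_step; nra. Qed.

Lemma iter_walk_step_le n (f g : int -> R) x :
  (forall u, f u <= g u) -> iter n walk_step f x <= iter n walk_step g x.
Proof. by move=> fg; elim: n x => //= n IH x; apply: walk_step_le. Qed.

Lemma iter_walk_step_ge0 n (f : int -> R) x :
  (forall u, 0 <= f u) -> 0 <= iter n walk_step f x.
Proof. by move=> f0; rewrite -(iter_walk_step_cst n 0 x); apply: iter_walk_step_le. Qed.

Lemma tproba_ge0 n x y : 0 <= tproba n x y.
Proof. by apply: iter_walk_step_ge0 => u; rewrite ler0n. Qed.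

Lemma tproba_le1 n x y : tproba n x y <= 1.
Proof.
rewrite -(iter_walk_step_cst n 1 x); apply: iter_walk_step_le => u.
by rewrite lern1 leq_b1.
Qed.

Lemma survival_ge0 b n x : 0 <= survival b n x.
Proof.
elim: n x => [|n IH] x /=; first by rewrite ler0n.
by rewrite mulr_ge0 ?ler0n// -[0](iter_walk_step_cst 1 0 x); apply: walk_step_le.
Qed.

Lemma survival_le1 b n x : survival b n x <= 1.
Proof.
elim: n x => [|n IH] x /=; first by rewrite lern1 leq_b1.
apply: (@le_trans _ _ (walk_step (survival b n) x)).
  rewrite ler_piMl ?lern1 ?leq_b1//.
  by rewrite -[0](iter_walk_step_cst 1 0 x); apply: walk_step_le => //; apply: survival_ge0.
by rewrite -[leRHS](iter_walk_step_cst 1 1 x); apply: walk_step_le.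
Qed.

Lemma iter_walk_step_local n f g x :
  (forall u, x - n%:Z <= u <= x + n%:Z -> f u = g u) ->
  iter n walk_step f x = iter n walk_step g x.
Proof.
elim: n x => [|n IH] x fg; first by apply: fg; lia.
by rewrite /= /walk_step !IH// => u ?; apply: fg; lia.
Qed.

(** To be at or beyond [m] at time [k], a walk started on the left must have
    visited [m] by then, and the expected number of visits bounds the
    probability of at least one. *)
Lemma tail_le_green (m : int) k (x : int) : x <= m ->
  iter k walk_step (fun u => (m <= u)%R%:R) x <= \sum_(j < k.+1) tproba j x m.
Proof.
elim: k x => [|k IH] x xm.
  by rewrite big_ord1 /tproba /= eq_le xm.
have [->|xNm] := eqVneq x m.
  rewrite big_ord_recl /tproba /= eqxx.
  apply: (@le_trans _ _ 1).
    rewrite -[leRHS](iter_walk_step_cst k.+1 1 m).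
    by apply: (@iter_walk_step_le k.+1) => u; rewrite lern1 leq_b1.
  by rewrite lerDl sumr_ge0// => j _; exact: (@tproba_ge0 (bump 0 j)).
rewrite big_ord_recl /tproba /= (negbTE xNm) add0r.
have H : x < m by rewrite lt_neqAle xNm.
apply: (le_trans (y := walk_step (fun u => \sum_(j < k.+1) tproba j u m) x)).
  by apply: walk_step_le; apply: IH; lia.
have := @iter_walk_step_sum 1 _ (index_enum 'I_k.+1) (fun j u => tproba j u m) x.
by move=> /= ->; apply: ler_sum => j _.
Qed.

(** Keep in the Chapman-Kolmogorov sum for [p_(2k)(b, b)] the intermediate
    points in [s]; reversibility turns each term into
    [p_k(b, y)^2 p b / p y], and the Cauchy-Schwarz inequality concludes. *)
Lemma return_lower (p : int -> R) (b : int) (k : nat) (s : seq int) :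
  (forall y, p y * w y = p (y + 1) * (1 - w (y + 1))) ->
  (forall y, 0 < p y) -> uniq s ->
  (\sum_(y <- s) tproba k b y) ^+ 2 * p b <= tproba (k + k) b b * \sum_(y <- s) p y.
Proof.
move=> rev p0 us.
have CK : \sum_(y <- s) tproba k y b * tproba k b y <= tproba (k + k) b b.
  rewrite /tproba iterD.
  have -> : \sum_(y <- s) tproba k y b * tproba k b y =
     iter k walk_step (fun u => \sum_(y <- s) tproba k y b * (u == y)%:R) b.
    rewrite iter_walk_step_sum; apply: eq_bigr => y _.
    by rewrite iter_walk_stepZ.
  apply: iter_walk_step_le => u.
  have [us'|uNs] := boolP (u \in s).
    rewrite (big_rem u us') /= eqxx mulr1 big_seq big1 ?addr0// => y.
    by rewrite mem_rem_uniq// inE eq_sym => /andP[/negbTE->]; rewrite mulr0.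
  rewrite big_seq big1; first exact: tproba_ge0.
  by move=> y ys; case: eqP uNs => [->|_ _]; rewrite ?ys ?mulr0.
apply: le_trans (ler_wpM2r _ CK); last first.
  by apply: sumr_ge0 => y _; exact: ltW.
have -> : \sum_(y <- s) tproba k y b * tproba k b y = \sum_(y <- s) tproba k b y ^+ 2 / p y * p b.
  apply: eq_bigr => y _; have e := tproba_rev k b y rev; have y0 := p0 y.
  apply: (mulfI (lt0r_neq0 y0)).
  by rewrite mulrA -e; field; lra.
rewrite -mulr_suml [leRHS]mulrAC; apply: ler_wpM2r; first exact: ltW.
set X := \sum_(y <- s) tproba k b y; set Y := \sum_(y <- s) p y.
have [Y0|Y0] := eqVneq Y 0.
  have s0 : s = [::].
    move: Y0; rewrite /Y; case: (s) => // a s'; rewrite big_cons => h.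
    have : 0 < p a + \sum_(j <- s') p j.
      by rewrite ltr_pwDl// sumr_ge0// => j _; exact: ltW.
    by rewrite h ltxx.
  by rewrite /X /Y s0 !big_nil expr0n mul0r.
have Yp : 0 < Y by rewrite lt_neqAle eq_sym Y0 sumr_ge0// => j _; exact: ltW.
rewrite -ler_pdivrMr//.
(* Cauchy-Schwarz as the tangent inequality a^2 / p >= 2 t a - t^2 p at the
   optimal slope t = X / Y. *)
set t := X / Y.
apply: (@le_trans _ _ (\sum_(y <- s) (2 * t * tproba k b y - t ^+ 2 * p y))).
  rewrite sumrB -!mulr_sumr -/X -/Y.
  have -> : X ^+ 2 / Y = t * X by rewrite /t expr2 mulrAC.
  have -> : t ^+ 2 * Y = t * X by rewrite expr2 -mulrA divfK ?gt_eqF// mulrC.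
  lra.
apply: ler_sum => y _.
have py := p0 y; rewrite ler_pdivlMr//.
rewrite -subr_ge0.
have -> : tproba k b y ^+ 2 - (2 * t * tproba k b y - t ^+ 2 * p y) * p y =
  (tproba k b y - t * p y) ^+ 2 by ring.
by rewrite sqr_ge0.
Qed.

End Walk.

(** * Valleys of the potential *)

Definition evenz (x : int) : bool := (2 %| x)%Z.

Lemma evenzD1 x : evenz (x + 1) = ~~ evenz x.
Proof. by rewrite /evenz; lia. Qed.

Lemma evenzB1 x : evenz (x - 1) = ~~ evenz x.
Proof. by rewrite -[in RHS](subrK 1 x) evenzD1 negbK. Qed.

Section Survival.
Context {R : realFieldType}.
Variable w : int -> R.
Hypothesis w01 : forall y, 0 <= w y <= 1.

(** Markov inequality for the hitting time of [b], whose mean is dominated by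
    any nonnegative [T] that decreases by at least 1 on average per step. *)
Lemma survival_le_supersol (T : int -> R) (b : int) (N : nat) (x : int) :
  (forall y, y <= b -> 0 <= T y) ->
  (forall y, y < b -> walk_step w T y <= T y - 1) ->
  x <= b -> survival w b N x * N%:R <= T x.
Proof.
move=> T0 TS xb.
suff H : forall k y, (k <= N)%N -> y <= b ->
    survival w b k y * N%:R <= T y + (N%:R - k%:R).
  by have := H N x (leqnn _) xb; rewrite subrr addr0.
elim=> [|k IH] y kN yb /=.
  rewrite subr0; apply: ler_wpDl; first exact: T0.
  by rewrite ler_piMl// ?ler0n// lern1 leq_b1.
have [->|yNb] := eqVneq y b.
  by rewrite !mul0r addr_ge0 ?T0// subr_ge0 ler_nat.
have ylt : y < b by rewrite lt_neqAle yNb.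
rewrite mul1r.
have h1 := IH (y + 1) (ltnW kN) ltac:(lia).
have h2 := IH (y - 1) (ltnW kN) ltac:(lia).
have := TS y ylt; have := w01 y.
move: h1 h2; rewrite /walk_step -natr1.
set s1 := survival _ _ _ _; set s2 := survival _ _ _ _; nra.
Qed.

(** Strong Markov property at the first visit to [b]: by parity an even time
    is left to return to [b]. *)
Lemma tproba_ge_survival (c : R) (b x : int) (n : nat) : 0 <= c ->
  (forall k, (k + k <= n)%N -> c <= tproba w (k + k) b b) ->
  x <= b -> evenz (x - b) = ~~ odd n ->
  c * (1 - survival w b n x) <= tproba w n x b.
Proof.
move=> c0; elim: n x => [|n IH] x H xb par.
  have [->|xNb] := eqVneq x b.
    have := H 0%N isT; rewrite /= eqxx/=; lra.
  by rewrite /= xNb /= subrr mulr0 /tproba; rewrite ler0n.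
have [xe|xNb] := eqVneq x b.
  have ev : ~~ odd n.+1 by rewrite -par xe subrr.
  have -> : n.+1 = (n.+1./2 + n.+1./2)%N by rewrite addnn even_halfK.
  rewrite xe; apply: le_trans (H _ _); last by rewrite addnn even_halfK.
  rewrite ler_piMr//; have := survival_ge0 w01 b (n.+1./2 + n.+1./2) b; lra.
have xlt : x < b by rewrite lt_neqAle xNb.
rewrite tprobaS /= xNb mul1r.
have Hn k : (k + k <= n)%N -> c <= tproba w (k + k) b b by move=> ?; apply: H; lia.
have h1 := IH (x + 1) Hn ltac:(lia) ltac:(rewrite addrAC evenzD1 par /= negbK //).
have h2 := IH (x - 1) Hn ltac:(lia) ltac:(rewrite addrAC evenzB1 par /= negbK //).
have := w01 x; rewrite /walk_step; move: h1 h2.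
set s1 := survival _ _ _ _; set s2 := survival _ _ _ _.
set t1 := tproba _ _ _ _; set t2 := tproba _ _ _ _; nra.
Qed.

End Survival.

Section SRW.
Context {R : realFieldType}.
Local Notation h := (fun=> 2^-1 : R).

Lemma half01 (y : int) : 0 <= (2^-1 : R) <= 1.
Proof. by rewrite invr_ge0 ler0n invf_le1 ?ler1n. Qed.

(** The function [2 L |x - b| - (x - b)^2] is the mean hitting time of [b] for
    the simple walk reflected at distance [L]; it controls survival within that
    distance, and farther away the bound exceeds 1. *)
Lemma survival_half (b x : int) (L : nat) : (0 < L)%N ->
  survival h b (L * L) x <= 4^-1 + 4 * (x - b)%:~R ^+ 2 / L%:R ^+ 2.
Proof.
move=> L0; have L0' : 0 < L%:R :> R by rewrite ltr0n.
have G k y : (k <= L * L)%N -> `|(y - b)%:~R| <= L%:R :> R ->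
    survival h b k y * L%:R ^+ 2 <=
    2 * L%:R * `|(y - b)%:~R| - (y - b)%:~R ^+ 2 + L%:R ^+ 2 - k%:R.
  elim: k y => [|k IH] y kL; have [t te] : exists t, t = y - b by exists (y - b).
    rewrite -te => tL.
    have : survival h b 0 y * L%:R ^+ 2 <= L%:R ^+ 2.
      by rewrite ler_piMl ?sqr_ge0//; exact: (survival_le1 (w := h) half01).
    have : 0 <= `|t%:~R| * (L%:R - `|t%:~R|) :> R by rewrite mulr_ge0 ?subr_ge0.
    have : 0 <= `|t%:~R| * L%:R :> R by rewrite mulr_ge0.
    have -> : t%:~R ^+ 2 = `|t%:~R| ^+ 2 :> R by rewrite real_normK ?num_real.
    by move: (survival _ _ _ _ * _) (`|t%:~R| : R) tL => *; lra.
  rewrite -te => tL.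
  have kL' : k.+1%:R <= L%:R ^+ 2 :> R by rewrite expr2 -natrM ler_nat.
  have [tz|t0] := eqVneq t 0.
    have yb : y = b by move: tz; rewrite te; lia.
    by rewrite /= yb eqxx/= !mul0r tz mulr0z normr0; lra.
  have [tLe|tLN] := eqVneq (`|t%:~R| : R) L%:R.
    have : survival h b k.+1 y * L%:R ^+ 2 <= L%:R ^+ 2.
      by rewrite ler_piMl ?sqr_ge0//; exact: (survival_le1 (w := h) half01).
    have -> : t%:~R ^+ 2 = `|t%:~R| ^+ 2 :> R by rewrite real_normK ?num_real.
    rewrite tLe; move: kL'; move: (survival _ _ _ _ * _) (k.+1%:R : R) => s1 k1; lra.
  have yNb : y != b by apply: contra_neq t0 => e; rewrite te e subrr.
  have tL1 : `|t%:~R| <= L%:R - 1 :> R.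
    have Lz : L%:R = (L%:Z)%:~R :> R by [].
    move: tL tLN; rewrite -intr_norm Lz ler_int eqr_int => tL tLN.
    by rewrite -[1]/(1%:~R) -intrB ler_int; lia.
  have H (u : int) : `|(t + u)%:~R| <= `|t%:~R| + `|u%:~R| :> R.
    by rewrite intrD ler_normD.
  have h1 := IH (y + 1) (ltnW kL); have h2 := IH (y - 1) (ltnW kL).
  have e1 : y + 1 - b = t + 1 by rewrite te addrAC.
  have e2 : y - 1 - b = t - 1 by rewrite te addrAC.
  rewrite e1 in h1; rewrite e2 in h2.
  have {}h1 := h1 ltac:(apply: le_trans (H 1) _; rewrite normr1; lra).
  have {}h2 := h2 ltac:(apply: le_trans (H (-1)) _; rewrite mulrN1z normrN1; lra).
  have hs : `|(t + 1)%:~R| + `|(t - 1)%:~R| = 2 * `|t%:~R| :> R.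
    rewrite -!intr_norm -intrD -[2]/(2%:~R) -intrM; congr (_%:~R); clear -t0; lia.
  have q1 : (t + 1)%:~R ^+ 2 = t%:~R ^+ 2 + 2 * t%:~R + 1 :> R.
    by rewrite intrD; ring.
  have q2 : (t - 1)%:~R ^+ 2 = t%:~R ^+ 2 - 2 * t%:~R + 1 :> R.
    by rewrite intrB; ring.
  rewrite /= yNb mul1r /walk_step -[k.+1%:R]natr1 /=.
  move: h1 h2; rewrite {}q1 {}q2.
  move: hs; move: (`|(t + 1)%:~R| : R) (`|(t - 1)%:~R| : R) => n1 n2.
  move: (`|t%:~R| : R) (survival _ _ _ (y + 1)) (survival _ _ _ (y - 1)) => n0 s1 s2.
  move=> hs h1 h2; have -> : 2 * L%:R * n0 = L%:R * (n1 + n2) by rewrite hs; ring.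
  rewrite [L%:R * (n1 + n2)]mulrDr.
  have -> : (2^-1 * s1 + (1 - 2^-1) * s2) * L%:R ^+ 2 =
      2^-1 * (s1 * L%:R ^+ 2 + s2 * L%:R ^+ 2) by field.
  move: h1 h2; rewrite mulrDr.
  have -> : 2 * L%:R * n1 = 2 * (L%:R * n1) by ring.
  have -> : 2 * L%:R * n2 = 2 * (L%:R * n2) by ring.
  move: (s1 * _) (s2 * _) (L%:R * n1) (L%:R * n2) => a1 a2 a3 a4.
  lra.
have LL0 : 0 < L%:R ^+ 2 :> R by rewrite exprn_gt0.
set t : R := (x - b)%:~R.
have [tL|tL] := leP `|t| L%:R.
  have := G (L * L)%N x (leqnn _) tL; rewrite natrM -/t.
  move=> hG; rewrite -(ler_pM2r LL0); apply: (le_trans hG).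
  rewrite [leRHS]mulrDl divfK ?gt_eqF//.
  have -> : t ^+ 2 = `|t| ^+ 2 :> R by rewrite real_normK ?num_real.
  have : 0 <= `|t| by []. move: (`|t|) => u u0.
  have : 0 <= (L%:R / 2 - 2 * u) ^+ 2 by rewrite sqr_ge0.
  nra.
apply: le_trans (survival_le1 (w := h) half01 _ _ _) _.
have : 1 <= t ^+ 2 / L%:R ^+ 2.
  rewrite ler_pdivlMr// mul1r -[t ^+ 2]real_normK ?num_real//.
  by rewrite lerXn2r ?nnegrE ?ler0n// ltW.
by rewrite -mulrA; lra.
Qed.

Lemma iter_half_sqr t (A C : R) (b z : int) :
  iter t (walk_step h) (fun u => A + C * (u - b)%:~R ^+ 2) z =
  A + C * ((z - b)%:~R ^+ 2 + t%:R).
Proof.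
elim: t z => [|t IH] z /=; first by rewrite addr0.
rewrite /walk_step !IH -[t.+1%:R]natr1 !intrD !intrN /=; field; exact: isT.
Qed.

End SRW.

(** Discrete primitives on all of [int], used for the potential, for the left
    mass and for the mean hitting times. *)
Lemma int_primitive (V : zmodType) (f : int -> V) (c : V) :
  exists2 F : int -> V, (forall y, F (y + 1) = F y + f y) &
    forall n : nat, F n = c + \sum_(0 <= i < n) f i.
Proof.
pose F (y : int) := match y with
  | Posz n => c + \sum_(0 <= i < n) f i
  | Negz n => c - \sum_(0 <= i < n.+1) f (- i.+1%:Z) end.
exists F => // -[n|[|n]].
- by rewrite -PoszD addn1 /= big_nat_recr//= addrA.
- by rewrite /= big_nat1 big_geq// addr0 subrK.
rewrite (_ : Negz n.+1 + 1 = Negz n); last by lia.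
by rewrite /= [in RHS]big_nat_recr//= opprD addrA -NegzE subrK.
Qed.

(** [E] is the exponential of minus the potential, [E y / w y] is a reversible
    measure, and [B y] plays the part of the sum of [E] over the sites up to
    [y]; an additive constant in [B] is harmless, hence the mere recurrence. *)
Section Valley.
Context {R : realFieldType}.
Variables (w : int -> R) (eps : R) (E B : int -> R).
Hypothesis eps0 : 0 < eps.
Hypothesis wE : forall y, eps <= w y <= 1 - eps.
Hypothesis E0 : forall y, 0 < E y.
Hypothesis EE : forall y, E (y - 1) * w y = (1 - w y) * E y.
Hypothesis B0 : forall y, 0 <= B y.
Hypothesis BE : forall y, B y = B (y - 1) + E y.

Let w01 y : 0 <= w y <= 1.
Proof. have h := wE y; have e := eps0; apply/andP; split; lra. Qed.

Lemma sum_seq_primitive (a : int) (n : nat) :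
  \sum_(y <- [seq a + i%:Z | i <- iota 0 n]) E y = B (a + n%:Z - 1) - B (a - 1).
Proof.
rewrite big_map; elim: n => [|n IH]; first by rewrite big_nil addr0 subrr.
rewrite -[n.+1]addn1 iotaD big_cat IH /= big_seq1 add0n.
have -> : a + (n + 1)%N%:Z - 1 = a + n%:Z by lia.
by rewrite [B (a + n%:Z)]BE addrAC.
Qed.

(** By reversibility the expected number of visits to [m] before time [k] is at
    most [(k + 1) (E m / eps) / E b], so the walk stays on the left of [m] with
    probability at least 1/2; the mass there being at most [C E b / eps],
    [return_lower] applies to the interval of the sites within reach. *)
Lemma valley_return (b m : int) (C : R) (k : nat) : b < m -> 0 < C ->
  B (m - 1) <= C * E b -> k.+1%:R * E m <= eps / 2 * E b ->
  eps / (4 * C) <= tproba w (k + k) b b.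
Proof.
move=> bm C0 HB HE; have e0 := eps0.
pose p y := E y / w y.
have w0 y : 0 < w y by have := wE y; lra.
have p0 y : 0 < p y by rewrite divr_gt0.
have rev y : p y * w y = p (y + 1) * (1 - w (y + 1)).
  rewrite /p divfK ?gt_eqF//; apply: (mulIf (lt0r_neq0 (w0 (y + 1)))).
  by have := EE (y + 1); rewrite addrK => ->; field; rewrite gt_eqF.
pose n := (k + `|m - b|)%N.
pose s := [seq (b - k%:Z) + i%:Z | i <- iota 0 n].
have us : uniq s by rewrite map_inj_uniq ?iota_uniq// => i j; lia.
have := return_lower w01 b k rev p0 us.
have Sp : \sum_(y <- s) p y <= C * E b / eps.
  apply: (@le_trans _ _ (\sum_(y <- s) E y / eps)).
    apply: ler_sum => y _; apply: ler_wpM2l; first exact: ltW.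
    by rewrite lef_pV2 ?posrE//; have := wE y; lra.
  rewrite -mulr_suml sum_seq_primitive ler_pM2r ?invr_gt0//.
  have -> : b - k%:Z + n%:Z - 1 = m - 1 by rewrite /n; lia.
  by have := B0 (b - k%:Z - 1); lra.
have St : 2^-1 <= \sum_(y <- s) tproba w k b y.
  have -> : \sum_(y <- s) tproba w k b y = iter k (walk_step w) (fun u => (u \in s)%:R) b.
    rewrite /tproba -iter_walk_step_sum; apply: eq_iter_walk_step => u.
    have [us'|uNs] := boolP (u \in s).
      rewrite (big_rem u us') /= eqxx big_seq big1 ?addr0// => y.
      by rewrite mem_rem_uniq// inE eq_sym => /andP[/negbTE->].
    rewrite big_seq big1// => y ys.
    by case: eqP uNs => [->|//]; rewrite ys.
  have -> : iter k (walk_step w) (fun u => (u \in s)%:R) b =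
      iter k (walk_step w) (fun u => 1 + -1 * (m <= u)%R%:R) b.
    apply: iter_walk_step_local => u ub.
    have -> : (u \in s) = ~~ (m <= u)%R.
      apply/mapP/idP => [[i]|um].
        by rewrite mem_iota /n => ? ->; lia.
      exists `|(u - (b - k%:Z))%R|%N; last by lia.
      by rewrite mem_iota /n; lia.
    by case: (m <= u)%R => /=; rewrite ?mulr0 ?addr0 ?mulr1 ?subrr.
  rewrite (iter_walk_stepD w k (fun=> 1)) iter_walk_stepZ iter_walk_step_cst.
  have := tail_le_green w01 k (ltW bm).
  have -> : \sum_(j < k.+1) tproba w j b m = \sum_(j < k.+1) p m / p b * tproba w j m b.
    apply: eq_bigr => j _; apply: (mulfI (lt0r_neq0 (p0 b))).
    by rewrite (tproba_rev j b m rev) mulrA mulrCA divff ?mulr1// gt_eqF.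
  move=> h.
  have : \sum_(j < k.+1) p m / p b * tproba w j m b <= k.+1%:R * (E m / eps / E b).
    apply: (@le_trans _ _ (\sum_(j < k.+1) E m / eps / E b)); last first.
      by rewrite sumr_const card_ord mulr_natl.
    apply: ler_sum => j _.
    rewrite -[leRHS]mulr1; apply: ler_pM; last exact: tproba_le1.
    - by rewrite ltW// divr_gt0.
    - exact: tproba_ge0.
    rewrite ler_pdivrMr// /p.
    have -> : E m / eps / E b * (E b / w b) = E m / eps / w b.
      by field; rewrite !gt_eqF.
    apply: (@le_trans _ _ (E m / eps)).
      apply: ler_wpM2l; first exact: ltW.
      by rewrite lef_pV2 ?posrE//; have := wE m; lra.
    rewrite ler_pdivlMr//; apply: ler_piMr; first by rewrite ltW// divr_gt0.
    by case/andP: (w01 b).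
  have : k.+1%:R * (E m / eps / E b) <= 2^-1.
    rewrite !mulrA ler_pdivrMr// ler_pdivrMr//; lra.
  lra.
move=> H.
have pb : E b <= p b.
  rewrite ler_pdivlMr//; apply: ler_piMr; first exact: ltW.
  by case/andP: (w01 b).
have Eb := E0 b.
rewrite ler_pdivrMr ?mulr_gt0//.
have t0 := tproba_ge0 w01 (k + k) b b.
have : (2^-1) ^+ 2 * E b <= tproba w (k + k) b b * (C * E b / eps).
  apply: (@le_trans _ _ ((\sum_(y <- s) tproba w k b y) ^+ 2 * p b)).
    apply: ler_pM; [by rewrite exprn_ge0 ?invr_ge0 ?ler0n | exact: ltW | | exact: pb].
    by rewrite lerXn2r ?nnegrE ?invr_ge0 ?ler0n ?sumr_ge0// => y _; exact: tproba_ge0.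
  by apply: le_trans H _; apply: ler_wpM2l.
rewrite [tproba _ _ _ _ * _]mulrA ler_pdivlMr//.
rewrite mulrAC mulrA ler_pM2r//; lra.
Qed.

(** The mean time to go from [y] to [y + 1] is the mass of the reversible
    measure up to [y] divided by [E y], hence at most [B y / (eps E y)]. *)
Lemma green_supersol (G : int -> R) (b : int) :
  (forall y, G (y + 1) = G y + B y / E y) ->
  (forall y, y <= b -> 0 <= (G b - G y) / eps) /\
  (forall y, y < b -> walk_step w (fun u => (G b - G u) / eps) y <= (G b - G y) / eps - 1).
Proof.
move=> GE; split.
  move=> y yb; apply: divr_ge0; last exact: ltW.
  rewrite subr_ge0.
  have [n ->] : exists n : nat, b = y + n%:Z by exists `|b - y|%N; lia.
  elim: n => [|n IH]; first by rewrite addr0.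
  have -> : y + n.+1%:Z = y + n%:Z + 1 by lia.
  by rewrite GE; apply: le_trans IH _; rewrite lerDl; apply: divr_ge0 => //; exact: ltW.
move=> y _; rewrite /walk_step; have e0 := eps0.
have := GE y; have := GE (y - 1); rewrite subrK => e1 e2.
have := wE y; have := BE y => h1 h2.
have Ey := E0 y; have Ey' := E0 (y - 1); have By := B0 y.
set X := B y / E y in e2; set X' := B (y - 1) / E (y - 1) in e1.
have k1 : w y * X = w y + (1 - w y) * X'.
  rewrite /X /X'; apply: (mulIf (lt0r_neq0 Ey)); apply: (mulIf (lt0r_neq0 Ey')).
  have -> : w y * (B y / E y) * E y * E (y - 1) = w y * E (y - 1) * B y.
    by field; rewrite gt_eqF.
  have -> : (w y + (1 - w y) * (B (y - 1) / E (y - 1))) * E y * E (y - 1) =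
     w y * E y * E (y - 1) + (1 - w y) * E y * B (y - 1).
    by field; rewrite gt_eqF.
  by rewrite -EE h1; ring.
have -> : G (y - 1) = G y - X' by rewrite e1 addrK.
rewrite e2 -subr_ge0.
have -> : (G b - G y) / eps - 1 - (w y * ((G b - (G y + X)) / eps) +
   (1 - w y) * ((G b - (G y - X')) / eps)) =
   (w y * X - (1 - w y) * X' - eps) / eps by field; rewrite gt_eqF.
by apply: divr_ge0; [rewrite k1; lra|exact: ltW].
Qed.

End Valley.

(** * The product chain and its meeting times *)

Section Product.
Context {R : realFieldType} {I : finType}.
Variable a : I -> int -> R.

(** A joint move of all chains is a choice, for each of them, of a jump up
    ([true]) or down ([false]). *)
Definition moved (s : I -> int) (v : {ffun I -> bool}) (i : I) : int :=
  if v i then s i + 1 else s i - 1.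

Definition move_proba (s : I -> int) (v : {ffun I -> bool}) : R :=
  \prod_i (if v i then a i (s i) else 1 - a i (s i)).

Definition joint_step (F : (I -> int) -> R) (s : I -> int) : R :=
  \sum_(v : {ffun I -> bool}) move_proba s v * F (moved s v).

(** Independence of the chains: products of functions of single coordinates
    are sent to products. *)
Lemma joint_step_prod (f : I -> int -> R) s :
  joint_step (fun s => \prod_i f i (s i)) s = \prod_i walk_step (a i) (f i) (s i).
Proof.
pose G i (e : bool) := (if e then a i (s i) else 1 - a i (s i)) *
                       f i (if e then s i + 1 else s i - 1).
transitivity (\prod_i \sum_(e : bool) G i e).
  rewrite bigA_distr_bigA; apply: eq_bigr => v _.
  by rewrite /move_proba /moved -big_split.
by apply: eq_bigr => i _; rewrite big_bool.
Qed.

Lemma sum_move_proba s : \sum_v move_proba s v = 1.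
Proof.
transitivity (\prod_i walk_step (a i) (fun=> 1) (s i)).
  rewrite -joint_step_prod; apply: eq_bigr => v _.
  by rewrite big1_eq mulr1.
by apply: big1 => i _; rewrite /walk_step; ring.
Qed.

Lemma joint_step_cst c s : joint_step (fun=> c) s = c.
Proof. by rewrite /joint_step -mulr_suml sum_move_proba mul1r. Qed.

Lemma joint_stepZ c F s : joint_step (fun u => c * F u) s = c * joint_step F s.
Proof. by rewrite /joint_step mulr_sumr; apply: eq_bigr => v _; rewrite mulrCA. Qed.

Lemma joint_stepB F G s : joint_step (fun u => F u - G u) s = joint_step F s - joint_step G s.
Proof. by rewrite /joint_step -sumrB; apply: eq_bigr => v _; rewrite mulrBr. Qed.

Lemma joint_step_sum (J : Type) (r : seq J) (F : J -> (I -> int) -> R) s :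
  joint_step (fun u => \sum_(j <- r) F j u) s = \sum_(j <- r) joint_step (F j) s.
Proof.
by rewrite exchange_big; apply: eq_bigr => v _; rewrite mulr_sumr.
Qed.

Hypothesis a01 : forall i y, 0 <= a i y <= 1.

Lemma move_proba_ge0 s v : 0 <= move_proba s v.
Proof.
by apply: prodr_ge0 => i _; have /andP[? ?] := a01 i (s i); case: ifP; rewrite ?subr_ge0.
Qed.

Lemma joint_step_le (F G : (I -> int) -> R) s :
  (forall v, F (moved s v) <= G (moved s v)) -> joint_step F s <= joint_step G s.
Proof.
by move=> FG; apply: ler_sum => v _; apply: ler_wpM2l => //; exact: move_proba_ge0.
Qed.

Variable meet : pred (I -> int).

(** Probability of no meeting at the times [0, ..., n]. *)
Fixpoint avoid (n : nat) (s : I -> int) : R :=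
  if n is m.+1 then (~~ meet s)%:R * joint_step (avoid m) s else (~~ meet s)%:R.

Lemma avoid_ge0 n s : 0 <= avoid n s.
Proof.
elim: n s => [|n IH] s /=; first by rewrite ler0n.
by rewrite mulr_ge0 ?ler0n// -(joint_step_cst 0 s); apply: joint_step_le.
Qed.

Lemma avoid_meet n s : meet s -> avoid n s = 0.
Proof. by case: n => [|n] /= ->; rewrite ?mul0r. Qed.

Lemma avoidS n s : ~~ meet s -> avoid n.+1 s = joint_step (avoid n) s.
Proof. by move=> /= ->; rewrite mul1r. Qed.

Lemma avoid_le1 n s : avoid n s <= 1.
Proof.
elim: n s => [|n IH] s; first by rewrite /= lern1 leq_b1.
have [m|m] := boolP (meet s); first by rewrite avoid_meet.
by rewrite avoidS// -(joint_step_cst 1 s); apply: joint_step_le.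
Qed.

Lemma avoid_anti m n s : (m <= n)%N -> avoid n s <= avoid m s.
Proof.
elim: m n s => [|m IH] n s.
  by case: n => //= n _; rewrite ler_piMr ?ler0n// -(joint_step_cst 1 s);
     apply: joint_step_le => v; exact: avoid_le1.
case: n => // n mn; have [ms|ms] := boolP (meet s); first by rewrite !avoid_meet.
by rewrite !avoidS//; apply: joint_step_le => v; apply: IH.
Qed.

Variable K : (I -> int) -> Prop.
Hypothesis K_move : forall s v, K s -> K (moved s v).

(** Markov property at time [n].  The time [M] must serve all the states
    reachable in [n] steps; there are finitely many of them, and [avoid] is
    nonincreasing in time. *)
Lemma avoid_concat (d : R) n s :
  (forall s, K s -> exists N, avoid N s <= d) -> K s ->
  exists M, avoid (n + M) s <= d * avoid n s.
Proof.
move=> H; elim: n s => [|n IH] s Ks.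
  have [ms|ms] := boolP (meet s).
    by exists 0%N; rewrite !avoid_meet// mulr0.
  by have [N hN] := H s Ks; exists N; rewrite add0n /= ms mulr1.
have [ms|ms] := boolP (meet s).
  by exists 0%N; rewrite !avoid_meet// mulr0.
have /fin_all_exists[M hM] : forall v : {ffun I -> bool}, exists M : nat,
    avoid (n + M) (moved s v) <= d * avoid n (moved s v).
  by move=> v; apply: IH; exact: K_move.
exists (\max_v M v)%N; rewrite addSn !avoidS// -joint_stepZ; apply: joint_step_le => v.
by apply: le_trans (hM v); apply: avoid_anti; rewrite leq_add2l leq_bigmax.
Qed.

Lemma avoid_geometric (d : R) : 0 <= d ->
  (forall s, K s -> exists N, avoid N s <= d) ->
  forall k s, K s -> exists N, avoid N s <= d ^+ k.
Proof.
move=> d0 H; elim=> [|k IH] s Ks; first by exists 0%N; rewrite expr0 avoid_le1.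
have [N hN] := H s Ks.
have [M hM] := avoid_concat N IH Ks.
exists (N + M)%N; apply: (le_trans hM); rewrite exprSr.
by apply: ler_wpM2l => //; rewrite exprn_ge0.
Qed.

End Product.

Section FirstHit.
Context {R : realFieldType}.
Variable w : int -> R.
Hypothesis w01 : forall y, 0 <= w y <= 1.
Variable b : int.

(** Probability that the first visit to [b] at or after time [t] takes place
    at time [n]. *)
Fixpoint hit (t n : nat) (z : int) {struct n} : R :=
  match t, n with
  | 0, 0 => (z == b)%:R
  | 0, m.+1 => (z != b)%:R * walk_step w (hit 0 m) z
  | _.+1, 0 => 0
  | u.+1, m.+1 => walk_step w (hit u m) z
  end.

Lemma hit_ge0 t n z : 0 <= hit t n z.
Proof.
elim: n t z => [|n IH] [|t] z //=; rewrite ?ler0n//.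
  by rewrite mulr_ge0 ?ler0n// -[0](iter_walk_step_cst w 1 0 z); apply: walk_step_le.
by rewrite -[0](walk_step_cst w 0 z); apply: walk_step_le.
Qed.

Lemma hit_neq0 t n z : hit t n z != 0 ->
  (t <= n)%N /\ evenz (z - b) = ~~ odd n.
Proof.
elim: n t z => [|n IH] [|t] z /=.
- by case: (eqVneq z b) => [->|]; rewrite ?eqxx// subrr.
- by rewrite eqxx.
- case: (z != b); last by rewrite mul0r eqxx.
  rewrite mul1r /walk_step.
  have [h1|h1] := eqVneq (hit 0 n (z + 1)) 0.
    have [h2|h2] := eqVneq (hit 0 n (z - 1)) 0; first by rewrite h1 h2 !mulr0 addr0 eqxx.
    by have [_] := IH _ _ h2; rewrite addrAC evenzB1 => <-; rewrite negbK.
  by have [_] := IH _ _ h1; rewrite addrAC evenzD1 => <-; rewrite negbK.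
- rewrite /walk_step.
  have [h1|h1] := eqVneq (hit t n (z + 1)) 0.
    have [h2|h2] := eqVneq (hit t n (z - 1)) 0; first by rewrite h1 h2 !mulr0 addr0 eqxx.
    by have [? ] := IH _ _ h2; rewrite addrAC evenzB1 => <-; rewrite negbK.
  by have [? ] := IH _ _ h1; rewrite addrAC evenzD1 => <-; rewrite negbK.
Qed.

Lemma sum_hit0 N z : \sum_(n < N.+1) hit 0 n z = 1 - survival w b N z.
Proof.
elim: N z => [|N IH] z.
  by rewrite big_ord1 /=; case: eqP => _; rewrite ?subr0 ?subrr.
rewrite big_ord_recl /=; case: (eqVneq z b) => zb /=.
  by rewrite big1 ?addr0 ?mul0r ?subr0// => i _; rewrite mul0r.
rewrite add0r mul1r; under eq_bigr do rewrite mul1r.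
by rewrite -walk_step_sum (eq_walk_step _ IH) walk_step_compl.
Qed.

(** Run the walk freely up to time [t], then ask for a visit within [N]
    further steps. *)
Lemma sum_hit t N z :
  \sum_(n < (t + N).+1) hit t n z = 1 - iter t (walk_step w) (survival w b N) z.
Proof.
elim: t z => [|t IH] z; first by rewrite add0n sum_hit0.
rewrite addSn big_ord_recl /= add0r.
by rewrite -walk_step_sum (eq_walk_step _ IH) walk_step_compl.
Qed.

Lemma sum_hit_le1 t N z : \sum_(n < N) hit t n z <= 1.
Proof.
elim: N t z => [|N IH] t z; first by rewrite big_ord0.
have H u : walk_step w (fun z => \sum_(n < N) hit u n z) z <= 1.
  by rewrite -[leRHS](walk_step_cst w 1 z); apply: walk_step_le.
rewrite big_ord_recl; case: t => [|t] /=.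
  case: (eqVneq z b) => zb /=; first by rewrite big1 ?addr0// => i _; rewrite mul0r.
  under eq_bigr do rewrite mul1r.
  by rewrite add0r -walk_step_sum; exact: H.
by rewrite add0r -walk_step_sum; exact: H.
Qed.

End FirstHit.

Section Meeting.
Context {R : realFieldType}.
Variables (d : nat) (w : int -> R).
Hypothesis w01 : forall y, 0 <= w y <= 1.

Definition walk_proba (i : option 'I_d) : int -> R :=
  if i is Some _ then w else fun=> 2^-1.

Definition meet (s : option 'I_d -> int) : bool := [forall j, s (Some j) == s None].

Lemma walk_proba01 i y : 0 <= walk_proba i y <= 1.
Proof. by case: i => [j|]; [exact: w01|exact: half01]. Qed.

Variable b : int.

Let h01 := @half01 R.

(** [term] is the probability that at time [n] the walkers are all at [b] while
    Z makes its first visit to [b] at or after time [t]; it is written with one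
    factor per chain so that [joint_step_prod] applies. *)
Let tf t n (i : option 'I_d) : int -> R :=
  if i is Some _ then fun y => tproba w n y b else hit (fun=> 2^-1) b t n.

Let term t n (s : option 'I_d -> int) : R := \prod_i tf t n i (s i).

Let tf_ge0 t n i y : 0 <= tf t n i y.
Proof. by case: i => [j|]; [exact: tproba_ge0|exact: hit_ge0]. Qed.

Let termE t n s : term t n s =
  hit (fun=> 2^-1) b t n (s None) * \prod_j tproba w n (s (Some j)) b.
Proof.
rewrite /term (bigD1 None)//=; congr (_ * _).
rewrite (reindex_omap (@Some 'I_d) id); last by case.
by apply: eq_big => [j|j _] //=; rewrite eqxx.
Qed.

Let term_le t n s : term t n s <= hit (fun=> 2^-1) b t n (s None).
Proof.
rewrite termE; apply: ler_piMr; first exact: hit_ge0.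
by apply: prodr_ile1 => j _; rewrite tproba_ge0 ?tproba_le1.
Qed.

(** For distinct [n] these events are disjoint, since the first visit of Z
    after [t] occurs once, and each of them contains a meeting. *)
Lemma meet_before t N s :
  \sum_(n < N.+1) hit (fun=> 2^-1) b t n (s None) * \prod_j tproba w n (s (Some j)) b
    <= 1 - avoid walk_proba meet N s.
Proof.
under eq_bigr do rewrite -termE.
have nomeet0 u t0 : ~~ meet u -> term t0 0 u = 0.
  move=> /forallPn[j jN]; rewrite termE; case: t0 => [|t0] /=; last by rewrite mul0r.
  have [sb|sb] := eqVneq (u None) b; last by rewrite mul0r.
  by rewrite (bigD1 j)//= /tproba /= -sb (negbTE jN) mul0r mulr0.
elim: N t s => [|N IH] t s.
  have [ms|ms] := boolP (meet s).
    rewrite avoid_meet// subr0 big_ord1; apply: le_trans (term_le _ _ _) _.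
    by have := sum_hit_le1 h01 b t 1 (s None); rewrite big_ord1.
  by rewrite big_ord1 nomeet0//= ms subrr.
have [ms|ms] := boolP (meet s).
  rewrite avoid_meet// subr0.
  apply: le_trans (sum_hit_le1 h01 b t N.+2 (s None)).
  by apply: ler_sum => n _; exact: term_le.
rewrite avoidS// big_ord_recl nomeet0// add0r.
apply: (@le_trans _ _ (joint_step walk_proba (fun u => \sum_(n < N.+1) term t.-1 n u) s)).
  rewrite joint_step_sum; apply: ler_sum => n _.
  rewrite (joint_step_prod walk_proba (tf t.-1 n)).
  apply: ler_prod => i _; rewrite tf_ge0/=.
  case: i => [j|] //=; case: t => [|t] //=.
  rewrite ler_piMl ?lern1 ?leq_b1//.
  rewrite -[0](walk_step_cst (fun=> 2^-1) 0 (s None)).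
  by apply: walk_step_le => //; exact: hit_ge0.
rewrite -[X in X - _](joint_step_cst walk_proba 1 s) -joint_stepB.
by apply: joint_step_le => [|v]; [exact: walk_proba01|exact: IH].
Qed.

(** Z visits [b] in the time window with probability at least 1/2, and at that
    time each walker is there with probability at least [c], given Z.  Parity
    enters because [p_n(x, b)] vanishes at times of the wrong parity. *)
Lemma avoid_le_of_window (c : R) (t N : nat) (s : option 'I_d -> int) : 0 <= c ->
  (forall i, evenz (s i - b) = evenz (s None - b)) ->
  (forall j n, (t <= n <= t + N)%N -> evenz (s (Some j) - b) = ~~ odd n ->
     c <= tproba w n (s (Some j)) b) ->
  iter t (walk_step (fun=> 2^-1 : R)) (survival (fun=> 2^-1 : R) b N) (s None) <= 2^-1 ->
  avoid walk_proba meet (t + N) s <= 1 - c ^+ d / 2.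
Proof.
move=> c0 par H hZ.
have := meet_before t (t + N) s.
have : c ^+ d * \sum_(n < (t + N).+1) hit (fun=> 2^-1 : R) b t n (s None) <=
   \sum_(n < (t + N).+1) hit (fun=> 2^-1 : R) b t n (s None) * \prod_j tproba w n (s (Some j)) b.
  rewrite mulr_sumr; apply: ler_sum => n _.
  have [->|/hit_neq0[tn pn]] := eqVneq (hit (fun=> 2^-1 : R) b t n (s None)) 0.
    by rewrite mul0r mulr0.
  rewrite mulrC; apply: ler_wpM2l; first exact: hit_ge0.
  rewrite -[X in c ^+ X]card_ord -prodr_const; apply: ler_prod => j _.
  by rewrite c0 H// ?par// tn -ltnS ltn_ord.
rewrite sum_hit.
have : 0 <= c ^+ d by rewrite exprn_ge0.
move: (avoid _ _ _ _) (\sum_(n < _) _) (iter _ _ _ _) (c ^+ d) hZ => X S T C; nra.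
Qed.

End Meeting.

(** * A valley forces a meeting *)

Lemma evenzB (x y : int) : evenz (x - y) = (evenz x == evenz y).
Proof. by rewrite /evenz; lia. Qed.

Section Quenched.
Context {R : realType}.
Variables (w : int -> R) (eps : R) (E B : int -> R).
Hypothesis eps0 : 0 < eps.
Hypothesis wE : forall y, eps <= w y <= 1 - eps.
Hypothesis E0 : forall y, 0 < E y.
Hypothesis EE : forall y, E (y - 1) * w y = (1 - w y) * E y.
Hypothesis B0 : forall y, 0 <= B y.
Hypothesis BE : forall y, B y = B (y - 1) + E y.

(** Up to constants, a time that lets Z ([b^2]) and the walkers (the sum) reach
    [b] from fixed starting points. *)
Definition time_scale (b : nat) : R :=
  1 + b%:R ^+ 2 + \sum_(0 <= y < b) B y%:Z / E y%:Z.

(** The constant 1200 is large enough for the walkers to be still confined at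
    the end of the time window used in [quenched_meeting]. *)
Definition valley (C : R) (b m : nat) : Prop :=
  [/\ (b < m)%N, B (m%:Z - 1) <= C * E b &
      1200 / eps ^+ 2 * time_scale b * E m <= E b].

Lemma window_exists (X : R) : 1 <= X ->
  exists2 L : nat, (0 < L)%N & X <= L%:R ^+ 2 <= 4 * X.
Proof.
move=> X1; have X0 : 0 <= X by lra.
exists (Num.truncn (Num.sqrt X)).+1 => //.
have /andP[h1 h2] := truncn_itv (sqrtr_ge0 X).
have s1 : 1 <= Num.sqrt X by rewrite -sqrtr1 ler_wsqrtr.
rewrite -[in X in X <= _](sqr_sqrtr X0) -[in X in _ <= 4 * X](sqr_sqrtr X0).
rewrite -natr1 in h2 *; move: s1 h1 h2; move: (Num.sqrt X) (_%:R : R) => a u a1 h1 h2.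
by apply/andP; split; nra.
Qed.

(** The valley is chosen far enough for [time_scale b] to dominate all the
    quantities that depend on the starting points; the lower bound then no
    longer depends on them, and [avoid_geometric] can be iterated. *)
Lemma quenched_meeting (d : nat) (C : R) (s : option 'I_d -> int) : 0 < C ->
  (forall b0 : nat, exists b m : nat, (b0 <= b)%N /\ valley C b m) ->
  (forall i, evenz (s i) = evenz (s None)) ->
  exists N, avoid (walk_proba w) (@meet d) N s <= 1 - (eps / (8 * C)) ^+ d / 2.
Proof.
move=> C0 Hval par; have e0 := eps0.
have w01 y : 0 <= w y <= 1 by have h := wE y; apply/andP; split; lra.
have e1 : eps <= 1 by have := wE 0; lra.
have [G GE Gn] := int_primitive (fun y => B y / E y) 0.
pose c : R := \sum_j `|G (s (Some j))|.
have c0 : 0 <= c by apply: sumr_ge0.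
pose b0 := ((Num.truncn c).+1 + \sum_i `|s i|)%N.
have b0c : ((Num.truncn c).+1 <= b0)%N by rewrite leq_addr.
have b0s i : (`|s i| <= b0)%N.
  by rewrite /b0 (bigD1 i)//= addnCA leq_addr.
have [b [m [b0b [bm HB HE]]]] := Hval b0.
have [Tpos TS] := green_supersol eps0 wE E0 EE B0 BE b GE.
pose A := time_scale b.
have bR : 1 <= b%:R :> R by rewrite ler1n (leq_trans _ b0b)// (leq_trans _ b0c).
have sum0 : 0 <= \sum_(0 <= y < b) B y%:Z / E y%:Z.
  by apply: sumr_ge0 => y _; apply: divr_ge0 => //; exact: ltW.
have A1 : 1 <= A by rewrite /A /time_scale; nra.
have bA : b%:R ^+ 2 <= A by rewrite /A /time_scale; lra.
have cA : c <= A.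
  apply: (@le_trans _ _ b%:R); last by nra.
  have /andP[_ h] := truncn_itv c0; apply: (le_trans (ltW h)).
  by rewrite ler_nat (leq_trans b0c).
have GA : G b <= A by rewrite Gn add0r /A /time_scale; have := sqr_ge0 (b%:R : R); lra.
have si i : (`|s i| <= b)%N.
  exact: leq_trans (b0s i) b0b.
have Tj j : (G b - G (s (Some j))) / eps <= 2 * A / eps.
  rewrite ler_pM2r ?invr_gt0//.
  have : `|G (s (Some j))| <= c by rewrite /c (bigD1 j)//= lerDl sumr_ge0.
  by have := ler_norm (- G (s (Some j))); rewrite normrN; lra.
(* The walkers have mean hitting time at most 2 A / eps = 2 Y, so they have
   reached b by time t, slightly more than 4 Y, with probability at least 1/2. *)
pose Y := A / eps.
have Y1 : 1 <= Y by rewrite /Y ler_pdivlMr//; lra.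
have AY : A <= Y by rewrite /Y ler_pdivlMr//; nra.
have Y0 : 0 <= 4 * Y by lra.
pose t := (Num.truncn (4 * Y)).+1.
have /andP[t1 t2] := truncn_itv Y0.
have t3 : t%:R <= 5 * Y :> R by rewrite /t -natr1; lra.
have zb : (s None - b%:Z)%:~R ^+ 2 <= 4 * A :> R.
  have h : `|s None - b%:Z| <= (2 * b)%N%:Z by have := si None; clear; lia.
  have : `|(s None - b%:Z)%:~R| <= 2 * b%:R :> R.
    by rewrite -intr_norm -(natrM _ 2) -[(2 * b)%:R]/((2 * b)%N%:Z%:~R) ler_int.
  rewrite -[X in X <= 4 * A]real_normK ?num_real//.
  have : 0 <= `|(s None - b%:Z)%:~R| :> R by [].
  by move: (`| _ |) => u u0 u1; nra.
(* A window of length L^2 with L^2 >= X makes 4 E (Z_t - b)^2 / L^2 <= 1/4, the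
   error term of [survival_half].  All times are then at most
   5 Y + 4 * 144 Y = 581 Y, which leads to k + 1 <= 600 Y below. *)
pose X : R := 16 * ((s None - b%:Z)%:~R ^+ 2 + t%:R).
have X1 : 1 <= X.
  have : 1 <= t%:R :> R by rewrite ler1n.
  by rewrite /X; have := sqr_ge0 ((s None - b%:Z)%:~R : R); lra.
have X2 : X <= 144 * Y by rewrite /X; lra.
have [L L0 /andP[L1 L2]] := window_exists X1.
exists (t + L * L)%N.
apply: (avoid_le_of_window w01 (b := b)).
- by rewrite divr_ge0 ?mulr_ge0 ?ltW.
- by move=> i; rewrite !evenzB par.
- move=> j n /andP[tn nN] pj.
  have H k : (k + k <= n)%N -> eps / (4 * C) <= tproba w (k + k) b b.
    move=> kn; apply: (valley_return eps0 wE E0 EE B0 BE (m := m)) => //.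
    have k1 : k.+1%:R <= 600 * Y :> R.
      have : (k + k)%:R <= (t + L * L)%:R :> R by rewrite ler_nat (leq_trans kn).
      rewrite !natrD natrM -expr2 -[k.+1%:R]natr1; lra.
    apply: (@le_trans _ _ (600 * Y * E m)).
      by apply: ler_wpM2r => //; exact: ltW.
    apply: (@le_trans _ _ (eps / 2 * (1200 / eps ^+ 2 * A * E m))); last first.
      by apply: ler_wpM2l => //; lra.
    by rewrite /Y le_eqVlt; apply/orP; left; apply/eqP; field; rewrite gt_eqF.
  have cc : 0 <= eps / (4 * C) by rewrite divr_ge0 ?mulr_ge0 ?ltW.
  have sb : s (Some j) <= b by have := si (Some j); clear; lia.
  apply: le_trans (tproba_ge_survival w01 cc H sb pj).
  have := survival_le_supersol w01 n Tpos TS sb.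
  have := Tj j; rewrite -mulrA -/Y => h1 h2.
  have nt : t%:R <= n%:R :> R by rewrite ler_nat.
  have t4 : 4 * Y < n%:R by apply: lt_le_trans nt; rewrite /t.
  have S2 : survival w b n (s (Some j)) <= 2^-1.
    have := survival_ge0 w01 b n (s (Some j)).
    move: (survival _ _ _ _) h2 => S h2 S0.
    rewrite leNgt; apply/negP => S3; nra.
  have -> : eps / (8 * C) = eps / (4 * C) * 2^-1 by field; rewrite gt_eqF.
  by apply: ler_wpM2l => //; lra.
apply: (@le_trans _ _ (iter t (walk_step (fun=> 2^-1 : R))
  (fun u => 4^-1 + 4 / L%:R ^+ 2 * (u - b%:Z)%:~R ^+ 2) (s None))).
  apply: iter_walk_step_le => u; first exact: half01.
  by rewrite mulrAC; exact: survival_half.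
rewrite iter_half_sqr.
have LL : 0 < L%:R ^+ 2 :> R by lra.
have -> : 4 / L%:R ^+ 2 * ((s None - b%:Z)%:~R ^+ 2 + t%:R) = X / 4 / L%:R ^+ 2.
  by rewrite /X; field; rewrite gt_eqF// ltr0n.
have : X / 4 / L%:R ^+ 2 <= 4^-1 by rewrite ler_pdivrMr//; lra.
lra.
Qed.

End Quenched.

(** * From the product chain to the quenched law *)

Lemma finSetT (V : finType) : finite_set [set: V].
Proof. exact: finite_finset. Qed.

(** Disjoint cells of full measure inside [H] need not cover [H]; they do up to
    a null set.  Here the cells are the histories with nearest-neighbour next
    steps. *)
Lemma measure_le_cells d (T : measurableType d) (R : realType)
  (mu : {measure set T -> \bar R}) (V : finType) (H A : set T) (Hv : V -> set T) :
  (mu [set: T] < +oo)%E -> measurable H -> measurable A ->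
  (forall v, measurable (Hv v)) ->
  trivIset [set: V] Hv -> (forall v, Hv v `<=` H) -> A `<=` H ->
  (\sum_v mu (Hv v) = mu H)%E -> (mu A <= \sum_v mu (A `&` Hv v))%E.
Proof.
move=> mufin mH mA mHv tHv HvH AH sumH.
have toset (F : V -> \bar R) : (\sum_(v \in [set: V]) F v = \sum_v F v)%E.
  rewrite fsbig_finite; last exact: finSetT.
  refine (@perm_big _ _ _ _ _ _ xpredT _ _).
  apply: uniq_perm; rewrite ?fset_uniq ?index_enum_uniq// => v.
  by rewrite in_fset_set; [|exact: finSetT]; apply/idP/idP => _; [exact: mem_index_enum|exact: mem_set].
pose U := \bigcup_(v in [set: V]) Hv v.
have mU : measurable U by apply: fin_bigcup_measurable => //; exact: finSetT.
have UH : U `<=` H by move=> t [v _]; exact: HvH.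
have muU : mu U = mu H.
  by rewrite /U measure_fin_bigcup; [rewrite toset|exact: finSetT| |].
have Hfin : (mu H < +oo)%E by apply: le_lt_trans mufin; apply: le_measure; rewrite ?inE.
have HU0 : mu (H `\` U) = 0%E.
  have HIU : H `&` U = U by apply/seteqP; split => [t []|t Ut] //; split => //; exact: UH.
  have e : mu (H `\` U) = (mu H - mu U)%E by rewrite measureD// HIU.
  rewrite e muU subee//.
  by rewrite ge0_fin_numE.
have AU : A `<=` (\bigcup_(v in [set: V]) (A `&` Hv v)) `|` (H `\` U).
  move=> t At; have [Ut|Ut] := pselect (U t).
    by left; case: Ut => v _ ?; exists v.
  by right; split => //; exact: AH.
have mAv v : measurable (A `&` Hv v) by exact: measurableI.
have tAv : trivIset [set: V] (fun v => A `&` Hv v).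
  by move=> u v _ _ [t [[_ hu] [_ hv]]]; apply: tHv => //; exists t.
rewrite -toset -measure_fin_bigcup//; last exact: finSetT.
apply: (@le_trans _ _ (mu ((\bigcup_(v in [set: V]) (A `&` Hv v)) `|` (H `\` U)))).
  apply: le_measure; rewrite ?inE//; apply: measurableU; last exact: measurableD.
  by apply: fin_bigcup_measurable => //; exact: finSetT.
rewrite measureU0//; last exact: measurableD.
by apply: fin_bigcup_measurable => //; exact: finSetT.
Qed.

Section Link.
Context {dT : measure_display} {T : measurableType dT} {R : realType}.
Variables (d : nat) (w : int -> R) (x : 'I_d -> int) (z : int).
Variables (S : 'I_d -> nat -> {mfun T >-> int}) (Z : nat -> {mfun T >-> int}).
Variable mu : {measure set T -> \bar R}.
Hypothesis mu1 : mu [set: T] = 1%E.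
Hypothesis w01 : forall y, 0 <= w y <= 1.
Hypothesis law : quenched_law w x z S Z mu.

Let W := walks S Z.

Definition hist_of (i : option 'I_d) (n : nat) (y : nat -> int) : set T :=
  [set t | forall k, (k <= n)%N -> W i k t = y k].

Definition hist (n : nat) (y : option 'I_d -> nat -> int) : set T :=
  [set t | forall i k, (k <= n)%N -> W i k t = y i k].

Definition start (i : option 'I_d) : int := if i is Some j then x j else z.

Lemma walk_markov i :
  markov_chain mu (start i) (nn_transition (walk_proba w i)) (W i).
Proof. by case: law => hS hZ _; case: i. Qed.

Lemma measurable_state (i : option 'I_d) k (A : set int) : measurable (W i k @^-1` A).
Proof. by rewrite -[X in measurable X]setTI; apply: measurable_funPT. Qed.

Lemma sigma_hist_of i n y : sigma_process (W i) (hist_of i n y).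
Proof.
rewrite (_ : hist_of i n y = \bigcap_(k in `I_n.+1) (W i k @^-1` [set y k])); last first.
  by apply/seteqP; split => t h k /= kn; apply: h => //=; rewrite ltnS in kn *.
apply: (@bigcap_measurable _ (g_sigma_algebraType
  (\bigcup_n preimage_set_system [set: T] (W i n) measurable))); first by exists 0%N.
move=> k _; apply: sub_sigma_algebra; exists k => //; exists [set y k] => //.
by rewrite setTI.
Qed.

Lemma measurable_hist_of i n y : measurable (hist_of i n y).
Proof.
rewrite (_ : hist_of i n y = \bigcap_(k in `I_n.+1) (W i k @^-1` [set y k])); last first.
  by apply/seteqP; split => t h k /= kn; apply: h => //=; rewrite ltnS in kn *.
by apply: bigcap_measurable => [|k _]; [exists 0%N|exact: measurable_state].
Qed.

Lemma measurable_hist n y : measurable (hist n y).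
Proof.
rewrite (_ : hist n y = \bigcap_(i in [set: option 'I_d]) hist_of i n (y i)); last first.
  by rewrite eqEsubset; split => t h i; [move=> _; exact: h|exact: h].
apply: fin_bigcap_measurable => // i _; exact: measurable_hist_of.
Qed.

(** Mutual independence of the processes, applied to one cylinder each. *)
Lemma mu_hist n y : mu (hist n y) = (\prod_i mu (hist_of i n (y i)))%E.
Proof.
case: law => _ _ ind.
pose J : {fset option 'I_d} := fset_set [set: option 'I_d].
have := ind J (fun i => hist_of i n (y i)) (fun i _ => @sigma_hist_of i n (y i)).
have -> : \bigcap_(i in [set` J]) hist_of i n (y i) = hist n y.
  rewrite eqEsubset; split => t h i => [k kn|_]; last exact: h.
  by apply: h => //=; rewrite in_fset_set; [exact: mem_set|exact: finSetT].
move=> ->; refine (@perm_big _ _ _ _ _ _ xpredT _ _).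
apply: uniq_perm; rewrite ?fset_uniq ?index_enum_uniq// => v.
by rewrite in_fset_set; [|exact: finSetT]; apply/idP/idP => _; [exact: mem_index_enum|exact: mem_set].
Qed.

Lemma mu_histS n y : mu (hist n.+1 y) =
  (mu (hist n y) * (\prod_i nn_transition (walk_proba w i) (y i n) (y i n.+1))%:E)%E.
Proof.
rewrite !mu_hist -prodEFin -big_split; apply: eq_bigr => i _ /=.
by case: (walk_markov i) => _ ->.
Qed.

Definition extend (n : nat) (y : option 'I_d -> nat -> int) (v : {ffun option 'I_d -> bool}) :=
  fun i k => if (k <= n)%N then y i k else moved (y^~ n) v i.

Lemma mu_extend n y v : mu (hist n.+1 (extend n y v)) =
  (mu (hist n y) * (move_proba (walk_proba w) (y^~ n) v)%:E)%E.
Proof.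
rewrite mu_histS; congr (_ * _)%E.
  congr (mu _); rewrite eqEsubset; split => t h i k kn; rewrite h//.
    by rewrite /extend kn.
  by rewrite /extend kn.
congr (_%:E); apply: eq_bigr => i _; rewrite /extend leqnn ltnn /moved /nn_transition.
case: (v i); first by rewrite eqxx.
by rewrite (negbTE (_ : _ != _)) ?eqxx//; lia.
Qed.

Definition state_at (n : nat) (t : T) : option 'I_d -> int := fun i => W i n t.

Definition no_meet (n N : nat) : set T :=
  [set t | forall k, (n <= k <= n + N)%N -> ~~ meet (state_at k t)].

Lemma measurable_meet k : measurable [set t | ~~ meet (state_at k t)].
Proof.
rewrite (_ : [set t | _] = ~` \bigcap_(j in [set: 'I_d])
    \bigcup_(a in [set: int]) (W (Some j) k @^-1` [set a] `&` W None k @^-1` [set a])).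
  apply: measurableC; apply: fin_bigcap_measurable => [|j _]; first exact: finSetT.
  apply: countable_bigcupT_measurable => [|a]; first exact: countableP.
  by apply: measurableI; exact: measurable_state.
apply/seteqP; split => t /=.
  move=> /negP h h'; apply: h; apply/forallP => j; apply/eqP.
  by have [a _ [/= ea eb]] := h' j I; rewrite /state_at ea eb.
move=> h; apply/negP => /forallP h'; apply: h => j _.
by exists (W None k t) => //; split => //=; exact/eqP/(h' j).
Qed.

Lemma measurable_no_meet n N : measurable (no_meet n N).
Proof.
rewrite (_ : no_meet n N = \bigcap_(k in [set k | (n <= k <= n + N)%N])
   [set t | ~~ meet (state_at k t)]) //.
apply: bigcap_measurable => [|k _]; last exact: measurable_meet.
by exists n => /=; rewrite leqnn leq_addr.
Qed.

Lemma hist_no_meet0 n N y : meet (y^~ n) -> hist n y `&` no_meet n N = set0.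
Proof.
move=> my; apply/seteqP; split => t // [ht /(_ n)].
rewrite leqnn leq_addr => /(_ isT)/negP; apply.
by rewrite (_ : state_at n t = y^~ n)//; apply/funext => i; exact: ht.
Qed.

(** One step of the chains splits a history into the histories that extend it,
    with the weights of [joint_step]. *)
Lemma mu_no_meet_le N n y :
  (mu (hist n y `&` no_meet n N) <=
   mu (hist n y) * (avoid (walk_proba w) (@meet d) N (y^~ n))%:E)%E.
Proof.
have p01 := walk_proba01 w01 (d := d).
elim: N n y => [|N IH] n y; have [my|my] := boolP (meet (y^~ n)).
- by rewrite hist_no_meet0// measure0 avoid_meet// mule0.
- rewrite /= my mule1; apply: le_measure; rewrite ?inE//.
  + by apply: measurableI; [exact: measurable_hist|exact: measurable_no_meet].
  + exact: measurable_hist.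
- by rewrite hist_no_meet0// measure0 avoid_meet// mule0.
rewrite avoidS//.
have cells := @measure_le_cells _ _ _ mu {ffun option 'I_d -> bool} (hist n y)
  (hist n y `&` no_meet n N.+1) (fun v => hist n.+1 (extend n y v)).
apply: (le_trans (cells _ _ _ _ _ _ _ _)).
- by rewrite mu1 ltry.
- exact: measurable_hist.
- by apply: measurableI; [exact: measurable_hist|exact: measurable_no_meet].
- by move=> v; exact: measurable_hist.
- move=> u v _ _ [t [hu hv]]; apply/ffunP => i.
  have := hu i n.+1 (leqnn _); rewrite (hv i n.+1 (leqnn _)) /extend ltnn /moved.
  by case: (u i) (v i) => -[] // ?; exfalso; lia.
- by move=> v t h i k kn; rewrite h ?(leq_trans kn)// /extend kn.
- by move=> t [].
- under eq_bigr do rewrite mu_extend.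
  rewrite -ge0_sume_distrr; last by move=> v _; rewrite lee_fin; exact: move_proba_ge0.
  by rewrite sumEFin sum_move_proba mule1.
rewrite /joint_step -sumEFin ge0_sume_distrr; last first.
  move=> v _; rewrite lee_fin mulr_ge0//; first exact: move_proba_ge0.
  exact: (avoid_ge0 p01).
apply: lee_sum => v _.
apply: (@le_trans _ _ (mu (hist n.+1 (extend n y v) `&` no_meet n.+1 N))).
  apply: le_measure; rewrite ?inE.
  - apply: measurableI; last exact: measurable_hist.
    by apply: measurableI; [exact: measurable_hist|exact: measurable_no_meet].
  - by apply: measurableI; [exact: measurable_hist|exact: measurable_no_meet].
  - move=> t [[_ h] h']; split=> // k /andP[k1 k2]; apply: h.
    by rewrite (ltnW k1) addnS -addSn.
apply: (le_trans (IH _ _)).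
rewrite mu_extend EFinM muleA.
rewrite (_ : (extend n y v)^~ n.+1 = moved (y^~ n) v)//.
by apply/funext => i; rewrite /extend ltnn.
Qed.

Definition coparity (s : option 'I_d -> int) : Prop :=
  forall i, evenz (s i) = evenz (s None).

Hypothesis start_coparity : coparity start.

(** All chains change parity at each step. *)
Lemma mu_hist_coparity n y : (mu (hist n y) != 0)%E -> coparity (y^~ n).
Proof.
elim: n => [|n IH].
  move=> h; suff -> : y^~ 0%N = start by [].
  apply/funext => i; apply/eqP/negPn/negP => yi; move/negP: h; apply.
  have [h0 _] := walk_markov i.
  rewrite -measure_le0 (le_trans (y := mu (~` [set t | W i 0%N t = start i])))//.
    apply: le_measure; rewrite ?inE.
    - exact: measurable_hist.
    - by apply: measurableC; exact: (measurable_state i 0 [set start i]).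
    - by move=> t h /= e; move/eqP: yi; apply; rewrite -e h.
  have mA : measurable [set t | W i 0%N t = start i] := measurable_state i 0 [set start i].
  have e : mu (setT `\` [set t | W i 0%N t = start i]) =
      (mu setT - mu (setT `&` [set t | W i 0%N t = start i]))%E.
    by rewrite measureD//; change (mu [set: T] < +oo)%E; rewrite mu1 ltry.
  by rewrite -setTD e setTI h0 mu1 subee.
rewrite mu_histS => h; have [h1 h2] : (mu (hist n y) != 0)%E /\
   \prod_i nn_transition (walk_proba w i) (y i n) (y i n.+1) != 0.
  split; apply: contra_neq h => ->; first by rewrite mul0e.
  by rewrite mule0.
have c := IH h1.
have flip i : evenz (y i n.+1) = ~~ evenz (y i n).
  have : nn_transition (walk_proba w i) (y i n) (y i n.+1) != 0.
    by move/prodf_neq0: h2 => /(_ i isT).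
  rewrite /nn_transition.
  case: (y i n.+1 =P y i n + 1) => [->|_]; first by rewrite evenzD1.
  by case: (y i n.+1 =P y i n - 1) => [->|_]; [rewrite evenzB1|rewrite eqxx].
by move=> i; rewrite !flip c.
Qed.

Lemma mu_never_meet n y (c : R) : 0 < c <= 1 ->
  (forall s, coparity s -> exists N, avoid (walk_proba w) (@meet d) N s <= 1 - c) ->
  mu.-negligible (hist n y `&` \bigcap_N no_meet n N).
Proof.
move=> /andP[c0 c1] H.
have mI : measurable (hist n y `&` \bigcap_N no_meet n N).
  apply: measurableI; first exact: measurable_hist.
  by apply: bigcapT_measurable => N; exact: measurable_no_meet.
apply/negligibleP => //; apply/eqP.
have [h0|h0] := eqVneq (mu (hist n y)) 0%E.
  rewrite -measure_le0 -h0; apply: le_measure; rewrite ?inE//.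
  exact: measurable_hist.
have cop := mu_hist_coparity h0.
have cmove s v : coparity s -> coparity (moved s v).
  move=> cs i; rewrite /moved; case: (v i) (v None) => -[];
    by rewrite ?evenzD1 ?evenzB1 cs.
have d0 : 0 <= 1 - c by lra.
have geo := avoid_geometric (walk_proba01 w01 (d := d)) cmove d0 H.
rewrite -measure_le0; apply/lee_addgt0Pr => e e0; rewrite add0e.
have [k hk] : exists k, (1 - c) ^+ k <= e.
  have lt1 : `|1 - c| < 1 by rewrite ger0_norm//; lra.
  have /cvgrPdist_le/(_ e e0)[k _ hk] := cvg_expr lt1.
  exists k; have := hk k (leqnn k); rewrite sub0r normrN => h.
  by apply: le_trans h; exact: ler_norm.
have [N hN] := geo k _ cop.
apply: (@le_trans _ _ (mu (hist n y `&` no_meet n N))).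
  apply: le_measure; rewrite ?inE//.
    by apply: measurableI; [exact: measurable_hist|exact: measurable_no_meet].
  by move=> t [ht h]; split => //; exact: h.
apply: (le_trans (mu_no_meet_le N n y)).
rewrite -[leRHS]mul1e; apply: lee_pmul => //.
- by rewrite lee_fin; exact: (avoid_ge0 (walk_proba01 w01 (d := d))).
- by rewrite -mu1; apply: le_measure; rewrite ?inE//; exact: measurable_hist.
- by rewrite lee_fin; apply: le_trans hk.
Qed.

(** Countably many histories of length [n], each of which leads to a later
    meeting almost surely. *)
Lemma meet_infinitely_often (c : R) : 0 < c <= 1 ->
  (forall s, coparity s -> exists N, avoid (walk_proba w) (@meet d) N s <= 1 - c) ->
  mu.-negligible (\bigcup_n \bigcap_N no_meet n N).
Proof.
move=> c01 H; apply: negligible_bigcup => n.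
pose Y (f : {ffun option 'I_d * 'I_n.+1 -> int}) (i : option 'I_d) (k : nat) : int :=
  f (i, inord k).
pose F (m : nat) : set T :=
  if (choice.unpickle m : option {ffun option 'I_d * 'I_n.+1 -> int}) is Some f
  then hist n (Y f) `&` \bigcap_N no_meet n N else set0.
have H2 : mu.-negligible (\bigcup_m F m).
  apply: negligible_bigcup => m; rewrite /F.
  case: (choice.unpickle _) => [f|]; last exact: negligible_set0.
  exact: mu_never_meet H.
apply: negligibleS H2 => t ht.
pose f := [ffun p : option 'I_d * 'I_n.+1 => W p.1 p.2 t].
exists (choice.pickle f) => //; rewrite /F choice.pickleK; split => // i k kn.
by rewrite /Y ffunE inordK.
Qed.

End Link.

(** * Perpetuities and the barrier tracker *)

Section Perpetuity.
Context {R : realType}.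
Variables (lam : R) (beta : nat -> R).

(** With [beta = rho^(kappa / 2)], these perpetuities mimic the recurrence
    [W_(n+1) = 1 + rho_(n+1) W_n] of [W = B / E], with [rho] replaced by its
    powers [kappa / 2] and [kappa]; [clock] corresponds to [time_scale]. *)
Fixpoint xi n : R := if n is m.+1 then 1 + beta n * xi m else lam.
Fixpoint zeta n : R := if n is m.+1 then 1 + beta n ^+ 2 * zeta m else lam ^+ 2.
Definition clock n : R := 1 + n%:R + \sum_(0 <= y < n) zeta y.
Definition prodb (i j : nat) : R := \prod_(i.+1 <= k < j.+1) beta k.

Lemma clockE n : clock n = 1 + n%:R + \sum_(0 <= y < n) zeta y.
Proof. by []. Qed.

Lemma clockS n : clock n.+1 = clock n + 1 + zeta n.
Proof. by rewrite /clock big_nat_recr//= -natr1; ring. Qed.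

Lemma clock0 : clock 0 = 1.
Proof. by rewrite /clock big_geq// !addr0. Qed.

Lemma prodbS i j : (i <= j)%N -> prodb i j.+1 = prodb i j * beta j.+1.
Proof. by move=> ij; rewrite /prodb big_nat_recr. Qed.

Lemma prodb_id i : prodb i i = 1.
Proof. by rewrite /prodb big_geq. Qed.

Lemma zetaE n : zeta n = lam ^+ 2 * prodb 0 n ^+ 2 +
  \sum_(0 <= i < n) prodb i.+1 n ^+ 2.
Proof.
elim: n => [|n IH]; first by rewrite prodb_id big_geq// expr1n mulr1 addr0.
rewrite /= IH big_nat_recr//= prodb_id expr1n prodbS//.
have -> : \sum_(0 <= i < n) prodb i.+1 n.+1 ^+ 2 =
    beta n.+1 ^+ 2 * \sum_(0 <= i < n) prodb i.+1 n ^+ 2.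
  rewrite mulr_sumr; apply: eq_big_nat => i /andP[_ i_n].
  by rewrite prodbS// exprMn mulrC.
ring.
Qed.

End Perpetuity.

(** State of the search: [live] is 1 until success and 0 afterwards, [weight]
    is [1 / clock] at the current anchor (or 0 if the anchor is useless because
    its [xi] is large), [height] is the product of [beta] since the anchor, and
    [floor] is the level under which the anchor is given up. *)
Record tracker (R : Type) := Tracker
  { live : R ; weight : R ; height : R ; floor : R }.

Section Tracker.
Context {R : realType}.
Variables (lam alpha r C1 K : R) (n0 : nat) (beta : nat -> R).

Local Notation xi := (xi lam beta).
Local Notation clock := (clock lam beta).
Local Notation prodb := (prodb beta).

Definition fresh_weight n : R := (xi n <= C1)%R%:R / clock n.

(** An anchor [b] is kept while it is useful and the product of [beta] from [b]
    on stays above the floor [alpha r^(n - b)]; otherwise the present site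
    becomes the anchor.  Success is the event that the squared product reaches
    [K clock_b]. *)
Fixpoint track (k : nat) : tracker R :=
  if k is j.+1 then
    let: Tracker d g U f := track j in
    let n := (n0 + k)%N in
    let U' := U * beta n in
    let f' := f * r in
    let d' := d * (g * U' ^+ 2 < K)%R%:R in
    if (g == 0) || (U' <= f')
    then Tracker d' (fresh_weight n) 1 alpha
    else Tracker d' g U' f'
  else Tracker 1 (fresh_weight n0) 1 alpha.

Hypothesis beta0 : forall n, 0 < beta n.
Hypothesis lam0 : 0 <= lam.
Hypothesis alpha01 : 0 < alpha < 1.
Hypothesis r1 : 1 < r.
Hypothesis K1 : 1 < K.

Lemma zeta_ge0 n : 0 <= zeta lam beta n.
Proof. by elim: n => [|n IH] /=; rewrite ?sqr_ge0// addr_ge0// mulr_ge0// sqr_ge0. Qed.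

Lemma xi_ge0 n : 0 <= xi n.
Proof. by elim: n => [|n IH] //=; rewrite addr_ge0// mulr_ge0// ltW. Qed.

Lemma clock_le n : clock n <= clock n.+1.
Proof. by rewrite clockS; have := zeta_ge0 n; lra. Qed.

Lemma clock_ge1 n : 1 <= clock n.
Proof.
by elim: n => [|n IH]; [rewrite clock0|exact: le_trans (clock_le n)].
Qed.

Lemma clock_homo m n : (m <= n)%N -> clock m <= clock n.
Proof.
elim: n => [|n IH]; first by rewrite leqn0 => /eqP->.
by rewrite leq_eqVlt => /predU1P[->//|/IH h]; apply: le_trans (clock_le n).
Qed.

Lemma prodb_gt0 i j : 0 < prodb i j.
Proof. by apply: prodr_gt0. Qed.

Definition anchored (k b : nat) : Prop := let n := (n0 + k)%N in
  [/\ (n0 <= b <= n)%N, weight (track k) = fresh_weight b, height (track k) = prodb b n,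
      floor (track k) = alpha * r ^+ (n - b) &
      forall j, (b < j <= n)%N -> alpha * r ^+ (j - b) < prodb b j].

Lemma track_anchored k : exists b, anchored k b.
Proof.
elim: k => [|k [b []]].
  exists n0; rewrite /anchored /= addn0 prodb_id subnn expr0 mulr1; split => //.
    by rewrite leqnn.
  by move=> j; lia.
case E : (track k) => [d g U f] /= /andP[n0b bn] gE UE fE Hj.
rewrite /anchored /= E; set n := (n0 + k.+1)%N.
have nE : n = (n0 + k).+1 by rewrite /n addnS.
case: ifPn => [_|].
  exists n; rewrite /= prodb_id subnn expr0 mulr1; split => //.
    by rewrite leqnn nE ltnW// ltnS (leq_trans n0b).
  by move=> j; lia.
rewrite negb_or -ltNge => /andP[gN0 fU].
have e1 : U * beta n = prodb b n by rewrite UE nE prodbS.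
have e2 : f * r = alpha * r ^+ (n - b) by rewrite fE nE subSn// exprSr mulrA.
exists b => /=; split => //; first by rewrite n0b nE ltnW// ltnS.
move=> j /andP[bj]; rewrite nE leq_eqVlt => /predU1P[->|]; last first.
  by rewrite ltnS => jn; apply: Hj; rewrite bj.
by rewrite -nE -e1 -e2.
Qed.

Lemma weight_bounds k : 0 <= weight (track k) <= 1.
Proof.
have [b [_ -> _ _ _]] := track_anchored k; rewrite /fresh_weight.
have a1 := clock_ge1 b; apply/andP; split; first by apply: divr_ge0; [rewrite ler0n|lra].
rewrite ler_pdivrMr; last by lra.
by rewrite mul1r (le_trans _ a1)// lern1 leq_b1.
Qed.

Lemma floor_ge k : alpha <= floor (track k).
Proof.
have [b [_ _ _ -> _]] := track_anchored k.
have /andP[al0 al1] := alpha01; have a0 : 0 <= alpha by exact: ltW.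
by rewrite -[X in X <= _]mulr1 ler_wpM2l// exprn_ege1//; exact: ltW.
Qed.

Lemma height_gt_floor k : floor (track k) < height (track k).
Proof.
have [b [/andP[_ bn] _ -> -> Hj]] := track_anchored k.
move: bn; rewrite leq_eqVlt => /predU1P[<-|bn]; last by apply: Hj; rewrite bn leqnn.
by rewrite subnn expr0 mulr1 prodb_id; case/andP: alpha01.
Qed.

(** As the clock runs forward, a useful anchor weighs at least as much as a new
    one would; a useless anchor is replaced at once, so that weight 0 means a
    large [xi] now. *)
Lemma weight_dichotomy k : let n := (n0 + k)%N in
  (weight (track k) = 0 /\ C1 < xi n) \/ (clock n)^-1 <= weight (track k).
Proof.
have [b [/andP[_ bn] gE _ _ _]] := track_anchored k.
have inv : (clock (n0 + k))^-1 <= (clock b)^-1.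
  have := clock_ge1 b; have := clock_ge1 (n0 + k) => h1 h2.
  by rewrite lef_pV2 ?posrE ?clock_homo//; lra.
move=> n; case: k @n bn gE inv => [|k] n bn gE inv.
  rewrite /n addn0 /= /fresh_weight; have [h|h] := leP (xi n0) C1; last by left; rewrite mul0r.
  by right; rewrite mul1r.
move: gE; rewrite /=; case E : (track k) => [d g U f] /=.
case: ifPn => [_ _|].
  rewrite -/n /= /fresh_weight; have [h|h] := leP (xi n) C1; last by left; rewrite mul0r.
  by right; rewrite mul1r.
rewrite negb_or /= => /andP[gN0 _] gE; right; rewrite gE; move: gE gN0.
rewrite /fresh_weight; case: (_ <= _) => [-> _|->]; last by rewrite mul0r eqxx.
by rewrite mul1r.
Qed.

Lemma live01 k : live (track k) = 0 \/
  live (track k) = 1 /\ weight (track k) * height (track k) ^+ 2 < K.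
Proof.
have w1 n : fresh_weight n * 1 ^+ 2 < K.
  have a1 := clock_ge1 n; rewrite expr1n mulr1 (le_lt_trans _ K1)// /fresh_weight.
  rewrite ler_pdivrMr; last by lra.
  by rewrite mul1r (le_trans _ a1)// lern1 leq_b1.
elim: k => [|k]; first by right; split=> //; exact: w1.
rewrite /=; case E : (track k) => [d g U f] /= [->|[-> h]].
  by left; case: ifP => _ /=; rewrite mul0r.
have [h'|h'] := ltP (g * (U * beta (n0 + k.+1)) ^+ 2) K; last first.
  by left; case: ifP => _ /=; rewrite mul1r.
by right; case: ifP => _ /=; rewrite mul1r; split=> //; exact: w1.
Qed.

Lemma dead_has_barrier k : live (track k) = 0 ->
  exists b m, [/\ (n0 <= b < m)%N, xi b <= C1, K * clock b <= prodb b m ^+ 2 &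
    forall j, (b < j < m)%N -> alpha * r ^+ (j - b) < prodb b j].
Proof.
elim: k => [|k IH]; first by move/eqP; rewrite /= oner_eq0.
have [h|[h _]] := live01 k; first by move=> _; apply: IH.
have [b [/andP[n0b bn] gE UE _ Hj]] := track_anchored k.
move: h gE UE; rewrite /=; case E : (track k) => [d g U f] /= -> gE UE.
have [h|h] := ltP (g * (U * beta (n0 + k.+1)) ^+ 2) K.
  by case: ifP => _ /= /eqP; rewrite mul1r oner_eq0.
move=> _; exists b, (n0 + k.+1)%N.
have e1 : U * beta (n0 + k.+1) = prodb b (n0 + k.+1) by rewrite UE addnS prodbS.
rewrite n0b addnS ltnS bn; split => //.
- rewrite leNgt; apply/negP => xc; move: h; rewrite gE /fresh_weight (lt_geF xc) !mul0r; have k1 := K1; lra.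
- move: h; rewrite e1 gE /fresh_weight addnS.
  have k1 := K1; case: (_ <= C1); last by rewrite !mul0r; lra.
  by have a1 := clock_ge1 b; rewrite mul1r mulrC ler_pdivlMr//; lra.
Qed.

(** The first term vanishes for a fresh anchor and is nonpositive for a product
    below the floor, hence giving up an anchor does not decrease it.  The second
    one rewards the return of [xi] to moderate values while anchors are
    useless. *)
Definition potential (eta x a : R) (t : tracker R) : R :=
  (height t ^+ 2 - floor t * height t - (1 - alpha)) * weight t - eta * x / a.

(** Pathwise part of the drift estimate: the left-hand side is what the
    potential would become with the anchor kept and the clock stopped.  A reset
    or a tick of the clock does not decrease it; only success may do so, by at
    most [bm^2 K], because the last jump of the height is one factor [beta]. *)
Lemma potential_step (eta bm : R) k : 0 <= eta -> beta (n0 + k.+1) <= bm ->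
  let n := (n0 + k)%N in let b := beta n.+1 in
  let t := track k in let t' := track k.+1 in
  live t * (((height t * b) ^+ 2 - floor t * r * (height t * b) - (1 - alpha)) * weight t
            - eta * (1 + b * xi n) / clock n)
  <= live t' * potential eta (xi n.+1) (clock n.+1) t' + bm ^+ 2 * K * (live t - live t').
Proof.
move=> eta0 bbm; cbv zeta.
set n := (n0 + k)%N; set b := beta n.+1; set t := track k; set t' := track k.+1.
have /andP[al0 al1] := alpha01; have k1 := K1; have r1' := r1.
have b0 : 0 < b by exact: beta0.
have bE : b = beta (n0 + k.+1) by rewrite addnS.
rewrite -bE in bbm.
have g01 : 0 <= weight t by have /andP[] := weight_bounds k.
have f0 : alpha <= floor t := floor_ge k.
have fU : floor t < height t := height_gt_floor k.
have [d0|[d1 gU]] := live01 k.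
  have d0' : live t' = 0.
    by move: d0; rewrite /t' /=; case: (track k) => ? ? ? ? /= ->;
       case: ifP => _ /=; rewrite mul0r.
  by rewrite d0 d0' !mul0r subrr mulr0 addr0.
have a1 : 1 <= clock n := clock_ge1 n.
have X : 0 <= eta * (1 + b * xi n).
  by rewrite mulr_ge0// addr_ge0// mulr_ge0 ?xi_ge0// ltW.
have aa : eta * (1 + b * xi n) / clock n.+1 <= eta * (1 + b * xi n) / clock n.
  by rewrite ler_wpM2l// lef_pV2 ?posrE ?clock_le//; have := clock_le n; lra.
have X' : 0 <= eta * (1 + b * xi n) / clock n by apply: divr_ge0 => //; lra.
have bsq : b ^+ 2 <= bm ^+ 2 by rewrite lerXn2r ?nnegrE//; lra.
have a1' : 0 < clock n.+1 by have := clock_le n; lra.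
move: aa X'; rewrite d1 mul1r /potential.
have -> : xi n.+1 = 1 + b * xi n by [].
set Y := eta * _ / clock n; set Y' := eta * _ / clock n.+1 => aa X'.
rewrite /t' /=; move: d1 gU g01 f0 fU; rewrite /t -bE.
case: (track k) => d g U f /= -> gU g0 f0 fU; rewrite mul1r.
have U0 : 0 < U by lra.
have Ub0 : 0 < U * b by rewrite mulr_gt0.
have fUb : 0 <= f * r * (U * b) by rewrite !mulr_ge0//; lra.
have [live'|dead] := ltP (g * (U * b) ^+ 2) K; last first.
  have le1 : (U * b) ^+ 2 * g <= bm ^+ 2 * K.
    rewrite exprMn mulrAC mulrC; apply: ler_pM; rewrite ?sqr_ge0//.
      by rewrite mulr_ge0// sqr_ge0.
    by rewrite mulrC ltW.
  have le2 : 0 <= (f * r * (U * b) + (1 - alpha)) * g by rewrite mulr_ge0//; lra.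
  have -> : ((U * b) ^+ 2 - f * r * (U * b) - (1 - alpha)) * g =
     (U * b) ^+ 2 * g - (f * r * (U * b) + (1 - alpha)) * g by ring.
  by case: ifP => _ /=; rewrite mul0r subr0 mulr1; lra.
have fresh_weight_ge0 : 0 <= fresh_weight (n0 + k.+1).
  by apply: divr_ge0; [rewrite ler0n|rewrite addnS; exact: ltW].
case: ifPn => [|_] /=; last by rewrite subrr mulr0 addr0 mul1r; lra.
rewrite subrr mulr0 addr0 mul1r.
have -> : (1 ^+ 2 - alpha * 1 - (1 - alpha)) * fresh_weight (n0 + k.+1) = 0 by ring.
case/orP => [/eqP->|le]; first by rewrite mulr0; lra.
have : ((U * b) ^+ 2 - f * r * (U * b) - (1 - alpha)) * g <= 0.
  apply: mulr_le0_ge0 => //; have : 0 <= (f * r - U * b) * (U * b).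
    by rewrite mulr_ge0 ?subr_ge0// ltW.
  rewrite expr2; lra.
lra.
Qed.

(** The right-hand side is the left-hand side of [potential_step] averaged over
    the next [beta], of mean [q] and of second moment 1.  For a useful anchor
    the gain is [floor height (1 - r q) weight >= 2 eta / clock]; for a useless
    one it comes from [E xi_(n+1) - xi_n = 1 - (1 - q) xi_n <= - 1], which
    holds above [C1 = 2 / (1 - q)]. *)
Lemma potential_drift (q eta : R) k :
  0 <= q < 1 -> r * q < 1 -> eta = alpha ^+ 2 * (1 - r * q) / 2 -> C1 = 2 / (1 - q) ->
  let n := (n0 + k)%N in let t := track k in
  live t * potential eta (xi n) (clock n) t + eta * (live t / clock n) <=
  live t * ((height t ^+ 2 - floor t * r * (q * height t) - (1 - alpha)) * weight t
            - eta * (1 + q * xi n) / clock n).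
Proof.
move=> /andP[q0 q1] rq etaE C1E; cbv zeta; set n := (n0 + k)%N; set t := track k.
have /andP[al0 al1] := alpha01.
have [->|[-> _]] := live01 k; first by rewrite !mul0r mulr0 addr0.
have g0 : 0 <= weight t by have /andP[] := weight_bounds k.
have f0 : alpha <= floor t := floor_ge k.
have fU : floor t < height t := height_gt_floor k.
have a1 : 1 <= clock n := clock_ge1 n.
have v0 : 0 < (clock n)^-1 by rewrite invr_gt0; lra.
have x0 : 0 <= xi n := xi_ge0 n.
have eta0 : 0 < eta by rewrite etaE divr_gt0// mulr_gt0 ?exprn_gt0//; lra.
rewrite /potential !mul1r -subr_ge0.
set v := (clock n)^-1; rewrite -/v in v0.
have -> : (height t ^+ 2 - floor t * r * (q * height t) - (1 - alpha)) * weight t -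
  eta * (1 + q * xi n) * v - ((height t ^+ 2 - floor t * height t - (1 - alpha)) *
  weight t - eta * xi n * v + eta * v) =
  (floor t * height t) * (1 - r * q) * weight t + eta * v * ((1 - q) * xi n - 2) by ring.
have D0 : 0 <= (floor t * height t) * (1 - r * q) * weight t.
  by rewrite !mulr_ge0//; lra.
have [[g_eq0 xC]|vg] := weight_dichotomy k.
  have : 0 <= eta * v * ((1 - q) * xi n - 2).
    rewrite mulr_ge0 ?mulr_ge0 ?ltW// subr_gt0.
    by move: xC; rewrite C1E ltr_pdivrMr ?subr_gt0// mulrC.
  lra.
have : 2 * eta * v <= (floor t * height t) * (1 - r * q) * weight t.
  apply: ler_pM => //; [by rewrite mulr_ge0// ltW|exact: ltW|].
  have -> : 2 * eta = alpha ^+ 2 * (1 - r * q) by rewrite etaE; field.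
  apply: ler_wpM2r; first by lra.
  by rewrite expr2; apply: ler_pM; lra.
have : 0 <= eta * v * ((1 - q) * xi n).
  apply: mulr_ge0; first by rewrite ltW// mulr_gt0.
  by apply: mulr_ge0 => //; lra.
lra.
Qed.

(** Splitting of the sum of [zeta] into windows of length less than [L], whose
    squared products have mean 1, and longer windows, whose products have the
    exponentially small mean [q^length].  The squares of the latter do not have
    small means, hence the use of their first powers. *)
Definition near (L n : nat) : R := \sum_(0 <= y < n) (lam ^+ 2 * prodb 0 y ^+ 2 +
  \sum_(0 <= i < y) (if (y < i.+1 + L)%N then prodb i.+1 y ^+ 2 else 0)).

Definition far (L n : nat) : R := \sum_(0 <= y < n) \sum_(0 <= i < y)
  (if (y < i.+1 + L)%N then 0 else prodb i.+1 y).

Lemma sum_sqr_le (s : seq nat) (F : nat -> R) : (forall i, 0 <= F i) ->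
  \sum_(i <- s) F i ^+ 2 <= (\sum_(i <- s) F i) ^+ 2.
Proof.
move=> F0; elim: s => [|i s IH]; first by rewrite !big_nil expr0n.
rewrite !big_cons.
have : 0 <= F i * \sum_(j <- s) F j by rewrite mulr_ge0// sumr_ge0.
move: IH; set X := \sum_(j <- s) F j; set Y := \sum_(j <- s) _; nra.
Qed.

(** The numerator bounds from below the indicator of [near <= l] and
    [far <= 1], on which [clock <= n + 2 + l] because the squared products of
    the long windows sum to at most [far^2].  This linear form is easy to
    integrate. *)
Lemma clock_inv_lower (l : R) (L n : nat) : 0 < l ->
  (1 - near L n / l - far L n) / (n%:R + 2 + l) <= (clock n)^-1.
Proof.
move=> l0.
have n0' : 0 <= n%:R :> R by rewrite ler0n.
have den : 0 < n%:R + 2 + l by lra.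
have a1 := clock_ge1 n.
have P0 i j : 0 <= prodb i j by rewrite ltW// prodb_gt0.
have near0 : 0 <= near L n.
  apply: sumr_ge0 => y _; rewrite addr_ge0 ?mulr_ge0 ?sqr_ge0//.
  by apply: sumr_ge0 => i _; case: ifP => // _; rewrite sqr_ge0.
have far0 : 0 <= far L n.
  by apply: sumr_ge0 => y _; apply: sumr_ge0 => i _; case: ifP.
have clock_ub : clock n <= 1 + n%:R + (near L n + far L n ^+ 2).
  rewrite clockE lerD2l.
  have F0 y i : 0 <= (if (y < i.+1 + L)%N then 0 else prodb i.+1 y) by case: ifP.
  apply: (@le_trans _ _ (near L n + \sum_(0 <= y < n) (\sum_(0 <= i < y)
     (if (y < i.+1 + L)%N then 0 else prodb i.+1 y)) ^+ 2)); last first.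
    by rewrite lerD2l; apply: sum_sqr_le => y; apply: sumr_ge0 => i _.
  rewrite /near -big_split; apply: ler_sum => y _ /=; rewrite zetaE -addrA lerD2l.
  apply: le_trans (lerD (lexx _) (sum_sqr_le _ (F0 y))).
  rewrite -big_split; apply: ler_sum => i _ /=; case: ifP => _.
    by rewrite expr0n addr0.
  by rewrite add0r.
have [neg|pos] := leP (1 - near L n / l - far L n) 0.
  by apply: (@le_trans _ _ 0); [apply: mulr_le0_ge0 => //; rewrite invr_ge0 ltW|rewrite invr_ge0; lra].
have nl : 0 <= near L n / l by apply: divr_ge0 => //; exact: ltW.
have nl1 : near L n <= l.
  have : near L n / l <= 1 by lra.
  by rewrite ler_pdivrMr// mul1r.
have f1 : far L n ^+ 2 <= 1 by rewrite expr_le1//; lra.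
apply: (@le_trans _ _ (n%:R + 2 + l)^-1).
  by rewrite ler_pdivrMr// mulVf ?gt_eqF//; lra.
by rewrite lef_pV2 ?posrE//; lra.
Qed.

End Tracker.

(** * A divergent sum *)

(** On the dyadic block from [2^j] to [2^(j+1)] the terms are at least of order
    [1 / (2^j j)], so the block contributes a term of the harmonic series. *)
Lemma log_harmonic_unbounded (R : realType) (u : nat -> R) (c C : R) (n0 j1 : nat) :
  0 < c -> (forall n, 0 <= u n) -> (forall N, \sum_(0 <= k < N) u k <= C) ->
  (forall j n, (j1 <= j)%N -> (n0 <= n)%N -> (2 ^ j <= n < 2 ^ j.+1)%N ->
     c / (2 ^+ j.+1 * j.+1%:R) <= u (n - n0)%N) -> False.
Proof.
move=> c0 u0 uC Hu.
pose a := maxn j1 n0.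
have na j : (a <= j)%N -> (n0 <= 2 ^ j)%N.
  move=> aj; apply: leq_trans (ltnW (ltn_expl j (ltnSn 1))).
  by apply: leq_trans aj; rewrite leq_maxr.
have block j : (a <= j)%N ->
    c / 2 * harmonic j <= \sum_(2 ^ j <= n < 2 ^ j.+1) u (n - n0)%N.
  move=> aj; apply: (@le_trans _ _ (\sum_(2 ^ j <= n < 2 ^ j.+1) c / (2 ^+ j.+1 * j.+1%:R))).
    rewrite sumr_const_nat expnS mul2n -addnn addnK -[leRHS]mulr_natr natrX /harmonic/= exprS.
    have X0 : 0 < 2 ^+ j :> R by rewrite exprn_gt0.
    have Y0 : 0 < j.+1%:R :> R by rewrite ltr0n.
    move: (2 ^+ j) (j.+1%:R : R) X0 Y0 => X Y X0 Y0.
    by rewrite le_eqVlt; apply/orP; left; apply/eqP; field; rewrite !gt_eqF.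
  rewrite big_nat_cond [leRHS]big_nat_cond; apply: ler_sum => n; rewrite andbT => nj.
  have aj1 : (j1 <= j)%N by apply: leq_trans aj; rewrite leq_maxl.
  apply: Hu => //; apply: leq_trans (na _ aj) _; by case/andP: nj.
have blocks b : (a <= b)%N ->
    \sum_(a <= j < b) c / 2 * harmonic j <= \sum_(2 ^ a <= n < 2 ^ b) u (n - n0)%N.
  elim: b => [|b IH]; first by rewrite leqn0 => /eqP->; rewrite !big_geq.
  rewrite leq_eqVlt => /predU1P[->|]; first by rewrite !big_geq.
  rewrite ltnS => ab; rewrite big_nat_recr//=.
  rewrite [leRHS](big_cat_nat (n := (2 ^ b))) ?leq_exp2l//=.
  by apply: lerD; [exact: IH|exact: block].
have bnd b : (a <= b)%N -> \sum_(a <= j < b) c / 2 * harmonic j <= C.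
  move=> ab; apply: (le_trans (blocks b ab)); apply: le_trans (uC (2 ^ b)%N).
  apply: (@le_trans _ _ (\sum_(n0 <= n < 2 ^ b) u (n - n0)%N)).
    rewrite [leRHS](big_cat_nat (n := (2 ^ a))) ?na ?leq_exp2l//=.
    by rewrite lerDr sumr_ge0.
  have -> : \sum_(n0 <= n < 2 ^ b) u (n - n0)%N = \sum_(0 <= k < 2 ^ b - n0) u k.
    by rewrite -{1}[n0]add0n big_addn; apply: eq_bigr => k _; rewrite addnK.
  rewrite [leRHS](big_cat_nat (n := (2 ^ b - n0))) ?leq_subr//=.
  by rewrite lerDl sumr_ge0.
apply: (@dvg_harmonic R).
apply: nondecreasing_is_cvgn.
  apply: (@nondecreasing_series R harmonic xpredT 0%N) => n _ _.
  by rewrite invr_ge0 ler0n.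
exists (\sum_(0 <= j < a) harmonic j + 2 / c * C) => _ [n _ <-].
have h0 j : 0 <= harmonic j :> R by rewrite invr_ge0 ler0n.
apply: (@le_trans _ _ (\sum_(0 <= j < maxn a n) harmonic j)).
  rewrite /series/= [leRHS](big_cat_nat (n := n)) ?leq_maxr//=.
  by rewrite lerDl sumr_ge0.
rewrite (big_cat_nat (n := a)) ?leq_maxl//= lerD2l.
have := bnd (maxn a n) (leq_maxl _ _); rewrite -mulr_sumr.
move: (\sum_(a <= j < maxn a n) _) => s h.
have -> : s = 2 / c * (c / 2 * s) by field; rewrite gt_eqF.
by apply: ler_wpM2l => //; rewrite ltW// divr_gt0.
Qed.

(** * Independence across sites *)

Section Independence.
Context {dE : measure_display} {E : measurableType dE} {R : realType}.
Variables (P : probability E R) (omega : int -> {RV P >-> R}).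
Hypothesis omega_iid : iid omega.

(** Finite intersections of events at single sites of [J]: a pi-system on which
    mutual independence can be read off directly. *)
Definition cylinder (J : set int) : set (set E) :=
  [set A | exists (K : {fset int}) (B : int -> set R),
    [/\ [set` K] `<=` J, forall k, measurable (B k) &
        A = \bigcap_(k in [set` K]) (omega k @^-1` B k)]].

Definition sites (J : set int) := g_sigma_algebraType (cylinder J).

Lemma measurable_omega k (B : set R) : measurable B -> measurable (omega k @^-1` B).
Proof. by move=> mB; rewrite -[X in measurable X]setTI; apply: measurable_funPT. Qed.

Lemma cylinder_measurable J (A : set E) : cylinder J A -> measurable A.
Proof.
move=> [K [B [KJ mB ->]]]; apply: fin_bigcap_measurable => [|k _].
  exact: finite_fset.
exact: measurable_omega.
Qed.

Lemma sites_measurable J (A : set E) :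
  @measurable _ (sites J) A -> measurable A.
Proof.
apply: smallest_sub; first exact: sigma_algebra_measurable.
exact: cylinder_measurable.
Qed.

Lemma cylinder_setI J : setI_closed (cylinder J).
Proof.
move=> _ _ [K1 [B1 [K1J mB1 ->]]] [K2 [B2 [K2J mB2 ->]]].
exists (K1 `|` K2)%fset.
exists (fun k => (if k \in K1 then B1 k else setT) `&` (if k \in K2 then B2 k else setT)).
split.
- by move=> k /=; rewrite in_fsetU => /orP[|]; [exact: K1J|exact: K2J].
- by move=> k; apply: measurableI; case: ifP.
- apply/seteqP; split => e.
    move=> [h1 h2] k /= _; split; case: ifP => // kK; [exact: h1|exact: h2].
  move=> h; split => k /= kK.
    by have := h k; rewrite /= in_fsetU kK => /(_ isT)[].
  by have := h k; rewrite /= in_fsetU kK orbT => /(_ isT)[].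
Qed.

Lemma cylinderT J : cylinder J setT.
Proof.
exists fset0, (fun=> setT); split => //.
by apply/seteqP; split => // e _ k.
Qed.

Definition to_sites (J : set int) : E -> sites J := id.

Lemma measurable_to_sites J : measurable_fun setT (to_sites J).
Proof. by move=> _ A mA; rewrite setTI; exact: (@sites_measurable J A mA). Qed.

HB.instance Definition _ J :=
  isMeasurableFun.Build _ _ _ _ (to_sites J) (@measurable_to_sites J).

Lemma omega_site (J : set int) k : J k ->
  measurable_fun setT (omega k : sites J -> R).
Proof.
move=> Jk _ B mB; rewrite setTI; apply: sub_sigma_algebra.
exists [fset k]%fset, (fun=> B); split => //.
  by move=> j /=; rewrite in_fset1 => /eqP->.
apply/seteqP; split => e /= h.
  by move=> j /=; rewrite in_fset1 => /eqP->.
by have := h k; apply; rewrite /= in_fset1.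
Qed.

Lemma cylinder_indep J i (A : set E) (B : set R) : ~ J i -> cylinder J A ->
  measurable B -> P (A `&` omega i @^-1` B) = (P A * P (omega i @^-1` B))%E.
Proof.
move=> Ji [K [C [KJ mC ->]]] mB.
have [ind _] := omega_iid.
have iK : i \notin K by apply/negP => h; apply: Ji; exact: KJ.
pose D k := if k == i then omega i @^-1` B else omega k @^-1` C k.
have Dk k : preimage_set_system [set: E] (omega k) measurable (D k).
  rewrite /D; case: eqP => [->|_]; first by exists B => //; rewrite setTI.
  by exists (C k) => //; rewrite setTI.
have h1 := ind (i |` K)%fset D (fun k _ => Dk k).
have h2 := ind K D (fun k _ => Dk k).
rewrite big_fsetU1// in h1.
have DK : \bigcap_(k in [set` K]) D k = \bigcap_(k in [set` K]) (omega k @^-1` C k).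
  apply: eq_bigcapr => k /= kK; rewrite /D; case: eqP => // ki.
  by rewrite -ki kK in iK.
have DiK : \bigcap_(k in [set` (i |` K)%fset]) D k =
    \bigcap_(k in [set` K]) (omega k @^-1` C k) `&` omega i @^-1` B.
  rewrite -DK; apply/seteqP; split => e.
    move=> h; split => [k /= kK|]; first by apply: h; rewrite /= in_fset1U kK orbT.
    by have := h i; rewrite /= in_fset1U eqxx /D eqxx; apply.
  by move=> [h h'] k /=; rewrite in_fset1U => /orP[/eqP->|kK]; [rewrite /D eqxx|exact: h].
by rewrite -DiK h1 -DK h2 /D eqxx muleC.
Qed.

(** Both sides are finite measures in [A] that agree on the cylinders. *)
Lemma sites_indep J i (A : set E) (B : set R) : ~ J i -> @measurable _ (sites J) A ->
  measurable B -> P (A `&` omega i @^-1` B) = (P A * P (omega i @^-1` B))%E.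
Proof.
move=> Ji mA mB.
have mH := measurable_omega i mB.
have p0 : 0 <= fine (P (omega i @^-1` B)) by rewrite fine_ge0.
have pE : P (omega i @^-1` B) = (fine (P (omega i @^-1` B)))%:E.
  by rewrite fineK// fin_num_measure.
pose m1 := pushforward (mrestr P mH) (to_sites J).
pose m2 := mscale (NngNum p0) (distribution P (to_sites J)).
have := @measure_unique _ R (sites J) (cylinder J) (fun=> setT) erefl
  (@cylinder_setI J) (fun=> @cylinderT J).
move=> /(_ _ m1 m2) H.
have : m1 A = m2 A.
  apply: H => //.
  - by apply/seteqP; split => // e _; exists 0%N.
  - move=> C cC; rewrite /m1 /m2 /pushforward /= /mrestr /mscale/= /distribution /pushforward /=.
    by rewrite (cylinder_indep Ji cC mB) -pE muleC.
  - move=> k; apply: (@le_lt_trans _ _ 1%E); last by rewrite ltry.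
    by apply: probability_le1; apply: measurableI; [exact: measurableT|exact: mH].
rewrite /m1 /m2 /mscale /pushforward /mrestr /distribution /= => ->//.
by rewrite muleC -pE.
Qed.

End Independence.

(** * Bounded random variables and their means *)

Definition bmfun d (T : measurableType d) (R : realType) (X : T -> R) : Prop :=
  measurable_fun setT X /\ exists M, forall t, `|X t| <= M.

Section Bmfun.
Context d (T : measurableType d) (R : realType).
Implicit Types X Y : T -> R.

Lemma bmfun_cst c : bmfun (fun _ : T => c : R).
Proof. by split; [exact: measurable_cst|exists `|c|]. Qed.

Lemma bmfunD X Y : bmfun X -> bmfun Y -> bmfun (fun t => X t + Y t).
Proof.
move=> [mX [M hM]] [mY [N hN]]; split; first exact: measurable_funD.
by exists (M + N) => t; apply: le_trans (ler_normD _ _) _; exact: lerD.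
Qed.

Lemma bmfunM X Y : bmfun X -> bmfun Y -> bmfun (fun t => X t * Y t).
Proof.
move=> [mX [M hM]] [mY [N hN]]; split; first exact: measurable_funM.
by exists (M * N) => t; rewrite normrM; apply: ler_pM.
Qed.

Lemma bmfunN X : bmfun X -> bmfun (fun t => - X t).
Proof.
move=> [mX [M hM]]; split; first exact: measurableT_comp.
by exists M => t; rewrite normrN.
Qed.

Lemma bmfunB X Y : bmfun X -> bmfun Y -> bmfun (fun t => X t - Y t).
Proof. by move=> bX bY; apply: bmfunD => //; exact: bmfunN. Qed.

Lemma bmfunX X n : bmfun X -> bmfun (fun t => X t ^+ n).
Proof.
move=> bX; elim: n => [|n IH]; first exact: bmfun_cst.
rewrite (_ : (fun t => _) = (fun t => X t * X t ^+ n)); first exact: bmfunM.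
by apply/funext => t; rewrite exprS.
Qed.

Lemma bmfun_sum (I : Type) (s : seq I) (F : I -> T -> R) :
  (forall i, bmfun (F i)) -> bmfun (fun t => \sum_(i <- s) F i t).
Proof.
move=> bF; elim: s => [|i s IH].
  rewrite (_ : (fun t => _) = (fun _ => 0)); first exact: bmfun_cst.
  by apply/funext => t; rewrite big_nil.
rewrite (_ : (fun t => _) = (fun t => F i t + \sum_(j <- s) F j t)); first exact: bmfunD.
by apply/funext => t; rewrite big_cons.
Qed.

Lemma bmfun_if (b : T -> bool) X Y : measurable_fun setT b ->
  bmfun X -> bmfun Y -> bmfun (fun t => if b t then X t else Y t).
Proof.
move=> mb [mX [M hM]] [mY [N hN]]; split; first exact: measurable_fun_ifT.
exists (Num.max M N) => t; rewrite le_max; case: ifP => _; first by rewrite hM.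
by rewrite hN orbT.
Qed.

Lemma bmfun_bool (b : T -> bool) : measurable_fun setT b ->
  bmfun (fun t => (b t)%:R : R).
Proof.
move=> mb; rewrite (_ : (fun t => _) = (fun t => if b t then 1 else 0)).
  by apply: bmfun_if => //; exact: bmfun_cst.
by apply/funext => t; case: (b t).
Qed.

Lemma bmfunV X (c : R) : 0 < c -> (forall t, c <= X t) -> measurable_fun setT X ->
  bmfun (fun t => (X t)^-1).
Proof.
move=> c0 cX mX; have X0 t : 0 < X t by apply: lt_le_trans c0 _.
split.
  rewrite (_ : (fun t => _) = (@powR R ^~ (-1)) \o X); first exact: measurableT_comp.
  by apply/funext => t /=; rewrite powR_inv1// ltW.
exists c^-1 => t; rewrite ger0_norm; last by rewrite invr_ge0 ltW.
by rewrite lef_pV2 ?posrE.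
Qed.

End Bmfun.

Section Mean.
Context d (T : measurableType d) (R : realType) (P : probability T R).
Implicit Types X Y : T -> R.

Definition mean X : R := \int[P]_t X t.

Lemma bmfun_integrable X : bmfun X -> P.-integrable setT (EFin \o X).
Proof.
move=> [mX [M hM]]; apply: measurable_bounded_integrable => //.
  by apply: (@le_lt_trans _ _ 1%E); rewrite ?ltry// probability_le1.
exists M; split; first exact: num_real.
by move=> x Mx t _; apply: le_trans (hM t) (ltW Mx).
Qed.

Lemma meanD X Y : bmfun X -> bmfun Y -> mean (fun t => X t + Y t) = mean X + mean Y.
Proof. by move=> bX bY; apply: RintegralD => //; exact: bmfun_integrable. Qed.

Lemma meanZ c X : bmfun X -> mean (fun t => c * X t) = c * mean X.
Proof. by move=> bX; apply: RintegralZl => //; exact: bmfun_integrable. Qed.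

Lemma mean_cst c : mean (fun=> c) = c.
Proof.
by rewrite /mean Rintegral_cst//; rewrite [X in fine X]probability_setT mulr1.
Qed.

Lemma meanB X Y : bmfun X -> bmfun Y -> mean (fun t => X t - Y t) = mean X - mean Y.
Proof. by move=> bX bY; apply: RintegralB => //; exact: bmfun_integrable. Qed.

Lemma mean_le X Y : bmfun X -> bmfun Y -> (forall t, X t <= Y t) -> mean X <= mean Y.
Proof. by move=> bX bY XY; apply: le_Rintegral => //; exact: bmfun_integrable. Qed.

Lemma mean_sum (I : Type) (s : seq I) (F : I -> T -> R) :
  (forall i, bmfun (F i)) ->
  mean (fun t => \sum_(i <- s) F i t) = \sum_(i <- s) mean (F i).
Proof.
move=> bF; elim: s => [|i s IH].
  rewrite big_nil -[RHS](mean_cst 0); congr mean.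
  by apply/funext => t; rewrite big_nil.
rewrite big_cons -IH -meanD//; last exact: bmfun_sum.
by congr mean; apply/funext => t; rewrite big_cons.
Qed.

Lemma mean_fin X : bmfun X -> (\int[P]_t (X t)%:E)%E = (mean X)%:E.
Proof.
move=> bX; rewrite /mean /Rintegral fineK//.
exact/integrable_fin_num/bmfun_integrable.
Qed.

End Mean.

Section MeanIndependence.
Context {dE : measure_display} {E : measurableType dE} {R : realType}.
Variables (P : probability E R) (omega : int -> {RV P >-> R}).
Hypothesis omega_iid : iid omega.

Local Notation sites := (sites omega).

Lemma bmfun_sites J (X : E -> R) : bmfun (X : sites J -> R) -> bmfun X.
Proof.
move=> [mX bX]; split => //.
exact: (measurableT_comp mX (@measurable_to_sites _ _ _ _ omega J)).
Qed.

Lemma bmfun_sites_sub (J J' : set int) (X : E -> R) : J `<=` J' ->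
  bmfun (X : sites J -> R) -> bmfun (X : sites J' -> R).
Proof.
move=> JJ' [mX bX]; split => // _ B mB.
have := mX measurableT B mB; rewrite !setTI.
apply: smallest_sub; first exact: smallest_sigma_algebra.
move=> A [K [C [KJ mC ->]]]; apply: sub_sigma_algebra.
by exists K, C; split => // k /KJ/JJ'.
Qed.

Lemma bmfun_omega (J : set int) k (h : R -> R) : J k -> measurable_fun setT h ->
  (exists M, forall r, `|h r| <= M) -> bmfun (fun e : sites J => h (omega k e)).
Proof.
move=> Jk mh [M hM]; split; last by exists M.
by apply: measurableT_comp => //; exact: omega_site.
Qed.

(** The pair of the sites in [J] and of the site [i] has a product law, and the
    theorem of Tonelli applies. *)
Lemma integral_indep (J : set int) i (X : E -> R) (h : R -> R) : ~ J i ->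
  measurable_fun setT (X : sites J -> R) -> (forall e, 0 <= X e) ->
  measurable_fun setT h -> (forall r, 0 <= h r) ->
  (\int[P]_e (X e * h (omega i e))%:E =
   \int[P]_e (X e)%:E * \int[P]_e (h (omega i e))%:E)%E.
Proof.
move=> Ji mX X0 mh h0.
pose phi (e : E) : sites J * R := (to_sites omega J e, omega i e).
have mphi : measurable_fun setT phi.
  by apply: measurable_fun_pair => //; exact: measurable_to_sites.
pose m1 := distribution P (to_sites omega J); pose m2 := distribution P (omega i).
pose f (p : sites J * R) : \bar R := (X p.1 * h p.2)%:E.
have mf : measurable_fun setT f.
  apply/measurable_EFinP; apply: measurable_funM.
    exact: measurableT_comp mX measurable_fst.
  exact: measurableT_comp mh measurable_snd.
have f0 p : (0 <= f p)%E by rewrite lee_fin mulr_ge0.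
transitivity (\int[pushforward P phi]_p f p)%E.
  by rewrite ge0_integral_pushforward.
transitivity (\int[m1 \x m2]_p f p)%E.
  apply: eq_measure_integral => A mA _; apply/esym/product_measure_unique => //.
  move=> A1 A2 mA1 mA2; rewrite /pushforward /m1 /m2 /distribution /pushforward.
  exact: (sites_indep omega_iid Ji mA1 mA2).
rewrite fubini_tonelli1// /fubini_F /f /=.
transitivity (\int[m1]_x ((X x)%:E * \int[m2]_y (h y)%:E))%E.
  apply: eq_integral => x _; under eq_integral do rewrite EFinM.
  rewrite ge0_integralZl//; first by apply/measurable_EFinP.
    by move=> y _; rewrite lee_fin.
  by rewrite lee_fin.
have mhi : measurable_fun setT (EFin \o h) by apply/measurable_EFinP.
rewrite ge0_integralZr//; do ?[by apply/measurable_EFinP |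
  by apply: integral_ge0 => y _; rewrite lee_fin].
congr (_ * _)%E; rewrite /m1 /m2.
  by rewrite ge0_integral_distribution//; apply/measurable_EFinP.
by rewrite ge0_integral_distribution.
by move=> x _; rewrite lee_fin.
Qed.

(** Reduction to the nonnegative case by adding to [X] a constant bound. *)
Lemma mean_indep (J : set int) i (X : E -> R) (h : R -> R) : ~ J i ->
  bmfun (X : sites J -> R) ->
  measurable_fun setT h -> (forall r, 0 <= h r) -> (exists M, forall r, `|h r| <= M) ->
  mean P (fun e => X e * h (omega i e)) = mean P X * mean P (fun e => h (omega i e)).
Proof.
move=> Ji bX mh h0 hb.
have bXE := bmfun_sites bX.
have bh : bmfun (fun e => h (omega i e)).
  by apply: (@bmfun_sites setT); apply: bmfun_omega.
have pos (Y : E -> R) : bmfun (Y : sites J -> R) -> (forall e, 0 <= Y e) ->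
    mean P (fun e => Y e * h (omega i e)) = mean P Y * mean P (fun e => h (omega i e)).
  move=> bY Y0; have bYE := bmfun_sites bY; apply: EFin_inj.
  rewrite -mean_fin; last exact: bmfunM.
  by rewrite EFinM -!mean_fin// (integral_indep Ji)//; case: bY.
have [mX [M hM]] := bX.
have M0 e : 0 <= X e + M by have := hM e; rewrite ler_norml => /andP[]; lra.
have := pos (fun e => X e + M) (bmfunD bX (bmfun_cst _ _)) M0.
rewrite meanD//; last exact: bmfun_cst.
rewrite mean_cst mulrDl -(meanZ P M bh).
rewrite (_ : (fun e => (X e + M) * _) =
    (fun e => X e * h (omega i e) + M * h (omega i e))); last first.
  by apply/funext => e; rewrite mulrDl.
have bXh : bmfun (fun e => X e * h (omega i e)) by exact: bmfunM.
have bMh : bmfun (fun e => M * h (omega i e)) by apply: bmfunM => //; exact: bmfun_cst.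
by rewrite meanD// => e; exact: addIr e.
Qed.

Lemma mean_ident i j (h : R -> R) : measurable_fun setT h -> (forall r, 0 <= h r) ->
  mean P (fun e => h (omega i e)) = mean P (fun e => h (omega j e)).
Proof.
move=> mh h0; rewrite /mean /Rintegral; congr fine.
have mhi : measurable_fun setT (EFin \o h) by apply/measurable_EFinP.
have D k : (\int[P]_e (h (omega k e))%:E = \int[distribution P (omega k)]_r (h r)%:E)%E.
  by rewrite ge0_integral_distribution.
rewrite !D; apply: eq_measure_integral => A mA _.
by case: omega_iid => _; apply.
Qed.

End MeanIndependence.

(** * Almost every environment has barriers *)

Section TrackS.
Context {R : realType}.
Variables (lam alpha r C1 K : R) (n0 : nat) (beta : nat -> R).
Local Notation track := (track lam alpha r C1 K n0 beta).
Local Notation fresh_weight := (fresh_weight lam C1 beta).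

Definition fresh k : bool := (weight (track k) == 0) ||
  (height (track k) * beta (n0 + k.+1) <= floor (track k) * r).

(** The transition of the tracker field by field, in the form needed for
    measurability. *)
Lemma trackS k : track k.+1 =
  Tracker (live (track k) *
             (weight (track k) * (height (track k) * beta (n0 + k.+1)) ^+ 2 < K)%R%:R)
    (if fresh k then fresh_weight (n0 + k.+1) else weight (track k))
    (if fresh k then 1 else height (track k) * beta (n0 + k.+1))
    (if fresh k then alpha else floor (track k) * r).
Proof. by rewrite /fresh /=; case: (track k) => d g U f /=; case: ifP. Qed.

End TrackS.

Section RandomTracker.
Context {dE : measure_display} {E : measurableType dE} {R : realType}.
Variables (P : probability E R) (omega : int -> {RV P >-> R}).
Hypothesis omega_iid : iid omega.
Variables (h : R -> R) (bm q : R).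
Hypothesis mh : measurable_fun setT h.
Hypothesis h0 : forall x, 0 < h x.
Hypothesis hbm : forall x, h x <= bm.
Hypothesis q01 : 0 <= q < 1.
Hypothesis mean_h : mean P (fun e => h (omega 0 e)) = q.
Hypothesis mean_h2 : mean P (fun e => h (omega 0 e) ^+ 2) = 1.

Definition beta_of (e : E) (n : nat) : R := h (omega n%:Z e).

Definition upto (n : nat) : set int := [set j | j <= n%:Z].

Local Notation sites n := (sites omega (upto n)).
Local Notation bt := beta_of.

Let h_bounded : exists M, forall x, `|h x| <= M.
Proof. by exists bm => x; rewrite ger0_norm// ltW. Qed.

Lemma sites_mono m n (X : E -> R) : (m <= n)%N ->
  bmfun (X : sites m -> R) -> bmfun (X : sites n -> R).
Proof.
move=> mn; apply: bmfun_sites_sub => k; rewrite /upto/= => km.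
by apply: le_trans km _; rewrite lez_nat.
Qed.

Lemma bmfun_beta n k : (k <= n)%N -> bmfun (fun e : sites n => bt e k).
Proof.
by move=> kn; apply: bmfun_omega.
Qed.

Lemma mean_beta_indep n (X : E -> R) : bmfun (X : sites n -> R) ->
  mean P (fun e => X e * bt e n.+1) = q * mean P X.
Proof.
move=> bX; have nJ : ~ upto n n.+1%:Z by rewrite /upto/= lez_nat ltnn.
rewrite (mean_indep omega_iid nJ bX mh _ h_bounded); last by move=> x; rewrite ltW.
rewrite mulrC; congr (_ * _); rewrite -mean_h.
exact: (mean_ident omega_iid _ _ mh (fun x => ltW (h0 x))).
Qed.

Lemma mean_beta2_indep n (X : E -> R) : bmfun (X : sites n -> R) ->
  mean P (fun e => X e * bt e n.+1 ^+ 2) = mean P X.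
Proof.
move=> bX; have nJ : ~ upto n n.+1%:Z by rewrite /upto/= lez_nat ltnn.
have mh2 : measurable_fun setT (fun x => h x ^+ 2) by exact: measurable_funX.
have h20 x : 0 <= h x ^+ 2 by rewrite sqr_ge0.
have h2b : exists M, forall x, `|h x ^+ 2| <= M.
  exists (bm ^+ 2) => x; rewrite ger0_norm// lerXn2r ?nnegrE// ?ltW//.
  exact: lt_le_trans (h0 x) (hbm x).
rewrite (mean_indep omega_iid nJ bX mh2 h20 h2b).
rewrite -[RHS]mulr1; congr (_ * _); rewrite -mean_h2.
exact: (mean_ident omega_iid _ _ mh2 h20).
Qed.

Variables (lam K : R) (n0 : nat).
Hypothesis lam0 : 0 <= lam.
Hypothesis K1 : 1 < K.

(* Any alpha in (0, 1) would do.  The growth rate r of the floor must satisfy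
   r > 1, so that the inverse products are summable, and r q < 1, so that the
   potential has a positive drift: r = 2 / (1 + q) does both. *)
Let alpha : R := 2^-1.
Let r : R := 2 / (1 + q).
Let C1 : R := 2 / (1 - q).
Let eta : R := alpha ^+ 2 * (1 - r * q) / 2.

Local Notation xi e := (xi lam (bt e)).
Local Notation clock e := (clock lam (bt e)).
Local Notation track e := (track lam alpha r C1 K n0 (bt e)).

Let bt0 e n : 0 < bt e n. Proof. exact: h0. Qed.
Let alpha01 : 0 < alpha < 1.
Proof. by rewrite /alpha; apply/andP; split; lra. Qed.
Let r1 : 1 < r.
Proof. by have /andP[q0 q1] := q01; rewrite /r ltr_pdivlMr; lra. Qed.
Let rq : r * q < 1.
Proof.
have /andP[q0 q1] := q01; rewrite /r mulrAC ltr_pdivrMr; lra.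
Qed.

Lemma bmfun_xi n : bmfun (fun e : sites n => xi e n).
Proof.
elim: n => [|n IH]; first exact: bmfun_cst.
apply: bmfunD; first exact: bmfun_cst.
by apply: bmfunM; [exact: bmfun_beta|exact: sites_mono IH].
Qed.

Lemma bmfun_zeta n : bmfun (fun e : sites n => zeta lam (bt e) n).
Proof.
elim: n => [|n IH]; first exact: bmfun_cst.
apply: bmfunD; first exact: bmfun_cst.
by apply: bmfunM; [apply: bmfunX; exact: bmfun_beta|exact: sites_mono IH].
Qed.

Lemma bmfun_clock n : bmfun (fun e : sites n => clock e n).
Proof.
elim: n => [|n IH].
  rewrite (_ : (fun e => _) = cst 1); first exact: bmfun_cst.
  by apply/funext => e; rewrite clock0.
rewrite (_ : (fun e => _) = (fun e => clock e n + 1 + zeta lam (bt e) n)).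
  apply: bmfunD; last exact: sites_mono (bmfun_zeta n).
  by apply: bmfunD; [exact: sites_mono IH|exact: bmfun_cst].
by apply/funext => e; rewrite clockS.
Qed.

Lemma bmfun_clock_inv n : bmfun (fun e : sites n => (clock e n)^-1).
Proof.
apply: (@bmfunV _ _ _ _ 1) => // [e|]; first exact: clock_ge1.
by case: (bmfun_clock n).
Qed.

Lemma bmfun_fresh_weight n : bmfun (fun e : sites n => fresh_weight lam C1 (bt e) n).
Proof.
apply: bmfunM; last exact: bmfun_clock_inv.
apply: bmfun_bool; apply: measurable_fun_ler => //.
by case: (bmfun_xi n).
Qed.

Lemma bmfun_track k : let n := (n0 + k)%N in
  [/\ bmfun (fun e : sites n => live (track e k)),
      bmfun (fun e : sites n => weight (track e k)),
      bmfun (fun e : sites n => height (track e k)) &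
      bmfun (fun e : sites n => floor (track e k))].
Proof.
elim: k => [|k].
  by split; try exact: bmfun_cst; rewrite addn0; exact: bmfun_fresh_weight.
move=> [bL bW bH bF] n.
have up (X : E -> R) : bmfun (X : sites (n0 + k)%N -> R) -> bmfun (X : sites n -> R).
  by apply: sites_mono; rewrite /n addnS.
move: bL bW bH bF => /up bL /up bW /up bH /up bF.
have bB : bmfun (fun e : sites n => bt e n) by exact: bmfun_beta.
have bHB := bmfunM bH bB.
have bFr := bmfunM bF (bmfun_cst _ r).
have mfresh : measurable_fun setT
   (fun e : sites n => fresh lam alpha r C1 K n0 (bt e) k).
  apply: measurable_or.
    by apply: measurable_fun_eqr => //; case: bW.
  by apply: measurable_fun_ler; [case: bHB|case: bFr].
have bW0 := bmfun_fresh_weight n.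
split.
- rewrite (_ : (fun e => _) = (fun e => live (track e k) *
    (weight (track e k) * (height (track e k) * bt e n) ^+ 2 < K)%R%:R)).
    apply: bmfunM => //; apply: bmfun_bool; apply: measurable_fun_ltr => //.
    by have [] := bmfunM bW (bmfunX 2 bHB).
  by apply/funext => e; rewrite trackS.
- rewrite (_ : (fun e => _) = (fun e => if fresh lam alpha r C1 K n0 (bt e) k
    then fresh_weight lam C1 (bt e) n else weight (track e k))); first exact: bmfun_if.
  by apply/funext => e; rewrite trackS.
- rewrite (_ : (fun e => _) = (fun e => if fresh lam alpha r C1 K n0 (bt e) k
    then 1 else height (track e k) * bt e n)).
    by apply: bmfun_if => //; exact: bmfun_cst.
  by apply/funext => e; rewrite trackS.
- rewrite (_ : (fun e => _) = (fun e => if fresh lam alpha r C1 K n0 (bt e) k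
    then alpha else floor (track e k) * r)).
    by apply: bmfun_if => //; exact: bmfun_cst.
  by apply/funext => e; rewrite trackS.
Qed.

Let lv k (e : E) := live (track e k).
Let D k : R := mean P (lv k).
Let pot k (e : E) := lv k e * potential alpha eta (xi e (n0 + k)) (clock e (n0 + k)) (track e k).
Let u k : R := mean P (fun e => lv k e / clock e (n0 + k)).

Let eta0 : 0 < eta.
Proof.
have /andP[al0 al1] := alpha01; have rq1 := rq.
by rewrite /eta divr_gt0// mulr_gt0 ?exprn_gt0//; lra.
Qed.

Let bmfun_lv k : bmfun (fun e : sites (n0 + k)%N => lv k e).
Proof. by have [] := bmfun_track k. Qed.

Let bmfun_pot k : bmfun (fun e : sites (n0 + k)%N => pot k e).
Proof.
have [bL bW bH bF] := bmfun_track k.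
apply: bmfunM => //; apply: bmfunB.
  apply: bmfunM => //; apply: bmfunB; last exact: bmfun_cst.
  by apply: bmfunB; [exact: bmfunX|exact: bmfunM].
apply: bmfunM; last exact: bmfun_clock_inv.
by apply: bmfunM; [exact: bmfun_cst|exact: bmfun_xi].
Qed.

Let bmfun_u k : bmfun (fun e : sites (n0 + k)%N => lv k e / clock e (n0 + k)).
Proof. by apply: bmfunM => //; exact: bmfun_clock_inv. Qed.

Let live_cases e k : live (track e k) = 0 \/
  live (track e k) = 1 /\ weight (track e k) * height (track e k) ^+ 2 < K.
Proof. by apply: live01. Qed.

(** The state of the tracker at time [k] is a function of the sites up to
    [n0 + k], hence independent of the next [beta]. *)
Lemma mean_potential_step k :
  mean P (pot k) + eta * u k <= mean P (pot k.+1) + bm ^+ 2 * K * (D k - D k.+1).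
Proof.
set n := (n0 + k)%N.
have [bL bW bH bF] := bmfun_track k.
have bX : bmfun (fun e : sites n => xi e n) := bmfun_xi n.
have bI : bmfun (fun e : sites n => (clock e n)^-1) := bmfun_clock_inv n.
pose A e := lv k e * (height (track e k) ^+ 2 * weight (track e k)).
pose B e := lv k e * (r * (floor (track e k) * height (track e k) * weight (track e k)))
   + lv k e * (eta * (xi e n * (clock e n)^-1)).
pose C e := lv k e * ((1 - alpha) * weight (track e k) + eta * (clock e n)^-1).
have bA : bmfun (A : sites n -> R).
  by apply: bmfunM => //; apply: bmfunM => //; exact: bmfunX.
have bB : bmfun (B : sites n -> R).
  apply: bmfunD; apply: bmfunM => //; (apply: bmfunM; first exact: bmfun_cst).
    by apply: bmfunM => //; exact: bmfunM.
  exact: bmfunM.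
have bC : bmfun (C : sites n -> R).
  by apply: bmfunM => //; apply: bmfunD; (apply: bmfunM => //; exact: bmfun_cst).
have bA' := bmfun_sites bA; have bB' := bmfun_sites bB; have bC' := bmfun_sites bC.
have bb : bmfun (fun e => bt e n.+1) by apply: (@bmfun_sites _ _ _ _ omega (upto n.+1)); exact: bmfun_beta.
have bAb : bmfun (fun e => A e * bt e n.+1 ^+ 2) by apply: bmfunM => //; exact: bmfunX.
have bBb : bmfun (fun e => B e * bt e n.+1) by exact: bmfunM.
have bqB : bmfun (fun e => q * B e) by apply: bmfunM => //; exact: bmfun_cst.
have mid : mean P (fun e => A e * bt e n.+1 ^+ 2 - B e * bt e n.+1 - C e) =
           mean P (fun e => A e - q * B e - C e).
  rewrite [LHS]meanB//; last exact: bmfunB.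
  rewrite [RHS]meanB//; last exact: bmfunB.
  rewrite [in LHS]meanB// [in RHS]meanB// meanZ//.
  by rewrite mean_beta2_indep// mean_beta_indep.
have bpot := bmfun_sites (bmfun_pot k); have bpot' := bmfun_sites (bmfun_pot k.+1).
have bu := bmfun_sites (bmfun_u k).
have blv := bmfun_sites (bmfun_lv k); have blv' := bmfun_sites (bmfun_lv k.+1).
have beu : bmfun (fun e => eta * (lv k e / clock e n)) by apply: bmfunM => //; exact: bmfun_cst.
have bd : bmfun (fun e => lv k e - lv k.+1 e) by exact: bmfunB.
have bcd : bmfun (fun e => bm ^+ 2 * K * (lv k e - lv k.+1 e)).
  by apply: bmfunM => //; exact: bmfun_cst.
have -> : mean P (pot k) + eta * u k = mean P (fun e => pot k e + eta * (lv k e / clock e n)).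
  by rewrite meanD// meanZ.
have -> : mean P (pot k.+1) + bm ^+ 2 * K * (D k - D k.+1) =
    mean P (fun e => pot k.+1 e + bm ^+ 2 * K * (lv k e - lv k.+1 e)).
  by rewrite meanD// meanZ// meanB.
apply: (@le_trans _ _ (mean P (fun e => A e - q * B e - C e))).
  apply: mean_le => [||e].
  - exact: bmfunD.
  - by apply: bmfunB => //; exact: bmfunB.
  have -> : A e - q * B e - C e = lv k e * ((height (track e k) ^+ 2 -
     floor (track e k) * r * (q * height (track e k)) - (1 - alpha)) * weight (track e k)
     - eta * (1 + q * xi e n) / clock e n) by rewrite /A /B /C; ring.
  exact: (potential_drift n0 (bt0 e) lam0 alpha01 r1 K1 k q01 rq erefl erefl).
rewrite -mid; apply: mean_le => [||e].
- by apply: bmfunB => //; exact: bmfunB.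
- exact: bmfunD.
have -> : A e * bt e n.+1 ^+ 2 - B e * bt e n.+1 - C e =
   lv k e * (((height (track e k) * bt e n.+1) ^+ 2 -
     floor (track e k) * r * (height (track e k) * bt e n.+1) - (1 - alpha))
      * weight (track e k) - eta * (1 + bt e n.+1 * xi e n) / clock e n).
  by rewrite /A /B /C; ring.
have := @potential_step _ lam alpha r C1 K n0 (bt e) (bt0 e) lam0 alpha01 r1 K1
   eta bm k (ltW eta0) (hbm _).
by rewrite /pot addnS.
Qed.

(** Telescoping of [mean_potential_step]: the potential is bounded above by [K]
    while the tracker is alive. *)
Lemma sum_mean_live_le : exists C : R, forall N, \sum_(0 <= k < N) u k <= C.
Proof.
have e0 := eta0.
exists ((K + bm ^+ 2 * K * D 0%N - mean P (pot 0%N)) / eta) => N.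
have S : eta * (\sum_(0 <= k < N) u k) <=
    mean P (pot N) - mean P (pot 0%N) + bm ^+ 2 * K * (D 0%N - D N).
  elim: N => [|N IH]; first by rewrite big_geq// mulr0 !subrr mulr0 addr0.
  rewrite big_nat_recr//= mulrDr.
  by have := mean_potential_step N; lra.
rewrite ler_pdivlMr// mulrC; apply: (le_trans S).
have DN : 0 <= D N.
  rewrite -(mean_cst P 0); apply: mean_le.
  - exact: bmfun_cst.
  - exact: bmfun_sites (bmfun_lv N).
  move=> e; rewrite /lv; case: (live_cases e N) => [->|[-> _]] //; exact: ler01.
have potK : mean P (pot N) <= K.
  rewrite -(mean_cst P K); apply: mean_le.
  - exact: bmfun_sites (bmfun_pot N).
  - exact: bmfun_cst.
  move=> e; rewrite /pot /lv; have k1 := K1; have /andP[al0 al1] := alpha01.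
  have [->|[-> gU]] := live_cases e N; first by rewrite mul0r; lra.
  have w0 : 0 <= weight (track e N).
    have : 0 <= weight (track e N) <= 1 by apply: weight_bounds.
    by case/andP.
  have f0 : alpha <= floor (track e N) by apply: floor_ge.
  have fU : floor (track e N) < height (track e N) by apply: height_gt_floor.
  have x0 : 0 <= xi e (n0 + N) by apply: xi_ge0.
  have a1 : 1 <= clock e (n0 + N) by apply: clock_ge1.
  rewrite mul1r /potential.
  have Y0 : 0 <= eta * xi e (n0 + N) / clock e (n0 + N).
    by apply: divr_ge0; [apply: mulr_ge0 => //; exact: ltW|lra].
  have Z0 : 0 <= (floor (track e N) * height (track e N) + (1 - alpha)) * weight (track e N).
    by apply: mulr_ge0 => //; apply: addr_ge0; [apply: mulr_ge0; lra|lra].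
  move: gU Y0 Z0; move: (_ * _ / _) => Y; lra.
have : 0 <= bm ^+ 2 * K * D N.
  by apply: mulr_ge0 => //; apply: mulr_ge0; [exact: sqr_ge0|have := K1; lra].
lra.
Qed.

Let bt_E k : bmfun (fun e => bt e k).
Proof. by apply: (@bmfun_sites _ _ _ _ omega (upto k)); exact: bmfun_beta. Qed.

Lemma bmfun_prodb j i : bmfun (fun e : sites j => prodb (bt e) i j).
Proof.
elim: j => [|j IH].
  rewrite (_ : (fun e => _) = cst 1); first exact: bmfun_cst.
  by apply/funext => e; rewrite /prodb big_geq.
have [ij|ji] := leqP i j; last first.
  rewrite (_ : (fun e => _) = cst 1); first exact: bmfun_cst.
  by apply/funext => e; rewrite /prodb big_geq.
rewrite (_ : (fun e => _) = (fun e => prodb (bt e) i j * bt e j.+1)).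
  by apply: bmfunM; [exact: sites_mono IH|exact: bmfun_beta].
by apply/funext => e; rewrite prodbS.
Qed.

Lemma mean_prodb j i : mean P (fun e => prodb (bt e) i j) = q ^+ (j - i).
Proof.
elim: j => [|j IH].
  rewrite sub0n expr0 -[RHS](mean_cst P 1); congr mean.
  by apply/funext => e; rewrite /prodb big_geq.
have [ij|ji] := leqP i j; last first.
  rewrite (_ : (j.+1 - i)%N = 0%N) ?expr0; last by apply/eqP; rewrite subn_eq0.
  rewrite -[RHS](mean_cst P 1); congr mean.
  by apply/funext => e; rewrite /prodb big_geq.
rewrite subSn// exprS -IH -(mean_beta_indep (bmfun_prodb j i)).
by congr mean; apply/funext => e; rewrite prodbS.
Qed.

Lemma mean_prodb2 j i : mean P (fun e => prodb (bt e) i j ^+ 2) = 1.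
Proof.
elim: j => [|j IH].
  rewrite -[RHS](mean_cst P 1); congr mean.
  by apply/funext => e; rewrite /prodb big_geq// expr1n.
have [ij|ji] := leqP i j; last first.
  rewrite -[RHS](mean_cst P 1); congr mean.
  by apply/funext => e; rewrite /prodb big_geq// expr1n.
rewrite -IH -[RHS](@mean_beta2_indep j); last by apply: bmfunX; exact: bmfun_prodb.
by congr mean; apply/funext => e; rewrite prodbS// exprMn.
Qed.

Let bmfun_prodb_E i j : bmfun (fun e => prodb (bt e) i j).
Proof. exact: bmfun_sites (bmfun_prodb j i). Qed.

Lemma window_count (L y : nat) :
  \sum_(0 <= i < y) (y < i.+1 + L)%N%:R <= (minn y L)%:R :> R.
Proof.
elim: y => [|y IH]; first by rewrite big_geq// min0n.
rewrite big_nat_recl//= add1n.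
have -> : \sum_(0 <= i < y) (y.+1 < i.+2 + L)%N%:R =
          \sum_(0 <= i < y) (y < i.+1 + L)%N%:R :> R.
  by apply: eq_bigr => i _; rewrite addSn ltnS.
rewrite ltnS; have [yL|Ly] := ltnP y L.
  rewrite (minn_idPl yL) -natr1 addrC lerD2r (le_trans IH)//.
  by rewrite ler_nat geq_minl.
by rewrite add0r (le_trans IH)// ler_nat leq_min geq_minr (leq_trans (geq_minl _ _)).
Qed.

Let bmfun_near_term L y i :
  bmfun (fun e => if (y < i.+1 + L)%N then prodb (bt e) i.+1 y ^+ 2 else 0).
Proof. by case: (y < i.+1 + L)%N; [exact: bmfunX|exact: bmfun_cst]. Qed.

Let bmfun_far_term L y i :
  bmfun (fun e => if (y < i.+1 + L)%N then 0 else prodb (bt e) i.+1 y).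
Proof. by case: (y < i.+1 + L)%N; [exact: bmfun_cst|]. Qed.

Let bmfun_near_col L y : bmfun (fun e => lam ^+ 2 * prodb (bt e) 0 y ^+ 2 +
  \sum_(0 <= i < y) (if (y < i.+1 + L)%N then prodb (bt e) i.+1 y ^+ 2 else 0)).
Proof.
apply: bmfunD; last exact: bmfun_sum.
by apply: bmfunM; [exact: bmfun_cst|exact: bmfunX].
Qed.

Lemma mean_near L n : mean P (fun e => near lam (bt e) L n) <= n%:R * (lam ^+ 2 + L%:R).
Proof.
rewrite [X in X <= _](mean_sum P (index_iota 0 n) (bmfun_near_col L)).
apply: (@le_trans _ _ (\sum_(0 <= y < n) (lam ^+ 2 + L%:R))); last first.
  by rewrite sumr_const_nat subn0 mulr_natl.
apply: ler_sum => y _.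
have b1 : bmfun (fun e => prodb (bt e) 0 y ^+ 2) by exact: bmfunX.
rewrite meanD; [|by apply: bmfunM => //; exact: bmfun_cst|exact: bmfun_sum].
rewrite meanZ// mean_prodb2 mulr1 lerD2l (mean_sum P (index_iota 0 y) (bmfun_near_term L y)).
apply: (@le_trans _ _ (minn y L)%:R); last by rewrite ler_nat geq_minr.
apply: le_trans (window_count L y); apply: ler_sum => i _.
by case: (y < i.+1 + L)%N; rewrite ?mean_prodb2 ?mean_cst.
Qed.

Lemma mean_far L n : mean P (fun e => far (bt e) L n) <= n%:R * n%:R * q ^+ L.
Proof.
have /andP[q0 q1] := q01.
have bcol y : bmfun (fun e => \sum_(0 <= i < y)
    (if (y < i.+1 + L)%N then 0 else prodb (bt e) i.+1 y)) by exact: bmfun_sum.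
rewrite [X in X <= _](mean_sum P (index_iota 0 n) bcol).
apply: (@le_trans _ _ (\sum_(0 <= y < n) (n%:R * q ^+ L))); last first.
  by rewrite sumr_const_nat subn0 -mulrA [leRHS]mulr_natl.
rewrite big_nat_cond [leRHS]big_nat_cond; apply: ler_sum => y; rewrite andbT => /andP[_ yn].
rewrite (mean_sum P (index_iota 0 y) (bmfun_far_term L y)).
apply: (@le_trans _ _ (\sum_(0 <= i < y) q ^+ L)).
  apply: ler_sum => i _; case: (ltnP y (i.+1 + L)) => yL.
    by rewrite mean_cst exprn_ge0.
  rewrite mean_prodb; apply: ler_wiXn2l => //; first exact: ltW.
  by rewrite leq_subRL// (leq_trans (leq_addr L _) yL).
rewrite sumr_const_nat subn0 -[leLHS]mulr_natl; apply: ler_wpM2r; first exact: exprn_ge0.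
by rewrite ler_nat ltnW.
Qed.

Lemma mean_live_over_clock (L k : nat) (l : R) : 0 < l -> let n := (n0 + k)%N in
  (D k - n%:R * (lam ^+ 2 + L%:R) / l - n%:R * n%:R * q ^+ L) / (n%:R + 2 + l) <= u k.
Proof.
move=> l0; cbv zeta; set n := (n0 + k)%N.
have den : 0 < n%:R + 2 + l by have : 0 <= n%:R :> R by []; lra.
have bnear : bmfun (fun e => near lam (bt e) L n) by exact: bmfun_sum.
have bfar : bmfun (fun e => far (bt e) L n) by apply: bmfun_sum => y; exact: bmfun_sum.
have blv := bmfun_sites (bmfun_lv k); have bu := bmfun_sites (bmfun_u k).
have bnl : bmfun (fun e => l^-1 * near lam (bt e) L n).
  by apply: bmfunM => //; exact: bmfun_cst.
have b1 : bmfun (fun e => lv k e - l^-1 * near lam (bt e) L n) by exact: bmfunB.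
have b2 : bmfun (fun e => lv k e - l^-1 * near lam (bt e) L n - far (bt e) L n).
  exact: bmfunB.
apply: (@le_trans _ _ (mean P (fun e => (n%:R + 2 + l)^-1 *
   (lv k e - l^-1 * near lam (bt e) L n - far (bt e) L n)))).
  rewrite meanZ// mulrC ler_pM2l ?invr_gt0// meanB// meanB// meanZ//.
  have : l^-1 * mean P (fun e => near lam (bt e) L n) <=
         l^-1 * (n%:R * (lam ^+ 2 + L%:R)).
    by rewrite ler_pM2l ?invr_gt0//; exact: mean_near.
  move=> h1; have h2 := mean_far L n.
  have -> : n%:R * (lam ^+ 2 + L%:R) / l = l^-1 * (n%:R * (lam ^+ 2 + L%:R)) by rewrite mulrC.
  have -> : mean P (fun e => lv k e) = D k by [].
  by apply: lerB => //; apply: lerB.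
apply: mean_le => //; first by apply: bmfunM => //; exact: bmfun_cst.
move=> e; have b0 := bt0 e.
have key : (1 - near lam (bt e) L n / l - far (bt e) L n) / (n%:R + 2 + l) <= (clock e n)^-1.
  by apply: clock_inv_lower.
have near0 : 0 <= near lam (bt e) L n.
  apply: sumr_ge0 => y _; apply: addr_ge0; first by rewrite mulr_ge0 ?sqr_ge0.
  by apply: sumr_ge0 => i _; case: ifP => // _; exact: sqr_ge0.
have far0 : 0 <= far (bt e) L n.
  apply: sumr_ge0 => y _; apply: sumr_ge0 => i _; case: ifP => // _.
  by apply: ltW; apply: prodb_gt0.
rewrite /lv; case: (live_cases e k) => [->|[-> _]].
  rewrite mul0r sub0r; apply: mulr_ge0_le0; first by rewrite invr_ge0 ltW.
  have : 0 <= l^-1 * near lam (bt e) L n by rewrite mulr_ge0 ?invr_ge0// ltW.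
  lra.
by rewrite mul1r mulrC [l^-1 * _]mulrC.
Qed.

(** Suppose that the tracker is alive with probability at least [del] at all
    times.  For [n] of order [2^j], take [L = L1 (j + 1)] and [l] of order
    [n L]: then [near <= l] and [far <= 1] fail with probability at most
    [del / 2], and [E (live_n / clock_n)] is at least of order [1 / (n j)],
    against [sum_mean_live_le]. *)
Lemma live_vanishes (del : R) : 0 < del -> exists k, D k < del.
Proof.
move=> del0; apply: contrapT => /forallNP Hk.
have Dge k : del <= D k by rewrite leNgt; apply/negP.
have /andP[q0 q1] := q01.
have [C uC] := sum_mean_live_le.
(* The factor 1/8 beats the factor n^2 <= 4^(j+1) in [mean_far] and leaves
   2^-(j+1). *)
have [L1 L1_gt0 qL1] : exists2 L1 : nat, (0 < L1)%N & q ^+ L1 <= 8^-1.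
  have qn : `|q| < 1 by rewrite ger0_norm.
  have e8 : 0 < 8^-1 :> R by lra.
  have /cvgrPdist_le/(_ _ e8)[k _ hk] := cvg_expr qn.
  exists k.+1 => //; have := hk k.+1 (leqnSn k).
  by rewrite sub0r normrN ger0_norm// exprn_ge0.
have [j1 hj1] : exists j1, 2^-1 ^+ j1 <= del / 4.
  have qn : `|2^-1 : R| < 1 by rewrite ger0_norm; lra.
  have e8 : 0 < del / 4 by lra.
  have /cvgrPdist_le/(_ _ e8)[k _ hk] := cvg_expr qn.
  exists k; have := hk k (leqnn k).
  by rewrite sub0r normrN ger0_norm// exprn_ge0.
pose G := 3 + 4 * (lam ^+ 2 + L1%:R) / del.
have L1R : 1 <= L1%:R :> R by rewrite ler1n.
have lam2 : 0 <= lam ^+ 2 by exact: sqr_ge0.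
have G0 : 0 < G.
  have : 0 <= 4 * (lam ^+ 2 + L1%:R) / del.
    by apply: divr_ge0; [apply: mulr_ge0; lra|exact: ltW].
  by rewrite /G; lra.
have u0 k : 0 <= u k.
  rewrite -(mean_cst P 0); apply: mean_le.
  - exact: bmfun_cst.
  - exact: bmfun_sites (bmfun_u k).
  move=> e; rewrite /lv; have a1 : 1 <= clock e (n0 + k) by apply: clock_ge1.
  by case: (live_cases e k) => [->|[-> _]]; apply: divr_ge0; lra.
apply: (@log_harmonic_unbounded R u (del / 2 / G) C n0 j1) => //.
  by apply: divr_gt0 => //; lra.
move=> j n jj n0n /andP[nj1 nj2]; set k := (n - n0)%N.
pose L := (L1 * j.+1)%N.
have nE : (n0 + k)%N = n by rewrite subnKC.
have n1 : 1 <= n%:R :> R by rewrite ler1n (leq_trans _ nj1)// expn_gt0.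
have L0 : 1 <= L%:R :> R by rewrite ler1n muln_gt0 L1_gt0.
have j1R : 1 <= j.+1%:R :> R by rewrite ler1n.
have n2 : n%:R <= 2 ^+ j.+1 :> R by rewrite -natrX ler_nat ltnW.
pose l := 4 * n%:R * (lam ^+ 2 + L%:R) / del.
have l0 : 0 < l by apply: divr_gt0 => //; apply: mulr_gt0; lra.
have := mean_live_over_clock L k l0; rewrite nE; apply: le_trans.
have t1 : n%:R * (lam ^+ 2 + L%:R) / l = del / 4.
  by rewrite /l; field; rewrite !gt_eqF//; lra.
have t2 : n%:R * n%:R * q ^+ L <= del / 4.
  apply: (@le_trans _ _ (2 ^+ j.+1 * 2 ^+ j.+1 * 8^-1 ^+ j.+1)).
    rewrite /L exprM; apply: ler_pM.
    - by apply: mulr_ge0; rewrite ler0n.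
    - by apply: exprn_ge0; apply: exprn_ge0.
    - by apply: ler_pM; rewrite ?ler0n.
    - by rewrite lerXn2r ?nnegrE ?exprn_ge0 ?invr_ge0.
  rewrite -!exprMn; have -> : 2 * 2 * 8^-1 = 2^-1 :> R by field.
  apply: le_trans hj1; apply: ler_wiXn2l; [by rewrite invr_ge0|by lra|].
  exact: leq_trans jj (leqnSn j).
have t3 : n%:R + 2 + l <= 2 ^+ j.+1 * j.+1%:R * G.
  apply: (@le_trans _ _ (n%:R * j.+1%:R * G)); last first.
    by apply: ler_wpM2r; [exact: ltW|apply: ler_wpM2r].
  have -> : l = n%:R * (4 * (lam ^+ 2 + L%:R) / del) by rewrite /l; field; rewrite gt_eqF.
  have : 4 * (lam ^+ 2 + L%:R) / del <= j.+1%:R * (4 * (lam ^+ 2 + L1%:R) / del).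
    rewrite mulrA ler_pM2r ?invr_gt0// mulrCA ler_pM2l// mulrDr /L natrM [L1%:R * _]mulrC.
    by rewrite lerD2r ler_peMl.
  rewrite /G; move: (4 * (lam ^+ 2 + L%:R) / del) (4 * (lam ^+ 2 + L1%:R) / del) => x y xy.
  have : n%:R * x <= n%:R * (j.+1%:R * y) by apply: ler_wpM2l => //; lra.
  have : n%:R <= n%:R * j.+1%:R :> R by rewrite ler_peMr//; lra.
  lra.
rewrite t1.
have dk := Dge k.
apply: (@le_trans _ _ (del / 2 / (n%:R + 2 + l))); last first.
  by apply: ler_wpM2r; [rewrite invr_ge0; lra|lra].
have -> : del / 2 / G / (2 ^+ j.+1 * j.+1%:R) = del / 2 / (2 ^+ j.+1 * j.+1%:R * G).
  by rewrite -[LHS]mulrA -invfM [G * _]mulrC.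
apply: ler_wpM2l; first by lra.
rewrite lef_pV2 ?posrE//; last by lra.
by rewrite !mulr_gt0 ?exprn_gt0//; lra.
Qed.

Lemma live_ae_dies :
  {ae P, forall e, exists k, live (track e k) = 0}.
Proof.
pose A k := [set e | live (track e k) = 1].
have mA k : measurable (A k).
  have [mL _] := bmfun_sites (bmfun_lv k).
  by have := mL measurableT [set 1] (measurable_set1 _); rewrite setTI.
have PA k : P (A k) = (D k)%:E.
  rewrite /D -mean_fin; last exact: bmfun_sites (bmfun_lv k).
  rewrite -[A k]setIT -(integral_indic P measurableT (mA k)).
  apply: eq_integral => e _; rewrite /lv indicE; congr (_%:E).
  case: (live_cases e k) => [l0|[l1 _]].
    by rewrite memNset ?l0//= /A/= l0 => /eqP; rewrite eq_sym oner_eq0.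
  by rewrite mem_set.
exists (\bigcap_k A k); split.
- exact: bigcapT_measurable.
- apply/eqP; rewrite -measure_le0; apply/lee_addgt0Pr => del del0; rewrite add0e.
  have [k hk] := live_vanishes del0.
  apply: (@le_trans _ _ (P (A k))); last by rewrite PA lee_fin ltW.
  by apply: le_measure; rewrite ?inE//; [exact: bigcapT_measurable|exact: bigcap_inf].
- move=> e /= ne k _; case: (live_cases e k) => [l0|[]//].
  by exfalso; apply: ne; exists k.
Qed.

(** Applied for all [n0], this yields barriers arbitrarily far to the right. *)
Lemma ae_barrier : {ae P, forall e, exists b m,
  [/\ (n0 <= b < m)%N, xi e b <= C1, K * clock e b <= prodb (bt e) b m ^+ 2 &
    forall j, (b < j < m)%N -> alpha * r ^+ (j - b) < prodb (bt e) b j]}.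
Proof.
apply: filterS live_ae_dies => e [k dead].
by apply: dead_has_barrier dead.
Qed.

End RandomTracker.

(** * Finite mass on the left *)

Section LeftSum.
Context {dE : measure_display} {E : measurableType dE} {R : realType}.
Variables (P : probability E R) (omega : int -> {RV P >-> R}).
Hypothesis omega_iid : iid omega.
Variables (h : R -> R) (bm q : R).
Hypothesis mh : measurable_fun setT h.
Hypothesis h0 : forall x, 0 < h x.
Hypothesis hbm : forall x, h x <= bm.
Hypothesis q01 : 0 <= q < 1.
Hypothesis mean_h : mean P (fun e => h (omega 0 e)) = q.

(** Product of [beta] over the sites [0, -1, ..., - k + 1]; its power
    [2 / kappa] is [E (- k) / E 0]. *)
Definition leftprod (e : E) (k : nat) : R := \prod_(0 <= i < k) h (omega (- i%:Z) e).

Let left_sites (k : nat) : set int := [set j | - k%:Z < j].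

Let h_bounded : exists M, forall x, `|h x| <= M.
Proof. by exists bm => x; rewrite ger0_norm// ltW. Qed.

Let bmfun_leftprod k : bmfun (fun e : sites omega (left_sites k) => leftprod e k).
Proof.
elim: k => [|k IH].
  rewrite (_ : (fun e => _) = cst 1); first exact: bmfun_cst.
  by apply/funext => e; rewrite /leftprod big_geq.
rewrite (_ : (fun e => _) = (fun e => leftprod e k * h (omega (- k%:Z) e))).
  apply: bmfunM; last by apply: bmfun_omega => //; rewrite /left_sites/=; lia.
  by apply: bmfun_sites_sub IH => j; rewrite /left_sites/=; lia.
by apply/funext => e; rewrite /leftprod big_nat_recr.
Qed.

Let mean_leftprod k : mean P (fun e => leftprod e k) = q ^+ k.
Proof.
elim: k => [|k IH].
  rewrite expr0 -[RHS](mean_cst P 1); congr mean.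
  by apply/funext => e; rewrite /leftprod big_geq.
have kJ : ~ left_sites k (- k%:Z) by rewrite /left_sites/= ltxx.
rewrite exprSr -IH -mean_h (mean_ident omega_iid 0 (- k%:Z) mh (fun x => ltW (h0 x))).
rewrite -(mean_indep omega_iid kJ (bmfun_leftprod k) mh (fun x => ltW (h0 x)) h_bounded).
by congr mean; apply/funext => e; rewrite /leftprod big_nat_recr.
Qed.

Let geometric_le n : \sum_(0 <= k < n) q ^+ k <= (1 - q)^-1.
Proof.
have /andP[q0 q1] := q01.
have e : (\sum_(0 <= k < n) q ^+ k) * (1 - q) = 1 - q ^+ n.
  elim: n => [|n IH]; first by rewrite big_geq// mul0r expr0 subrr.
  by rewrite big_nat_recr//= mulrDl IH exprS; ring.
rewrite -[X in _ <= X]mul1r ler_pdivlMr; last by lra.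
by rewrite e; have := exprn_ge0 n q0; lra.
Qed.

(** The expected sum is at most [1 / (1 - q)].  An integer bound is recorded so
    that countably many values of the initial condition of the perpetuities
    suffice. *)
Lemma ae_left_sum_bounded :
  {ae P, forall e, exists lam : nat, forall n, \sum_(0 <= k < n) leftprod e k <= lam%:R}.
Proof.
pose f k (e : E) := (leftprod e k)%:E.
have lp0 e k : 0 <= leftprod e k by apply: prodr_ge0 => i _; exact: ltW.
have bE k := bmfun_sites (bmfun_leftprod k).
have mf k : measurable_fun setT (f k) by apply/measurable_EFinP; case: (bE k).
have f0 k e : setT e -> (0 <= f k e)%E by rewrite lee_fin.
pose F e := (\sum_(k <oo) f k e)%E.
have mF : measurable_fun setT F by apply: ge0_emeasurable_sum => // k e _ _; exact: f0.
have F0 e : (0 <= F e)%E by apply: nneseries_ge0 => k _ _; exact: f0.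
have intF : P.-integrable setT F.
  apply/integrableP; split => //.
  under eq_integral do rewrite gee0_abs//.
  rewrite integral_nneseries//.
  apply: (@le_lt_trans _ _ ((1 - q)^-1)%:E); last by rewrite ltry.
  apply: lime_le.
    by apply: is_cvg_nneseries => k _ _; apply: integral_ge0 => e _; exact: f0.
  apply: nearW => n.
  under eq_bigr => k _ do rewrite (mean_fin P (bE k)) mean_leftprod.
  by rewrite sumEFin lee_fin.
have := integrable_ae measurableT intF; apply: filterS => e /(_ I) Ffin.
exists (Num.truncn (fine (F e))).+1 => n.
have F0' : 0 <= fine (F e) by exact: fine_ge0.
have /andP[_ h2] := truncn_itv F0'; apply: le_trans (ltW h2).
rewrite -lee_fin fineK// -sumEFin.
by apply: nneseries_lim_ge => k _ _; exact: f0.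
Qed.

End LeftSum.

(** * From barriers to valleys *)

Section PowerSuperadditive.
Context {R : realType} (s : R).
Hypothesis s1 : 1 <= s.

Let s0 : 0 <= s. Proof. by have := s1; lra. Qed.

Lemma powR_superadd (x y : R) : 0 <= x -> 0 <= y -> x `^ s + y `^ s <= (x + y) `^ s.
Proof.
move=> x0 y0; have h1 := s1.
have sn0 : s != 0 by rewrite gt_eqF//; lra.
have key (u v : R) : 0 <= u -> u <= v -> u `^ s <= u * v `^ (s - 1).
  move=> u0 uv; have [->|un0] := eqVneq u 0; first by rewrite powR0// mul0r.
  have up : 0 < u by rewrite lt_neqAle eq_sym un0.
  have -> : u `^ s = u `^ 1 * u `^ (s - 1).
    by rewrite -powRD ?un0 ?implybT//; congr (_ `^ _); lra.
  rewrite powRr1//.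
  apply: ler_wpM2l => //; apply: ge0_ler_powR; rewrite ?nnegrE//; lra.
have [xy0|xyn0] := eqVneq (x + y) 0.
  have -> : x = 0 by lra.
  have -> : y = 0 by lra.
  by rewrite addr0 powR0// addr0.
have xyp : 0 < x + y by rewrite lt_neqAle eq_sym xyn0 addr_ge0.
have -> : (x + y) `^ s = (x + y) `^ 1 * (x + y) `^ (s - 1).
  by rewrite -powRD ?xyn0 ?implybT//; congr (_ `^ _); lra.
rewrite powRr1 ?(ltW xyp)// mulrDl; apply: lerD; apply: key => //; lra.
Qed.

Lemma powR_superadd_sum (I : Type) (l : seq I) (F : I -> R) :
  (forall i, 0 <= F i) -> \sum_(i <- l) F i `^ s <= (\sum_(i <- l) F i) `^ s.
Proof.
move=> F0; elim: l => [|i l IH]; first by rewrite !big_nil powR_ge0.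
rewrite !big_cons; apply: le_trans (powR_superadd (F0 i) _); last by rewrite sumr_ge0.
by rewrite lerD2l.
Qed.

End PowerSuperadditive.

Lemma geometric_sum_le (R : realFieldType) (t : R) j : 0 <= t -> t < 1 ->
  \sum_(0 <= i < j) 2 * t ^+ i.+1 <= 2 / (1 - t).
Proof.
move=> t0 t1.
have e : (\sum_(0 <= i < j) 2 * t ^+ i.+1) * (1 - t) + 2 * t ^+ j.+1 = 2 * t.
  elim: j => [|j IH]; first by rewrite big_geq// mul0r add0r expr1.
  by rewrite big_nat_recr//= -[RHS]IH [t ^+ j.+2]exprS; ring.
rewrite ler_pdivlMr; last by lra.
have : 0 <= t ^+ j.+1 by rewrite exprn_ge0.
lra.
Qed.

(** With [s = 1 / kappa], the weights satisfy
    [E b / E m = (prod beta)^(2 s)].  As powers of exponent at least 1 are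
    superadditive, [W = B / E] is at most [xi^(2 s)] and at most [zeta^s], the
    comparison of the recurrences being an induction. *)
Section Valleys.
Context {R : realType}.
Variables (w : int -> R) (eps : R) (be : int -> R) (s lam r C1 : R).
Hypothesis eps0 : 0 < eps.
Hypothesis wE : forall y, eps <= w y <= 1 - eps.
Hypothesis s2 : 2 <= s.
Hypothesis be0 : forall y, 0 < be y.
Hypothesis rhoE : forall y, rho (w y) = be y `^ (2 * s).
Hypothesis lam0 : 0 <= lam.
Hypothesis left_sum : forall n,
  \sum_(0 <= k < n) \prod_(0 <= i < k) be (- i%:Z) <= lam.
Hypothesis r1 : 1 < r.
Hypothesis C1_ge0 : 0 <= C1.
Local Notation beta := (fun n : nat => be n%:Z).
Variable K : R.
Hypothesis K_def : K = 1200 / eps ^+ 2.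
Hypothesis barriers : forall n0, exists b m,
  [/\ (n0 <= b < m)%N, xi lam beta b <= C1, K * clock lam beta b <= prodb beta b m ^+ 2 &
    forall j, (b < j < m)%N -> 2^-1 * r ^+ (j - b) < prodb beta b j].

Let p := 2 * s.
Let p1 : 1 <= p. Proof. by have := s2; rewrite /p; lra. Qed.
Let s1 : 1 <= s. Proof. by have := s2; lra. Qed.

Lemma valleys_exist : exists (E B : int -> R) (C : R),
  [/\ 0 < C, forall y, 0 < E y, forall y, E (y - 1) * w y = (1 - w y) * E y &
   [/\ forall y, 0 <= B y, forall y, B y = B (y - 1) + E y &
   forall b0 : nat, exists b m : nat, (b0 <= b)%N /\ valley eps E B C b m]].
Proof.
have e0 := eps0; have h1 := r1; have hp := p1; have hs := s1.
have w0 y : 0 < w y by have := wE y; lra.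
have rho0 y : 0 < rho (w y) by rewrite rhoE powR_gt0.
have [F FS F0] := int_primitive (fun y => - ln (rho (w (y + 1)))) 0.
pose E y := expR (F y).
have E0 y : 0 < E y by exact: expR_gt0.
have ES y : E (y + 1) * rho (w (y + 1)) = E y.
  by rewrite /E FS expRD expRN lnK ?posrE// mulfVK// gt_eqF.
have E00 : E 0 = 1 by rewrite /E (F0 0%N) big_geq// addr0 expR0.
have EB y : E (y - 1) = rho (w y) * E y by have := ES (y - 1); rewrite subrK mulrC.
have EE y : E (y - 1) * w y = (1 - w y) * E y.
  by rewrite EB /rho mulrAC divfK// gt_eqF.
have Eright b j : E b%:Z = E (b + j)%N%:Z * prodb beta b (b + j) `^ p.
  elim: j => [|j IH]; first by rewrite addn0 prodb_id powR1 mulr1.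
  have pp : 0 < prodb beta b (b + j) by apply: prodr_gt0.
  rewrite IH addnS prodbS ?leq_addr// powRM ?ltW// mulrA mulrAC; congr (_ * _).
  have -> : (b + j).+1%:Z = (b + j)%N%:Z + 1 by rewrite -addn1 PoszD.
  by rewrite /p -rhoE ES.
have Eleft k : E (- k%:Z) = (\prod_(0 <= i < k) be (- i%:Z)) `^ p.
  elim: k => [|k IH]; first by rewrite oppr0 E00 big_geq// powR1.
  have pp : 0 < \prod_(0 <= i < k) be (- i%:Z) by apply: prodr_gt0.
  have -> : - k.+1%:Z = - k%:Z - 1 by rewrite -addn1 PoszD opprD.
  by rewrite EB IH rhoE big_nat_recr//= powRM ?ltW// mulrC.
have [B BS Bn] := int_primitive (fun y => E (y + 1)) (lam `^ p).
have BE y : B y = B (y - 1) + E y by have := BS (y - 1); rewrite subrK.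
have Bneg k : B (- k%:Z) = lam `^ p - \sum_(0 <= i < k) E (- i%:Z).
  elim: k => [|k IH]; first by rewrite oppr0 (Bn 0%N) !big_geq// addr0 subr0.
  rewrite big_nat_recr//= opprD addrA -IH.
  have -> : - k.+1%:Z = - k%:Z - 1 by rewrite -addn1 PoszD opprD.
  by have := BE (- k%:Z); lra.
have B0 y : 0 <= B y.
  case: y => n; first by rewrite Bn addr_ge0 ?powR_ge0// sumr_ge0// => i _; exact: ltW.
  rewrite NegzE Bneg subr_ge0.
  apply: (@le_trans _ _ (\sum_(0 <= i < n.+1) (\prod_(0 <= j < i) be (- j%:Z)) `^ p)).
    by apply: ler_sum => i _; rewrite Eleft.
  apply: le_trans (powR_superadd_sum p1 _ _) _.
    by move=> i; apply: ltW; apply: prodr_gt0.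
  have P0 : 0 <= \sum_(0 <= i < n.+1) \prod_(0 <= j < i) be (- j%:Z).
    by apply: sumr_ge0 => i _; apply: ltW; apply: prodr_gt0.
  by apply: ge0_ler_powR; rewrite ?nnegrE//; lra.
pose W (n : nat) := B n%:Z / E n%:Z.
have W0 : W 0%N = lam `^ p by rewrite /W (Bn 0%N) big_geq// addr0 E00 divr1.
have WS n : W n.+1 = 1 + beta n.+1 `^ p * W n.
  have nE : n.+1%:Z = n%:Z + 1 by rewrite -addn1 PoszD.
  rewrite /W /p -rhoE nE BS -(ES n%:Z).
  have := E0 (n%:Z + 1); have := rho0 (n%:Z + 1).
  move: (E (n%:Z + 1)) (B n%:Z) (rho _) => x z t t0 x0.
  by field; rewrite !gt_eqF.
have b0 n : 0 < beta n by exact: be0.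
have xi0 n : 0 <= xi lam beta n by apply: xi_ge0.
have zeta0 n : 0 <= zeta lam beta n by apply: zeta_ge0.
have Wxi n : W n <= xi lam beta n `^ p.
  elim: n => [|n IH]; first by rewrite W0.
  rewrite WS /=; apply: le_trans (powR_superadd p1 ler01 _); last first.
    by rewrite mulr_ge0// ltW.
  rewrite powR1 lerD2l powRM//; last exact: ltW.
  by apply: ler_wpM2l => //; exact: powR_ge0.
have sqr_p x : 0 <= x -> x `^ p = (x ^+ 2) `^ s.
  by move=> x0; rewrite /p powRrM -powR_mulrn.
have Wzeta n : W n <= zeta lam beta n `^ s.
  elim: n => [|n IH]; first by rewrite W0 /= sqr_p.
  rewrite WS /=; apply: le_trans (powR_superadd s1 ler01 _); last first.
    by rewrite mulr_ge0// sqr_ge0.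
  rewrite powR1 lerD2l powRM ?sqr_ge0// -sqr_p; last exact: ltW.
  by apply: ler_wpM2l => //; exact: powR_ge0.
(* Superadditivity of x^s, applied to 1, b and each zeta; the inequality
   b^2 <= b^s uses s >= 2. *)
have scale b : time_scale E B b <= clock lam beta b `^ s.
  rewrite /time_scale /clock.
  have S0 : 0 <= \sum_(0 <= y < b) zeta lam beta y by exact: sumr_ge0.
  apply: le_trans (powR_superadd s1 _ S0); last by rewrite addr_ge0.
  apply: lerD.
    apply: le_trans (powR_superadd s1 ler01 _) => //.
    rewrite powR1 lerD2l; case: b {S0} => [|b]; first by rewrite expr0n/= powR_ge0.
    by rewrite -powR_mulrn// ler_powR// ler1n.
  apply: le_trans (powR_superadd_sum s1 _ _) => //.
  by apply: ler_sum => y _; exact: Wzeta.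
have K1 : 1 <= K.
  have e1 : eps <= 1 by have := wE 0; lra.
  rewrite K_def ler_pdivlMr ?exprn_gt0// mul1r (@le_trans _ _ 1)//; last by lra.
  by rewrite expr_le1// ltW.
pose t := r^-1.
have t0 : 0 < t by rewrite invr_gt0; lra.
have t1 : t < 1 by rewrite invf_lt1//; lra.
have geo j : \sum_(0 <= i < j) 2 * t ^+ i.+1 <= 2 / (1 - t).
  by apply: geometric_sum_le => //; exact: ltW.
(* B (m - 1) / E b splits into B b / E b <= xi_b^p <= C1^p and the sum over
   b < y < m of (prod beta)^-p, dominated by a geometric series through the
   floor 2^-1 r^(y - b). *)
pose C := C1 `^ p + (2 / (1 - t)) `^ p + 1.
have C0 : 0 < C.
  by have := powR_ge0 C1 p; have := powR_ge0 (2 / (1 - t)) p; rewrite /C; lra.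
exists E, B, C; split => //; split => // m0.
have [b [m [/andP[m0b bm] xC KU Hj]]] := barriers m0.
exists b, m; split => //.
have [j mE] : exists j, m = (b + j.+1)%N by exists (m - b.+1)%N; rewrite addnS -addSn subnKC.
split => //; last first.
  rewrite -K_def (Eright b j.+1) -mE mulrC; apply: ler_wpM2l; first exact: ltW.
  have U0 : 0 <= prodb beta b m by apply: ltW; apply: prodr_gt0.
  have a1 : 0 <= clock lam beta b by apply: le_trans ler01 _; apply: clock_ge1.
  have K0 : 0 <= K := le_trans ler01 K1.
  rewrite sqr_p//; apply: (@le_trans _ _ ((K * clock lam beta b) `^ s)); last first.
    by apply: ge0_ler_powR; rewrite ?nnegrE ?sqr_ge0//; [exact: le_trans ler01 hs|exact: mulr_ge0].
  rewrite powRM//; apply: ler_pM => //.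
    rewrite /time_scale !addr_ge0 ?sqr_ge0// sumr_ge0// => y _.
    by apply: divr_ge0 => //; exact: ltW.
  by rewrite -[X in X <= _](powRr1 (ltW (lt_le_trans ltr01 K1))) ler_powR.
have -> : m%:Z - 1 = (b + j)%N%:Z by rewrite mE addnS -addn1 PoszD addrK.
have Bsum i : B (b + i)%N%:Z = B b%:Z + \sum_(0 <= k < i) E (b + k.+1)%N%:Z.
  elim: i => [|i IH]; first by rewrite addn0 big_geq// addr0.
  rewrite big_nat_recr//= addrA -IH.
  have -> : (b + i.+1)%N%:Z = (b + i)%N%:Z + 1 by rewrite addnS -addn1 PoszD.
  exact: BS.
rewrite Bsum /C mulrDl mulrDl mul1r -addrA; apply: lerD.
  have : W b <= C1 `^ p.
    by apply: le_trans (Wxi b) _; apply: ge0_ler_powR; rewrite ?nnegrE//; lra.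
  by rewrite /W ler_pdivrMr.
apply: (@le_trans _ _ (\sum_(0 <= k < j) (2 * t ^+ k.+1) `^ p * E b)).
  rewrite big_nat_cond [leRHS]big_nat_cond; apply: ler_sum => k; rewrite andbT => /andP[_ kj].
  rewrite (Eright b k.+1).
  have U0 : 0 < prodb beta b (b + k.+1) by apply: prodr_gt0.
  have T0 : 0 < 2 * t ^+ k.+1 by rewrite mulr_gt0// exprn_gt0.
  have one : 1 <= 2 * t ^+ k.+1 * prodb beta b (b + k.+1).
    have cond : (b < b + k.+1 < m)%N.
      by rewrite mE ltn_add2l ltnS kj andbT addnS ltnS leq_addr.
    have := Hj _ cond; rewrite addKn => /ltW hU.
    apply: (@le_trans _ _ (2 * t ^+ k.+1 * (2^-1 * r ^+ k.+1))); last first.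
      by apply: ler_wpM2l => //; exact: ltW.
    have -> : 2 * t ^+ k.+1 * (2^-1 * r ^+ k.+1) = (t * r) ^+ k.+1.
      by rewrite exprMn; field.
    by rewrite /t mulVf ?expr1n// gt_eqF//; lra.
  rewrite mulrCA -(powRM p (ltW T0) (ltW U0)); apply: ler_peMr; first exact: ltW.
  have e1 : 1 `^ p = 1 :> R by rewrite powR1.
  rewrite -[X in X <= _]e1; apply: ge0_ler_powR; rewrite ?nnegrE//.
    exact: le_trans ler01 hp.
  exact: le_trans ler01 one.
rewrite -mulr_suml.
have : \sum_(0 <= k < j) (2 * t ^+ k.+1) `^ p <= (2 / (1 - t)) `^ p.
  have T0 k : 0 <= 2 * t ^+ k.+1 by rewrite mulr_ge0// exprn_ge0// ltW.
  apply: le_trans (powR_superadd_sum p1 _ T0) _.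
  apply: ge0_ler_powR; rewrite ?nnegrE//; [lra|by rewrite sumr_ge0|].
  by apply: divr_ge0; lra.
move=> hS; have := E0 b%:Z => Eb.
have := ler_wpM2r (ltW Eb) hS; lra.
Qed.

End Valleys.

(** * The random environment *)

Section Environment.
Context {dE : measure_display} {E : measurableType dE} {R : realType}.
Variables (P : probability E R) (omega : int -> {RV P >-> R}).
Hypothesis omega01 : forall y e, 0 < omega y e < 1.
Hypothesis omega_iid : iid omega.
Variables (eps kappa : R).
Hypothesis eps0 : 0 < eps < 2^-1.
Hypothesis omega_eps : P [set e | eps <= omega 0 e <= 1 - eps] = 1%E.
Hypothesis drift : ('E_P[fun e => (ln (rho (omega 0 e)))%R] < 0)%E.
Hypothesis kappa0 : 0 < kappa < 2^-1.
Hypothesis mean_rho : ('E_P[fun e => (rho (omega 0 e) `^ kappa)%R] = 1)%E.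

(** The ellipticity bounds hold only almost surely; clamping makes [rho_power]
    bounded everywhere and changes nothing almost surely. *)
Definition clamp (x : R) : R := Num.max eps (Num.min x (1 - eps)).

Definition rho_power (x : R) : R := rho (clamp x) `^ (kappa / 2).

Let clamp_itv x : eps <= clamp x <= 1 - eps.
Proof.
have /andP[e0 e1] := eps0; rewrite /clamp le_max lexx/= ge_max ge_min lexx orbT andbT.
lra.
Qed.

Let clamp_id x : eps <= x <= 1 - eps -> clamp x = x.
Proof. by move=> /andP[x0 x1]; rewrite /clamp (min_idPl x1) (max_idPr x0). Qed.

Let rho_clamp_gt0 x : 0 < rho (clamp x).
Proof.
have /andP[e0 e1] := eps0; have /andP[h1 h2] := clamp_itv x.
by rewrite /rho divr_gt0//; lra.
Qed.

Let rho_clamp_le x : rho (clamp x) <= eps^-1.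
Proof.
have /andP[e0 e1] := eps0; have /andP[h1 h2] := clamp_itv x.
rewrite /rho ler_pdivrMr; last by lra.
apply: (@le_trans _ _ 1); first by lra.
by rewrite mulrC ler_pdivlMr ?mul1r.
Qed.

Let rho_power_gt0 x : 0 < rho_power x.
Proof. by rewrite powR_gt0. Qed.

Let bound : R := eps^-1 `^ (kappa / 2).

Let rho_power_le x : rho_power x <= bound.
Proof.
have /andP[e0 e1] := eps0; have /andP[k0 k1] := kappa0.
apply: ge0_ler_powR; rewrite ?nnegrE//; first by lra.
- exact: ltW.
- by rewrite invr_ge0 ltW.
Qed.

Let measurable_clamp : measurable_fun setT clamp.
Proof.
by apply: measurable_maxr => //; apply: measurable_minr.
Qed.

Let measurable_rho_clamp : measurable_fun setT (fun x => rho (clamp x)).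
Proof.
have /andP[e0 e1] := eps0.
apply: measurable_funM; first exact: measurable_funB.
by have [] := @bmfunV _ _ _ clamp eps e0 (fun x => proj1 (andP (clamp_itv x))) measurable_clamp.
Qed.

Let measurable_rho_power : measurable_fun setT rho_power.
Proof.
rewrite (_ : rho_power = (@powR R ^~ (kappa / 2)) \o (fun x => rho (clamp x)))//.
exact: measurableT_comp.
Qed.

Let omega_clamp : {ae P, forall e, forall y, eps <= omega y e <= 1 - eps}.
Proof.
pose A y := [set e | ~ (eps <= omega y e <= 1 - eps)].
have A0 y : P.-negligible (A y).
  have mB : measurable (`[eps, 1 - eps]%classic : set R) by exact: measurable_itv.
  have e1 : P (omega y @^-1` `[eps, 1 - eps]%classic) = 1%E.
    have [_ /(_ y 0 _ mB)] := omega_iid.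
    rewrite /distribution /pushforward => ->; rewrite -omega_eps; congr (P _).
  exists (~` (omega y @^-1` `[eps, 1 - eps]%classic)); split.
  - by apply: measurableC; exact: measurable_omega.
  - by rewrite probability_setC ?e1 ?subee//; exact: measurable_omega.
  - by move=> e /= h; rewrite in_itv.
have : P.-negligible (\bigcup_n (A n%:Z `|` A (- n%:Z))).
  by apply: negligible_bigcup => n; apply: negligibleU.
apply: negligibleS => e /= /existsNP[y hy].
case: y hy => n hy; first by exists n => //; left.
by exists n.+1 => //; right; rewrite -NegzE.
Qed.

Let q := mean P (fun e => rho_power (omega 0 e)).

Let rho_power_sq x : rho_power x ^+ 2 = rho (clamp x) `^ kappa.
Proof.
rewrite /rho_power -powR_mulrn ?powR_ge0// -powRrM; congr (_ `^ _).
by rewrite divfK.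
Qed.

Let bmfun_rho_power y : bmfun (fun e => rho_power (omega y e)).
Proof.
apply: (@bmfun_sites _ _ _ _ omega setT); apply: bmfun_omega => //.
by exists bound => x; rewrite ger0_norm// ltW.
Qed.

Let measurable_rho_omega : measurable_fun setT (fun e => rho (omega 0 e)).
Proof.
apply: measurable_funM; first exact: measurable_funB.
rewrite (_ : (fun e => _) = (@powR R ^~ (-1)) \o omega 0); first exact: measurableT_comp.
by apply/funext => e /=; rewrite powR_inv1//; have /andP[/ltW] := omega01 0 e.
Qed.

Let mean_rho_power_sq : mean P (fun e => rho_power (omega 0 e) ^+ 2) = 1.
Proof.
apply: EFin_inj; rewrite -mean_fin; last exact: bmfunX.
rewrite -mean_rho unlock; apply: ae_eq_integral => //.
- by apply/measurable_EFinP; case: (bmfunX 2 (bmfun_rho_power 0)).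
- apply/measurable_EFinP.
  exact: (measurableT_comp (f := @powR R ^~ kappa) (g := fun e => rho (omega 0 e))).
apply: filterS omega_clamp => e he _.
by rewrite rho_power_sq clamp_id.
Qed.

(** [E (beta - 1)^2 = 2 - 2 q]; were it zero, [rho] would be almost surely 1,
    against the negative mean of its logarithm. *)
Let q01 : 0 <= q < 1.
Proof.
have bh := bmfun_rho_power 0; have bh2 := bmfunX 2 bh.
have b1 := @bmfun_cst _ E R 1.
have b2h : bmfun (fun e => 2 * rho_power (omega 0 e)).
  by apply: bmfunM => //; exact: bmfun_cst.
have bsq : bmfun (fun e => (rho_power (omega 0 e) - 1) ^+ 2).
  by apply: bmfunX; exact: bmfunB.
have V : mean P (fun e => (rho_power (omega 0 e) - 1) ^+ 2) = 2 - 2 * q.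
  rewrite (_ : (fun e => _) =
    (fun e => rho_power (omega 0 e) ^+ 2 - 2 * rho_power (omega 0 e) + 1)).
    have b3 := bmfunB bh2 b2h.
    by rewrite meanD// meanB// meanZ// mean_cst mean_rho_power_sq -/q; ring.
  by apply/funext => e; ring.
have V0 : 0 <= mean P (fun e => (rho_power (omega 0 e) - 1) ^+ 2).
  by rewrite -(mean_cst P 0); apply: mean_le => // [|e]; [exact: bmfun_cst|exact: sqr_ge0].
apply/andP; split.
  by rewrite -(mean_cst P 0); apply: mean_le => // [|e]; [exact: bmfun_cst|exact: ltW].
rewrite lt_neqAle; apply/andP; split; last by lra.
apply/eqP => q1.
have V1 : mean P (fun e => (rho_power (omega 0 e) - 1) ^+ 2) = 0 by rewrite V q1; lra.
have msq : measurable_fun setT (fun e => ((rho_power (omega 0 e) - 1) ^+ 2)%:E).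
  by apply/measurable_EFinP; case: bsq.
have ae1 : ae_eq P setT (fun e => ((rho_power (omega 0 e) - 1) ^+ 2)%:E) (cst 0%E).
  apply/(ae_eq_integral_abs P measurableT msq).
  under eq_integral do rewrite gee0_abs ?lee_fin ?sqr_ge0//.
  by rewrite mean_fin// V1.
have ae2 : ae_eq P setT (fun e => (ln (rho (omega 0 e)))%:E) (cst 0%E).
  apply: filterS2 ae1 omega_clamp => e h1 h2 _.
  have /eqP := h1 I; rewrite eqe sqrf_eq0 subr_eq0 => /eqP hw1.
  have r0 : 0 < rho (omega 0 e) by rewrite -(clamp_id (h2 0)).
  have : rho_power (omega 0 e) ^+ 2 = 1 by rewrite hw1 expr1n.
  rewrite rho_power_sq clamp_id// => /(congr1 (@ln R)); rewrite ln_powR ln1 => /eqP.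
  have /andP[k0 _] := kappa0.
  by rewrite mulf_eq0 gt_eqF//= => /eqP->.
move: drift; rewrite unlock (@ae_eq_integral _ _ _ P setT (cst 0%E) _ measurableT _ _ ae2)//.
  by rewrite integral0 ltxx.
apply/measurable_EFinP.
exact: (measurableT_comp (f := @ln R) (g := fun e => rho (omega 0 e))).
Qed.

Lemma ae_valleys : {ae P, forall e,
  [/\ forall y, eps <= omega y e <= 1 - eps &
    exists (Ec B : int -> R) (C : R),
    [/\ 0 < C, forall y, 0 < Ec y,
        forall y, Ec (y - 1) * omega y e = (1 - omega y e) * Ec y &
     [/\ forall y, 0 <= B y, forall y, B y = B (y - 1) + Ec y &
     forall b0 : nat, exists b m : nat, (b0 <= b)%N /\ valley eps Ec B C b m]]]}.
Proof.
have /andP[e0 e1] := eps0; have /andP[k0 k1] := kappa0; have /andP[q0 q1] := q01.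
have K1 : 1 < 1200 / eps ^+ 2.
  rewrite ltr_pdivlMr ?exprn_gt0// mul1r; apply: (@lt_trans _ _ 1); last by lra.
  by rewrite expr_lt1//; [lra|exact: ltW].
pose bar (lam n0 : nat) := ae_barrier omega_iid measurable_rho_power rho_power_gt0
  rho_power_le q01 erefl mean_rho_power_sq n0 (ler0n R lam) K1.
have bars : {ae P, forall e, forall lam n0 : nat, exists b m,
  [/\ (n0 <= b < m)%N, xi lam%:R (beta_of omega rho_power e) b <= 2 / (1 - q),
    1200 / eps ^+ 2 * clock lam%:R (beta_of omega rho_power e) b <=
       prodb (beta_of omega rho_power e) b m ^+ 2 &
    forall j, (b < j < m)%N ->
      2^-1 * (2 / (1 + q)) ^+ (j - b) < prodb (beta_of omega rho_power e) b j]}.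
  by apply/ae_foralln => lam; apply/ae_foralln => n0; exact: bar.
have left := ae_left_sum_bounded omega_iid measurable_rho_power rho_power_gt0
  rho_power_le q01 erefl.
apply: filterS3 omega_clamp left bars => e he [lam hlam] hbar; split => //.
have s2 : 2 <= kappa^-1.
  by rewrite -[2]invrK lef_pV2 ?posrE ?invr_gt0//; exact: ltW.
have rhoE y : rho (omega y e) = rho_power (omega y e) `^ (2 * kappa^-1).
  rewrite /rho_power clamp_id// -powRrM.
  have -> : kappa / 2 * (2 * kappa^-1) = 1 by field; rewrite gt_eqF.
  by rewrite powRr1// -(clamp_id (he y)); exact: ltW.
have r1 : 1 < 2 / (1 + q) by rewrite ltr_pdivlMr; lra.
have C1 : 0 <= 2 / (1 - q) by apply: divr_ge0; lra.
exact: (@valleys_exist R (fun y => omega y e) eps (fun y => rho_power (omega y e))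
  kappa^-1 lam%:R (2 / (1 + q)) (2 / (1 - q)) e0 he s2 _ rhoE (ler0n _ _) hlam r1 C1 _ erefl (hbar lam)).
Qed.

End Environment.

(** * Infinitely many meetings *)

Lemma not_infinite_bounded (A : set nat) : ~ infinite_set A ->
  exists n, forall k, (n <= k)%N -> ~ A k.
Proof.
move=> /contrapT finA.
exists (\max_(i <- fset_set A) i).+1 => k nk Ak.
have : (k <= \max_(i <- fset_set A) i)%N.
  by apply: (leq_bigmax_seq (F := id)) => //; rewrite in_fset_set// mem_set.
by rewrite leqNgt nk.
Qed.

Theorem theorem1p1 (R : realType) (d : nat) (hd : (1 <= d)%N)
  (dE : measure_display) (E : measurableType dE) (P : probability E R)
  (omega : int -> {RV P >-> R})
  (omega01 : forall y e, 0 < omega y e < 1)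
  (omega_iid : iid omega)
  (hi : exists eps0 : R, 0 < eps0 < 2^-1 /\
     P [set e | eps0 <= omega 0 e <= 1 - eps0] = 1%E)
  (hii : ('E_P[fun e => (ln (rho (omega 0 e)))%R] < 0)%E)
  (hiii : exists kappa : R, 0 < kappa < 2^-1 /\
     ('E_P[fun e => (rho (omega 0 e) `^ kappa)%R] = 1)%E)
  (x : 'I_d -> int) (z : int) (hparity : same_parity x z)
  (dT : measure_display) (T : measurableType dT)
  (S : 'I_d -> nat -> {mfun T >-> int}) (Z : nat -> {mfun T >-> int})
  (Q : R.-pker E ~> T)
  (hQ : forall e, quenched_law (fun y => omega y e) x z S Z (Q e)) :
  {ae annealed P Q, forall t,
     infinite_set [set n : nat | forall j : 'I_d, S j n t = Z n t]}.
Proof.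
have [eps [eps0 omega_eps]] := hi; have [kappa [kappa0 mean_rho]] := hiii.
have start_par : coparity (start x z).
  move=> i; case: hparity => -[hx hz]; case: i => [j|] //=; rewrite /evenz.
    by rewrite hx hz.
  by rewrite (negbTE (hx j)) (negbTE hz).
pose bad := \bigcup_n \bigcap_N no_meet S Z n N.
have mbad : measurable bad.
  apply: bigcupT_measurable => n; apply: bigcapT_measurable => N.
  exact: measurable_no_meet.
have Qbad : {ae P, forall e, Q e bad = 0%E}.
  have := ae_valleys omega01 omega_iid eps0 omega_eps hii kappa0 mean_rho.
  apply: filterS => e [he [Ec [B [C [C0 Ec0 EcE [B0 BE hval]]]]]].
  have /andP[e0 e1] := eps0.
  have w01 y : 0 <= omega y e <= 1 by have := he y => ?; apply/andP; split; lra.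
  have Q1 : Q e [set: T] = 1%E by exact: prob_kernel.
  have collide s : coparity s -> exists N,
      avoid (walk_proba (fun y => omega y e)) (@meet d) N s <= 1 - (eps / (8 * C)) ^+ d / 2.
    move=> cs; exact: (quenched_meeting e0 he Ec0 EcE B0 BE C0 hval cs).
  have c0 : 0 < (eps / (8 * C)) ^+ d / 2.
    by rewrite divr_gt0// exprn_gt0// divr_gt0// mulr_gt0.
  have c1 : (eps / (8 * C)) ^+ d / 2 <= 1.
    have [N hN] := collide _ start_par.
    have : 0 <= avoid (walk_proba (fun y => omega y e)) (@meet d) N (start x z).
      by apply: avoid_ge0 => i y; exact: walk_proba01.
    lra.
  have neg := meet_infinitely_often Q1 w01 (hQ e) start_par (introT andP (conj c0 c1)) collide.
  exact: measure_negligible neg.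
exists bad; split => //.
- rewrite /annealed (ae_eq_integral (cst 0%E))//.
  + by rewrite integral0.
  + exact: measurable_kernel.
  + by apply: filterS Qbad => e he _.
- move=> t /= /not_infinite_bounded[n hn]; exists n => // N _ k /= /andP[nk _].
  apply/negP => /forallP hm; apply: (hn k nk) => j.
  exact/eqP/(hm j).
Qed.
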